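(* Let $M$ be a connected smooth manifold and let $\theta$ be a closed non-exact $1$-form on $M$. Let $\rho\colon \pi_1(M)\to (\mathbb{R}_+^*,\times)$ denote the representation associated to the de Rham class $[\theta]\in H^1_{\mathrm{dR}}(M)$. Then the following assertions hold: (1) If $H^1_\theta(M)\neq 0$, then there exists an indecomposable representation $\xi\colon \pi_1(M)\to \mathrm{GL}_2(\mathbb{R})$ with $\det\xi=\rho$, which fixes the vector $\begin{pmatrix} 1 \\ 0\end{pmatrix}\in\mathbb{R}^2$. (2) Conversely, if there exists an indecomposable representation $\xi\colon \pi_1(M)\to \mathrm{GL}_2(\mathbb{R})$ with $\det\xi=\rho$ which fixes the vector $\begin{pmatrix} 1 \\ 0\end{pmatrix}\in\mathbb{R}^2$, then $H^1_\theta(M)\neq 0$.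
   Context: Twisted cohomology: for a closed $1$-form $\theta$ on $M$, the twisted differential is $d_\theta:=d-\theta\wedge\colon\Omega^k(M)\to\Omega^{k+1}(M)$; it satisfies $d_\theta\circ d_\theta=0$, and $H^k_\theta(M):=\ker(d_\theta|_{\Omega^k(M)})/d_\theta(\Omega^{k-1}(M))$. These groups depend, up to isomorphism, only on the de Rham class of $\theta$. Representation associated to $[\theta]$: let $\pi\colon\widetilde M\to M$ be the universal cover, with $\pi_1(M)$ acting on $\widetilde M$ by deck transformations. Choose $\varphi\in C^\infty(\widetilde M)$ with $\pi^*\theta=d\varphi$. For each $\gamma\in\pi_1(M)$ there is a constant $c_\gamma\in\mathbb{R}$ with $\gamma^*\varphi=\varphi+c_\gamma$, and $\rho(\gamma):=e^{c_\gamma}$ defines a group morphism $\rho\colon\pi_1(M)\to(\mathbb{R}^*_+,\times)$ which depends only on $[\theta]$. A representation $\xi\colon\Gamma\to\mathrm{GL}_2(\mathbb{R})$ (group morphism) is decomposable if $\mathbb{R}^2$ is the direct sum of two one-dimensional $\xi(\Gamma)$-invariant subspaces, and indecomposable otherwise. It fixes a vector $v$ if $\xi(\gamma)v=v$ for all $\gamma\in\Gamma$. *)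

(* Defs.v *)
From HB Require Import structures.
From mathcomp Require Import all_boot all_order all_algebra.
From mathcomp Require Import all_classical all_reals all_analysis.

Set Implicit Arguments.
Unset Strict Implicit.
Unset Printing Implicit Defensive.

Import Order.TTheory GRing.Theory Num.Theory numFieldNormedType.Exports.

Local Open Scope classical_set_scope.
Local Open Scope ring_scope.

Definition partial (R : realType) (n : nat) (i : 'I_n) (f : 'rV[R]_n -> R^o)
    (x : 'rV[R]_n) : R :=
  'D_(delta_mx 0 i) f x.

Fixpoint Ck (R : realType) (n k : nat) (U : set 'rV[R]_n)
    (f : 'rV[R]_n -> R^o) : Prop :=
  {in U, continuous f} /\
  if k is k'.+1 then
    forall i : 'I_n,
      (forall x, U x -> derivable f x (delta_mx 0 i)) /\
      Ck k' U (partial i f)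
  else True.

(* Meaningful for open U only, which is the only case used below. *)
Definition Cinfty (R : realType) (n : nat) (U : set 'rV[R]_n)
    (f : 'rV[R]_n -> R^o) : Prop :=
  forall k, Ck k U f.

(* The two maps are total functions; only their restrictions to chart_dom and
   chart_rng, which are inverse homeomorphisms, matter. *)
Record chart (R : realType) (n : nat) (M : topologicalType) := Chart {
  chart_dom : set M;
  chart_rng : set 'rV[R]_n;
  chart_map :> M -> 'rV[R]_n;
  chart_inv : 'rV[R]_n -> M;
  chart_dom_open : open chart_dom;
  chart_rng_open : open chart_rng;
  chart_map_rng : forall p, chart_dom p -> chart_rng (chart_map p);
  chart_inv_dom : forall x, chart_rng x -> chart_dom (chart_inv x);
  chart_mapK : forall p, chart_dom p -> chart_inv (chart_map p) = p;
  chart_invK : forall x, chart_rng x -> chart_map (chart_inv x) = x;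
  chart_map_cont : {in chart_dom, continuous chart_map};
  chart_inv_cont : {in chart_rng, continuous chart_inv}
}.

(* A smooth n-manifold without boundary, its smooth structure being given by an
   atlas that need not be maximal. *)
Record manifold (R : realType) (n : nat) := Manifold {
  carrier :> topologicalType;
  manifold_hausdorff : hausdorff_space carrier;
  manifold_second_countable : @second_countable carrier;
  atlas_idx : Type;
  atlas : atlas_idx -> chart R n carrier;
  atlas_cover : forall p : carrier, exists a, chart_dom (atlas a) p;
  atlas_smooth : forall (a b : atlas_idx) (j : 'I_n),
    Cinfty [set x | chart_rng (atlas a) x /\
                    chart_dom (atlas b) (chart_inv (atlas a) x)]
           (fun x => (atlas b) (chart_inv (atlas a) x) 0 j)
}.

Section SmoothMaps.
Context (R : realType) (n : nat).
Implicit Types M N : manifold R n.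

Definition smooth_fun M (f : M -> R) : Prop :=
  forall a : atlas_idx M,
    Cinfty (chart_rng (atlas a)) (fun x => f (chart_inv (atlas a) x)).

(* For V open. *)
Definition smooth_on M N (V : set M) (F : M -> N) : Prop :=
  {in V, continuous F} /\
  forall (a : atlas_idx M) (b : atlas_idx N) (j : 'I_n),
    Cinfty [set x | [/\ chart_rng (atlas a) x,
                        V (chart_inv (atlas a) x) &
                        chart_dom (atlas b) (F (chart_inv (atlas a) x))]]
           (fun x => (atlas b) (F (chart_inv (atlas a) x)) 0 j).

End SmoothMaps.

Section Forms.
Context (R : realType) (n : nat).
Implicit Types M N : manifold R n.

(* A 1-form is given by its components in each chart of the atlas: w a x is the
   row (w_1(x), ..., w_n(x)) with w = \sum_i w_i dx^i on the domain of the
   chart a, read at the point x of chart_rng (atlas a).  Values at x outside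
   chart_rng are irrelevant. *)
Definition form1 M := atlas_idx M -> 'rV[R]_n -> 'rV[R]_n.

Definition form1_eq M (w1 w2 : form1 M) : Prop :=
  forall a x, chart_rng (atlas a) x -> w1 a x = w2 a x.

(* eta = F^* w, for F smooth. *)
Definition is_pullback M N (F : M -> N) (w : form1 N) (eta : form1 M) : Prop :=
  forall (b : atlas_idx M) (a : atlas_idx N) (y : 'rV[R]_n),
    chart_rng (atlas b) y ->
    chart_dom (atlas a) (F (chart_inv (atlas b) y)) ->
    eta b y = \row_i \sum_(j < n)
      w a (atlas a (F (chart_inv (atlas b) y))) 0 j *
      partial i (fun z => (atlas a) (F (chart_inv (atlas b) z)) 0 j) y.

(* Pulling back along the identity is the change of coordinates rule. *)
Definition is_form1 M (w : form1 M) : Prop :=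
  (forall a (j : 'I_n),
     Cinfty (chart_rng (atlas a)) (fun x => w a x 0 j)) /\
  is_pullback idfun w w.

Definition d0 M (f : M -> R) : form1 M :=
  fun a x => \row_i partial i (fun z => f (chart_inv (atlas a) z)) x.

(* 2-forms, also in charts: w a x is the antisymmetric matrix of the components
   w_ij(x) with w = \sum_(i < j) w_ij dx^i /\ dx^j. *)
Definition form2 M := atlas_idx M -> 'rV[R]_n -> 'M[R]_n.

Definition form2_zero M (w : form2 M) : Prop :=
  forall a x, chart_rng (atlas a) x -> w a x = 0.

Definition d1 M (w : form1 M) : form2 M :=
  fun a x => \matrix_(i, j) (partial i (fun z => w a z 0 j) x -
                             partial j (fun z => w a z 0 i) x).

Definition wedge11 M (v w : form1 M) : form2 M :=
  fun a x => \matrix_(i, j) (v a x 0 i * w a x 0 j - v a x 0 j * w a x 0 i).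

Definition closed1 M (w : form1 M) : Prop := form2_zero (d1 w).

Definition exact1 M (w : form1 M) : Prop :=
  exists2 f : M -> R, smooth_fun f & form1_eq w (d0 f).

Definition dtw0 M (theta : form1 M) (f : M -> R) : form1 M :=
  fun a x => d0 f a x - f (chart_inv (atlas a) x) *: theta a x.

Definition dtw1 M (theta : form1 M) (w : form1 M) : form2 M :=
  fun a x => d1 w a x - wedge11 theta w a x.

Definition twisted_cocycles M (theta : form1 M) : set (form1 M) :=
  [set w | is_form1 w /\ form2_zero (dtw1 theta w)].

Definition twisted_coboundaries M (theta : form1 M) : set (form1 M) :=
  [set w | exists2 f : M -> R, smooth_fun f & form1_eq w (dtw0 theta f)].

(* The quotient of the cocycles by the coboundaries is not the zero space. *)
Definition twisted_H1_neq0 M (theta : form1 M) : Prop :=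
  exists2 w, twisted_cocycles theta w & ~ twisted_coboundaries theta w.

End Forms.

Section Loops.
Context (R : realType).
Implicit Types T : topologicalType.

(* Paths are total functions on R; only their values on [0, 1] matter. *)
Definition is_path T (x y : T) (g : R -> T) : Prop :=
  [/\ {within `[0, 1], continuous g}, g 0 = x & g 1 = y].

Definition is_loop T (x : T) (g : R -> T) : Prop := is_path x x g.

Definition path_homotopic T (g1 g2 : R -> T) : Prop :=
  exists H : R * R -> T,
    [/\ {within `[0, 1] `*` `[0, 1], continuous H},
        forall t : R, t \in `[0, 1] -> H (0, t) = g1 t,
        forall t : R, t \in `[0, 1] -> H (1, t) = g2 t &
        forall s : R, s \in `[0, 1] -> H (s, 0) = g1 0 /\ H (s, 1) = g1 1].

Definition path_concat T (g1 g2 : R -> T) : R -> T :=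
  fun t => if t <= 2^-1 then g1 (2 * t) else g2 (2 * t - 1).

Definition simply_connected T : Prop :=
  (forall x y : T, exists g, is_path x y g) /\
  (forall (x : T) (g : R -> T), is_loop x g -> path_homotopic g (cst x)).

End Loops.

(* A representation of pi_1(T, x0) on R^2 (column vectors), as a matrix-valued
   function of loops at x0 that is constant on homotopy classes and turns
   concatenation into product; its values at functions that are not loops at
   x0 are irrelevant. *)
Definition pi1_rep (R : realType) (T : topologicalType) (x0 : T)
    (xi : (R -> T) -> 'M[R]_2) : Prop :=
  [/\ forall g, is_loop x0 g -> xi g \in unitmx,
      forall g1 g2, is_loop x0 g1 -> is_loop x0 g2 ->
        path_homotopic g1 g2 -> xi g1 = xi g2 &
      forall g1 g2, is_loop x0 g1 -> is_loop x0 g2 ->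
        xi (path_concat g1 g2) = xi g1 *m xi g2].

Definition rep_invariant (R : realType) (T : topologicalType) (x0 : T)
    (xi : (R -> T) -> 'M[R]_2) (L : {vspace 'cV[R]_2}) : Prop :=
  forall g, is_loop x0 g -> forall v, v \in L -> xi g *m v \in L.

Definition decomposable (R : realType) (T : topologicalType) (x0 : T)
    (xi : (R -> T) -> 'M[R]_2) : Prop :=
  exists L1 L2 : {vspace 'cV[R]_2},
    [/\ \dim L1 = 1%N /\ \dim L2 = 1%N,
        (L1 + L2)%VS = fullv /\ (L1 :&: L2)%VS = 0%VS,
        rep_invariant x0 xi L1 &
        rep_invariant x0 xi L2].

Section UniversalCover.
Context (R : realType) (n : nat).
Implicit Types M N : manifold R n.

(* Over V, the map p is the projection of a disjoint union of copies of V. *)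
Definition evenly_covered M N (p : N -> M) (V : set M) : Prop :=
  exists (J : Type) (U : J -> set N) (s : J -> M -> N),
    [/\ forall j, open (U j),
        trivIset setT U,
        p @^-1` V = \bigcup_j U j &
        forall j, [/\ smooth_on V (s j),
                      forall q, V q -> U j (s j q),
                      forall q, V q -> p (s j q) = q &
                      forall y, U j y -> s j (p y) = y]].

Definition smooth_covering M N (p : N -> M) : Prop :=
  [/\ smooth_on setT p,
      range p = setT &
      forall q : M, exists V : set M, [/\ open V, V q & evenly_covered p V]].

Definition universal_cover M N (p : N -> M) : Prop :=
  smooth_covering p /\ simply_connected R N.

Definition deck_transformation M N (p : N -> M) (h : N -> N) : Prop :=
  [/\ continuous h,
      exists h', [/\ continuous h', cancel h h' & cancel h' h] &
      forall y, p (h y) = p y].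

(* h is the deck transformation by which the class of the loop g at p y0 acts:
   it sends y0 to the end point of the lift of g that starts at y0. *)
Definition pi1_acts_by M N (p : N -> M) (y0 : N) (g : R -> M) (h : N -> N) :
    Prop :=
  deck_transformation p h /\
  exists2 lift : R -> N, is_path y0 (h y0) lift &
    forall t : R, t \in `[0, 1] -> p (lift t) = g t.

(* rho g = e^(c g), where p^* theta = d phi and g^* phi = phi + c g. *)
Definition assoc_rep M N (p : N -> M) (y0 : N) (theta : form1 M)
    (rho : (R -> M) -> R) : Prop :=
  exists (phi : N -> R) (act : (R -> M) -> N -> N) (c : (R -> M) -> R),
    [/\ smooth_fun phi,
        is_pullback p theta (d0 phi) &
        forall g, is_loop (p y0) g ->
          [/\ pi1_acts_by p y0 g (act g),
              forall y, phi (act g y) = phi y + c g &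
              rho g = expR (c g)]].

End UniversalCover.

(* Main.v *)
(* Over the universal cover [p : Mt -> M] write [p^* theta = dphi].  A form [w]
   with [dw = theta /\ w] corresponds to the closed form [exp(-phi) p^* w = dh],
   and [h] transforms under the deck transformation of a loop [g] by
   [h (g y) = rho(g)^-1 h y + b g].  The affine cocycle [b] is the same thing as
   the representation [[1, rho b], [0, rho]], which is decomposable exactly when
   [b g = (1 - rho(g)^-1) u] for a constant [u], that is, when
   [exp(phi) (h - u)] descends to a primitive of [w] on [M].

   From [w] to the representation, [phi] and [h] are not built on [Mt]: pairs of
   local primitives on [M] form a flat connection on [M * R * R], and [(phi, h)]
   is its holonomy along loops.  Conversely, an [h] with prescribed [b] is a
   smooth average of locally constant ones, which needs a partition of unity. *)

(* Producing [phi] or [h] on [Mt] from a form would itself require transport along paths and its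
   invariance under homotopy. Both are therefore proved once, for an abstract flat connection whose
   total space carries no topology; the same theory, applied to the covering, supplies path lifting
   and the properties of deck transformations. Adding constants of integration is an affine symmetry
   of the connection on [M * R * R]. It carries transport from one starting point to transport from
   another, which is why concatenation of loops becomes a product of triangular matrices. The first
   coordinate is matched with the given [phi] by comparing two primitives of the pulled-back [theta]
   along a lifted loop. In the other direction the transformation law of [h] is affine, so it
   survives averaging with weights coming from [M], and local solutions can be glued; the failure of
   the average to be locally constant is what the form [exp(phi) dh] records. That form is read on
   [M] through lifts, and its independence of the lift is where [rho] and [rho^-1] cancel. *)
Require Import Defs.
From mathcomp Require Import all_boot all_order all_algebra ring lra.
From mathcomp Require Import all_classical all_reals all_analysis.

Set Implicit Arguments.
Unset Strict Implicit.
Unset Printing Implicit Defensive.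

Import Order.TTheory GRing.Theory Num.Theory numFieldNormedType.Exports.

Local Open Scope classical_set_scope.
Local Open Scope ring_scope.

(* The [filter] lemmas of the library fail to find the filter instance of the
   neighbourhoods of a matrix or of a pair; these instances for points do not. *)
Section Near.
Context (T : topologicalType).
Implicit Types (x : T) (P Q S : T -> Prop).
Lemma nearS x P Q : (forall z, P z -> Q z) -> (\forall z \near x, P z) -> \forall z \near x, Q z.
Proof. exact: filterS. Qed.
Lemma nearS2 x P Q S : (forall z, P z -> Q z -> S z) -> (\forall z \near x, P z) ->
 (\forall z \near x, Q z) -> \forall z \near x, S z.
Proof. exact: filterS2. Qed.
Lemma nearI x P Q : (\forall z \near x, P z) -> (\forall z \near x, Q z) ->
 \forall z \near x, P z /\ Q z.
Proof. exact: filterI. Qed.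
Lemma near_forall x (I : finType) (P : I -> T -> Prop) : (forall i, \forall z \near x, P i z) ->
   \forall z \near x, forall i, P i z.
Proof. exact: filter_forall. Qed.
Lemma near_near x P : (\forall z \near x, P z) -> \forall z \near x, \forall y \near z, P y.
Proof. exact: nbhs_interior. Qed.
Lemma near_self x P : (\forall z \near x, P z) -> P x.
Proof. exact: nbhs_singleton. Qed.
Lemma near_all x P : (forall z, P z) -> \forall z \near x, P z.
Proof. by move=> H; near=> z. Unshelve. all: by end_near. Qed.
Lemma near_cvg (U : topologicalType) (f g : T -> U) x (l : U) :
  (\forall y \near x, f y = g y) -> f @ x --> l -> g @ x --> l.
Proof.
by move=> fg; apply: cvg_trans; apply: near_eq_cvg; apply: filterS fg => y ->.
Qed.
Lemma near_dist (R : realType) (f : T -> R) x (e : R) : {for x, continuous f} -> 0 < e ->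
  \forall y \near x, `|f x - f y| < e.
Proof. by move=> cf e0; exact: cvgr_dist_lt. Qed.
Lemma near_comp (U : topologicalType) (f : T -> U) x (P : U -> Prop) : {for x, continuous f} ->
  (\forall y \near f x, P y) -> \forall z \near x, P (f z).
Proof. by move=> cf nP; exact: (cf _ nP). Qed.
Lemma near_open (A : set T) x : open A -> A x -> \forall z \near x, A z.
Proof. by move=> oA Ax; exact: open_nbhs_nbhs. Qed.
End Near.

(** * Paths and parallel transport *)

Section RealInduction.
Context (R : realType).

(** If [P] failed somewhere, the supremum of the initial intervals on which it holds would satisfy
    [P] and could still be passed. This replaces subdivisions of [0, 1] and Lebesgue numbers in the
    lifting arguments below. *)
Lemma real_induction (P : R -> Prop) :
  P 0 ->
  (forall t, 0 <= t -> P t -> \forall x \near t, t <= x -> P x) ->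
  (forall t, 0 < t -> (forall s, 0 <= s < t -> P s) -> P t) ->
  forall t, 0 <= t -> P t.
Proof.
move=> P0 Pstep Plim t t_ge0; apply: contrapT => nPt.
pose A := [set x : R | 0 <= x /\ forall s, 0 <= s <= x -> P s].
have A0 : A 0 by split=> // s; rewrite -eq_le => /eqP <-.
have ubA : ubound A t.
  move=> x [x_ge0 Ax]; rewrite leNgt; apply/negP => tx.
  by apply: nPt; apply: Ax; rewrite t_ge0 ltW.
have hsA : has_sup A by split; [exists 0 | exists t].
set c := sup A.
have c_ge0 : 0 <= c by exact: ub_le_sup hsA.2 _ A0.
have Pltc s : 0 <= s < c -> P s.
  move=> /andP[s0 sc].
  have [x [x_ge0 Ax] sx] := sup_adherent (eps := c - s) (ltac:(by rewrite subr_gt0)) hsA.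
  by apply: Ax; rewrite s0/= ltW//; rewrite -/c in sx; lra.
have Pc : P c.
  have [c0|c0] := leP c 0; last exact: Plim.
  by have -> : c = 0 by lra.
have [e /= e0 He] := (nbhs_ballP _ _).1 (Pstep _ c_ge0 Pc).
have : A (c + e / 2).
  split=> [|s /andP[s0 sce]]; first lra.
  have [sc|cs] := ltP s c; first by apply: Pltc; rewrite s0.
  apply: He => //=; rewrite /ball/=.
  rewrite ltr_norml; lra.
by move=> /(ub_le_sup hsA.2); rewrite -/c; lra.
Qed.

End RealInduction.

(* A flat connection presented by its local parallel transports: [tr_map i e q]
   moves the point [e] of the total space to the fibre of [q] inside the patch
   [i].  Both coverings and systems of local primitives are of this form. *)
Record transport (B : topologicalType) := Transport {
  tr_tot : Type;
  tr_pr : tr_tot -> B;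
  tr_idx : Type;
  tr_dom : tr_idx -> set B;
  tr_map : tr_idx -> tr_tot -> B -> tr_tot;
  tr_dom_open : forall i, open (tr_dom i);
  tr_dom_cover : forall q, exists i, tr_dom i q;
  tr_mapE : forall i e q, tr_dom i (tr_pr e) -> tr_dom i q ->
    tr_pr (tr_map i e q) = q;
  tr_map_id : forall i e, tr_dom i (tr_pr e) -> tr_map i e (tr_pr e) = e;
  tr_map_trans : forall i e q q',
    tr_dom i (tr_pr e) -> tr_dom i q -> tr_dom i q' ->
    tr_map i (tr_map i e q) q' = tr_map i e q';
  tr_map_near : forall i i' e, tr_dom i (tr_pr e) -> tr_dom i' (tr_pr e) ->
    \forall q \near tr_pr e, tr_map i e q = tr_map i' e q
}.

(** * Horizontal lifts: local form and uniqueness *)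

Section Lifts.
Context (R : realType) (B : topologicalType) (S : transport B).
Implicit Types (g : R -> B) (L : R -> tr_tot S) (e : tr_tot S).
Notation pr := (@tr_pr B S).
Notation V := (@tr_dom B S).
Notation tau := (@tr_map B S).

(** As the total space has no topology, continuity of a lift is replaced by agreement near [t] with
    the transport of its own value at [t]. *)
Definition lift_at g L (t : R) := pr (L t) = g t /\
  forall i, V i (g t) -> \forall x \near t, L x = tau i (L t) (g x).

(** One patch suffices, since by [tr_map_near] the transports of two patches agree near the base
    point. *)
Lemma lift_atI g L t i : {for t, continuous g} ->
  pr (L t) = g t -> V i (g t) ->
  (\forall x \near t, L x = tau i (L t) (g x)) -> lift_at g L t.
Proof.
move=> cg pL Vi near_i; split=> // i' Vi'.
have : \forall x \near t, tau i (L t) (g x) = tau i' (L t) (g x).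
  have /cg : \forall q \near g t, tau i (L t) q = tau i' (L t) q.
    by rewrite -pL; apply: tr_map_near; rewrite pL.
  by [].
by apply: filterS2 near_i => x -> ->.
Qed.

Lemma near_dom g t i : {for t, continuous g} -> V i (g t) ->
  \forall x \near t, V i (g x).
Proof. by move=> cg Vi; apply: cg; exact: open_nbhs_nbhs (conj (tr_dom_open i) Vi). Qed.

Lemma lift_at_near g L t : continuous g -> lift_at g L t ->
  \forall x \near t, lift_at g L x.
Proof.
move=> cg [pL HL]; have [i Vi] := tr_dom_cover S (g t).
have H1 := HL i Vi; have H2 := near_dom (cg t) Vi.
apply: filterS (nbhs_interior (filterI H1 H2)) => x Hx.
have /= [Lx Vx] := nbhs_singleton Hx.
apply: (lift_atI (cg x) _ Vx); first by rewrite Lx tr_mapE ?pL.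
by apply: filterS Hx => y [-> Vy]; rewrite Lx tr_map_trans ?pL.
Qed.

(** Transport within a patch is invertible, so the value at [t] is recovered from the values just
    before it. This is the limit step of the real inductions. *)
Lemma lift_at_back g L t i : continuous g -> lift_at g L t -> V i (g t) ->
  \forall x \near t, L t = tau i (L x) (g t).
Proof.
move=> cg [pL HL] Vi; move: (HL i Vi) (near_dom (cg t) Vi).
by apply: filterS2 => x -> Vx; rewrite tr_map_trans ?pL// -pL tr_map_id ?pL.
Qed.

Lemma near_left (t : R) (Q : R -> Prop) : 0 < t ->
  (\forall x \near t, Q x) -> exists s, [/\ 0 <= s, s < t & Q s].
Proof.
move=> t0 /nbhs_ballP[e /= e0 He].
exists (Num.max 0 (t - e / 2)); split.
- by rewrite le_max lexx.
- by rewrite gt_max t0/=; lra.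
- apply: He; rewrite /ball/= ltr_norml.
  by have [] := leP 0 (t - e / 2) => ?; apply/andP; split; lra.
Qed.

Lemma lift_unique g L L' : continuous g ->
  (forall t, 0 <= t -> lift_at g L t) -> (forall t, 0 <= t -> lift_at g L' t) ->
  L 0 = L' 0 -> forall t, 0 <= t -> L t = L' t.
Proof.
move=> cg lL lL' L0; apply: real_induction => // t t0.
- move=> Lt; have [i Vi] := tr_dom_cover S (g t).
  move: ((lL t t0).2 i Vi) ((lL' t t0).2 i Vi).
  by apply: filterS2 => x -> -> _; rewrite Lt.
- move=> Ls; have [i Vi] := tr_dom_cover S (g t).
  have b1 := lift_at_back cg (lL t (ltW t0)) Vi.
  have b2 := lift_at_back cg (lL' t (ltW t0)) Vi.
  have [s [s0 st [-> ->]]] := near_left t0 (filterI b1 b2).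
  by rewrite Ls ?s0.
Qed.

Lemma lift_in_patch g L i (a b : R) : continuous g -> a <= b ->
  (forall t, a <= t <= b -> lift_at g L t) ->
  (forall t, a <= t <= b -> V i (g t)) -> L b = tau i (L a) (g b).
Proof.
move=> cg ab lL Vi.
have aab : a <= a <= b by rewrite lexx.
have pLa : V i (pr (L a)) by rewrite (lL a aab).1; exact: Vi.
suff H : forall t, 0 <= t -> a + t <= b -> L (a + t) = tau i (L a) (g (a + t)).
  by have := H (b - a); rewrite (addrC a) subrK lexx subr_ge0; apply.
apply: real_induction.
- by rewrite addr0 => _; rewrite -(lL a aab).1 tr_map_id.
- move=> t t0 IH; have [atb|bat] := leP (a + t) b; last first.
    by near=> x => tx atx; exfalso; lra.
  have latb : a <= a + t <= b by rewrite atb lerDl t0.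
  have := (lL _ latb).2 i (Vi _ latb).
  move=> /nbhs_ballP[e /= e0 He]; apply/nbhs_ballP; exists e => //= x xe tx atb'.
  have -> : L (a + x) = tau i (L (a + t)) (g (a + x)).
    apply: He; rewrite /ball/= opprD addrACA subrr add0r//.
  rewrite IH// tr_map_trans//; [exact: Vi | apply: Vi; lra].
- move=> t t0 IH atb.
  have latb : a <= a + t <= b by rewrite atb lerDl ltW.
  have [e /= e0 He] := (nbhs_ballP _ _).1 (lift_at_back cg (lL _ latb) (Vi _ latb)).
  have : \forall s \near t, ball (a + t) e (a + s).
    apply/nbhs_ballP; exists e => //= s; rewrite /ball/=.
    by rewrite opprD addrACA subrr add0r.
  move=> /(near_left t0)[s [s0 st /He ->]].
  rewrite IH; [|by rewrite s0|lra].
  by rewrite tr_map_trans//; apply: Vi; lra.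
Unshelve. all: by end_near.
Qed.

End Lifts.

Lemma continuous_pairr (R : realType) (s : R) : continuous (fun t : R => (s, t)).
Proof.
move=> t; apply: (@cvg_pair _ _ _ (nbhs t) (nbhs s) (nbhs t) _ _ _ (fun=> s) id).
  exact: cvg_cst.
exact: cvg_id.
Qed.

Lemma continuous_pairl (R : realType) (s : R) : continuous (fun t : R => (t, s)).
Proof.
move=> t; apply: (@cvg_pair _ _ _ (nbhs t) (nbhs t) (nbhs s) _ _ _ id (fun=> s)).
  exact: cvg_id.
exact: cvg_cst.
Qed.

(** * Existence of lifts and invariance under homotopy *)

Section LiftExistence.
Context (R : realType) (B : topologicalType) (S : transport B).
Implicit Types (g : R -> B) (L : R -> tr_tot S) (e : tr_tot S).
Notation pr := (@tr_pr B S).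
Notation V := (@tr_dom B S).
Notation tau := (@tr_map B S).

Lemma lift_at_congr g L L' t :
  (\forall x \near t, L x = L' x) -> lift_at g L t -> lift_at g L' t.
Proof.
move=> eL [pL HL]; have eLt := nbhs_singleton eL; split; first by rewrite -eLt.
by move=> i /HL; apply: filterS2 eL => x <- ->; rewrite eLt.
Qed.

Lemma lift_at_tau g e i t : continuous g -> V i (pr e) -> V i (g t) ->
  lift_at g (fun x => tau i e (g x)) t.
Proof.
move=> cg Ve Vt; apply: (lift_atI (cg t) _ Vt); first exact: tr_mapE.
by apply: filterS (near_dom (cg t) Vt) => x Vx; rewrite tr_map_trans.
Qed.

Lemma lift_at_comp g L (u : R -> R) t : {for t, continuous u} ->
  lift_at g L (u t) -> lift_at (g \o u) (L \o u) t.
Proof. by move=> cu [pL HL]; split=> // i /HL /cu. Qed.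

(** Lifts are built on half-lines ending at [t], for growing [t]. Constancy of [g] to the left of 0
    makes the first patch enough to start, and constancy to the right of 1 lets the lift be frozen
    there. *)
Lemma lift_exists g e : continuous g ->
  (forall t, t <= 0 -> g t = g 0) -> (forall t, 1 <= t -> g t = g 1) ->
  pr e = g 0 -> exists L, (forall t, lift_at g L t) /\ L 0 = e.
Proof.
move=> cg g0 g1 pe.
have : forall t, 0 <= t ->
    exists L, L 0 = e /\ forall s, s <= t -> lift_at g L s.
  apply: real_induction.
  - have [i Vi] := tr_dom_cover S (g 0).
    exists (fun x => tau i e (g x)); split; first by rewrite -pe tr_map_id ?pe.
    by move=> s s0; apply: lift_at_tau => //; rewrite ?pe ?(g0 _ s0).
  - move=> t t0 [L [L0 HL]].
    have /nbhs_ballP[d /= d0 Hd] := lift_at_near cg (HL _ (lexx t)).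
    apply/nbhs_ballP; exists d => //= x xd tx; exists L; split=> // s sx.
    have [st|ts] := leP s t; first exact: HL.
    apply: Hd; move: xd; rewrite /ball/= !ltr_norml => /andP[? ?].
    by apply/andP; split; lra.
  - move=> t t0 IH; have [i Vi] := tr_dom_cover S (g t).
    have /nbhs_ballP[d /= d0 Hd] := near_dom (cg t) Vi.
    have [s [s0 st std]] := near_left t0 (nbhsx_ballx t d d0).
    have VV y : s <= y <= t -> V i (g y).
      move=> /andP[sy yt]; apply: Hd; move: std.
      by rewrite /ball/= !ltr_norml => /andP[? ?]; apply/andP; split; lra.
    have [|L [L0 HL]] := IH s; first by rewrite s0.
    have Vs : V i (g s) by apply: VV; rewrite lexx ltW.
    have Vp : V i (pr (L s)) by rewrite (HL s (lexx s)).1.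
    (* The lift up to a time [s] at which the path is already in the patch of [g t] is continued by
       transport in that patch. *)
    exists (fun x => if x <= s then L x else tau i (L s) (g x)).
    rewrite s0; split=> // y yt; case: (ltgtP y s) => [ys|sy|ys].
    + apply: (lift_at_congr _ (HL y (ltW ys))).
      near=> x; suff -> : x <= s by [].
      by apply: ltW; near: x; exact: lt_nbhsl.
    + have Vy : V i (g y) by apply: VV; rewrite ltW.
      apply: (lift_at_congr _ (lift_at_tau cg Vp Vy)).
      near=> x; rewrite leNgt; suff -> : s < x by [].
      by near: x; exact: lt_nbhsr.
    + rewrite ys; apply: (lift_atI (cg s) _ Vs); rewrite lexx ?(HL s (lexx s)).1//.
      by apply: filterS ((HL s (lexx s)).2 i Vs) => x ->; rewrite if_same.
move=> /(_ 1 ler01)[L [L0 HL]].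
have pL1 := (HL 1 (lexx 1)).1.
exists (fun t => if t <= 1 then L t else L 1); rewrite ler01; split=> // t.
have [i Vi] := tr_dom_cover S (g 1).
have L1 : tau i (L 1) (g 1) = L 1 by rewrite -pL1 tr_map_id ?pL1.
case: (ltgtP t 1) => [t1|t1|->].
- apply: (lift_at_congr _ (HL t (ltW t1))).
  near=> x; suff -> : x <= 1 by [].
  by apply: ltW; near: x; exact: lt_nbhsl.
- have gt := g1 t (ltW t1).
  apply: (lift_atI (cg t) (i := i)); rewrite ?(lt_geF t1) ?gt//.
  near=> x; have x1 : 1 < x by near: x; exact: lt_nbhsr.
  by rewrite leNgt x1/= g1 ?L1// ltW.
- apply: (lift_atI (cg 1) _ Vi); rewrite lexx//.
  apply: filterS ((HL 1 (lexx 1)).2 i Vi) => x ->.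
  by case: leP => // x1; rewrite g1 ?L1// ltW.
Unshelve. all: by end_near.
Qed.

Lemma lift_in_patch2 g L i (c r a b : R) : continuous g ->
  (forall t, lift_at g L t) ->
  (forall t, `|t - c| < r -> V i (g t)) -> `|a - c| < r -> `|b - c| < r ->
  L b = tau i (L a) (g b).
Proof.
move=> cg lL Vi; rewrite !ltr_norml => /andP[ac ca] /andP[bc cb].
have Vbt u v t : - r < u - c -> v - c < r -> u <= t <= v -> V i (g t).
  move=> uc cv /andP[ut tv]; apply: Vi; rewrite ltr_norml.
  by apply/andP; split; lra.
have [ab|ba] := leP a b.
  by apply: lift_in_patch => // t; apply: Vbt.
have Va := Vbt a a a ac ca; rewrite lexx in Va.
have Vb := Vbt b b b bc cb; rewrite lexx in Vb.
rewrite (lift_in_patch (i := i) (a := b) (b := a) (g := g) (L := L)) ?ltW//;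
  last by move=> t; apply: Vbt.
have pLb : V i (pr (L b)) by rewrite (lL b).1; apply: Vb.
rewrite tr_map_trans//; [|exact: Va|exact: Vb].
by rewrite -(lL b).1 tr_map_id.
Qed.

Section Homotopy.
Variables (H : R * R -> B) (L : R -> R -> tr_tot S).
Hypothesis cH : continuous H.
Hypothesis lL : forall s t, lift_at (fun t => H (s, t)) (L s) t.

Let cHr s : continuous (fun t => H (s, t)).
Proof.
move=> t; apply: (@continuous_comp _ _ _ (fun t => (s, t)) H t).
  exact: continuous_pairr.
exact: cH.
Qed.

(** Joint flatness in both variables at a point of the square; the lifts are so far only known to be
    flat in [t], for each [s] separately. *)
Let good s0 t0 := exists i, V i (H (s0, t0)) /\
  \forall z \near (s0, t0), L z.1 z.2 = tau i (L s0 t0) (H z).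

Let pL s t : pr (L s t) = H (s, t). Proof. exact: (lL s t).1. Qed.

(** Inside a box mapped to a single patch, one moves in the direction of [s] at time [t0], where
    flatness is assumed, and then along each lift to the required time. *)
Let good_extend s0 t0 t1 i (r : R) : 0 < r ->
  (forall z, ball (s0, t1) r z -> V i (H z)) -> `|t0 - t1| < r ->
  (\forall s \near s0, L s t0 = tau i (L s0 t0) (H (s, t0))) ->
  good s0 t1.
Proof.
move=> r0 Vi t01 near_s0.
have Vs s t : `|s0 - s| < r -> `|t - t1| < r -> V i (H (s, t)).
  by move=> sr tr; apply: Vi; split=> //=; rewrite /ball/= distrC.
have s00 : `|s0 - s0| < r by rewrite subrr normr0.
have t11 : `|t1 - t1| < r by rewrite subrr normr0.
have step s t : `|s0 - s| < r -> `|t - t1| < r ->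
    L s t = tau i (L s t0) (H (s, t)).
  move=> sr tr; apply: (lift_in_patch2 (c := t1) (r := r) (@cHr s)) => // u.
  exact: Vs.
exists i; split; first exact: Vs.
have /nbhs_ballP[d /= d0 Hd] := near_s0.
apply/nbhs_ballP; exists (Num.min r d); first by rewrite /= lt_min r0.
move=> [s t] [/= sb tb].
have sr : `|s0 - s| < r by apply: lt_le_trans sb _; rewrite ge_min lexx.
have tr : `|t - t1| < r.
  by rewrite distrC; apply: lt_le_trans tb _; rewrite ge_min lexx.
have sd : ball s0 d s by apply: lt_le_trans sb _; rewrite ge_min lexx orbT.
have Vp : V i (pr (L s0 t0)) by rewrite pL; apply: Vs.
rewrite (step s t)// (step s0 t1)// (Hd _ sd).
by rewrite !tr_map_trans//; apply: Vs.
Qed.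

Let near_box s0 t1 i : V i (H (s0, t1)) ->
  exists2 r, 0 < r & forall z, ball (s0, t1) r z -> V i (H z).
Proof.
move=> Vi; have := cH (open_nbhs_nbhs (conj (tr_dom_open i) Vi)).
by move=> /nbhs_ballP[r /= r0 Hr]; exists r.
Qed.

Let all_good s0 : (forall s, H (s, 0) = H (s0, 0) /\ L s 0 = L s0 0) ->
  forall t, 0 <= t -> good s0 t.
Proof.
move=> HL0; apply: real_induction.
- have [i Vi] := tr_dom_cover S (H (s0, 0)).
  have [r r0 Hr] := near_box Vi.
  apply: (good_extend (t0 := 0) r0 Hr); first by rewrite subrr normr0.
  near=> s; have [-> ->] := HL0 s.
  by rewrite -pL tr_map_id// pL.
- move=> t t0 [i [Vi Hi]].
  have nV : \forall z \near (s0, t), V i (H z).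
    exact: cH (open_nbhs_nbhs (conj (tr_dom_open i) Vi)).
  have nW : nbhs (s0, t) (interior [set z |
      L z.1 z.2 = tau i (L s0 t) (H z) /\ V i (H z)]).
    by apply: nbhs_interior; exact: filterI.
  have cs := @continuous_pairr _ s0 t.
  have : \forall t' \near t, nbhs (s0, t') [set z |
      L z.1 z.2 = tau i (L s0 t) (H z) /\ V i (H z)] by exact: cs _ nW.
  apply: filterS => t' Ht' _.
  have [/= L' V'] := nbhs_singleton Ht'.
  exists i; split=> //; apply: filterS Ht' => z [-> Vz].
  by rewrite L' tr_map_trans// pL.
- move=> t t0 IH; have [i Vi] := tr_dom_cover S (H (s0, t)).
  have [r r0 Hr] := near_box Vi.
  have [t' [t'0 t't rt']] := near_left t0 (nbhsx_ballx t r r0).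
  have [|i' [Vi' Hi']] := IH t'; first by rewrite t'0.
  have t'r : `|t' - t| < r by rewrite distrC.
  apply: (good_extend r0 Hr t'r).
  have Vit' : V i (H (s0, t')) by apply: Hr; split=> //; exact: ballxx.
  (* The patch [i'] that was good at the earlier time is exchanged for the patch [i] around the
     limit. *)
  have : \forall q \near H (s0, t'), tau i' (L s0 t') q = tau i (L s0 t') q.
    by rewrite -pL; apply: tr_map_near; rewrite pL.
  move=> /(@cH (s0, t')) nb.
  have cs := @continuous_pairl _ t' s0.
  have : \forall s \near s0, L s t' = tau i' (L s0 t') (H (s, t')) /\
      tau i' (L s0 t') (H (s, t')) = tau i (L s0 t') (H (s, t')).
    apply: (cs [set z | L z.1 z.2 = tau i' (L s0 t') (H z) /\
      tau i' (L s0 t') (H z) = tau i (L s0 t') (H z)]); exact: filterI.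
  by apply: filterS => s [E1 E2]; rewrite E1 E2.
Unshelve. all: by end_near.
Qed.

(** At [t = 1] the base point stays at [c], and transport from a point to its own base point is the
    identity; so joint flatness makes the end point [L s 1] locally constant in [s]. *)
Lemma lift_homotopy e b c : (forall s, L s 0 = e) ->
  (forall s, H (s, 0) = b) -> (forall s, H (s, 1) = c) -> L 0 1 = L 1 1.
Proof.
move=> L0 Hb Hc.
have loc s0 : \forall s \near s0, L s 1 = L s0 1.
  have [|i [Vi Hi]] := all_good (s0 := s0) _ ler01.
    by move=> s; rewrite !Hb !L0.
  have cs := @continuous_pairl R 1 s0.
  have : \forall s \near s0, L s 1 = tau i (L s0 1) (H (s, 1)) by exact: cs _ Hi.
  apply: filterS => s ->.
  by rewrite Hc -(Hc s0) -pL tr_map_id// pL.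
suff : forall s, 0 <= s -> L 0 1 = L s 1 by apply; exact: ler01.
apply: real_induction => // s s0 IH.
  by apply: filterS (loc s) => s' -> _.
by have [s' [s'0 s's <-]] := near_left s0 (loc s); apply: IH; rewrite s'0.
Qed.

End Homotopy.

End LiftExistence.

(** * Extension of paths from [0, 1] to the line *)

Section Clamp.
Context (R : realType).
Implicit Types t : R.

Definition clamp t : R := Num.max 0 (Num.min 1 t).

Lemma clamp_in t : clamp t \in `[0, 1].
Proof. by rewrite in_itv/= /clamp le_max lexx/= ge_max ler01 ge_min lexx. Qed.

Lemma clamp_id t : t \in `[0, 1] -> clamp t = t.
Proof. by rewrite in_itv/= /clamp => /andP[? ?]; rewrite min_r// max_r. Qed.

Lemma clamp_le0 t : t <= 0 -> clamp t = 0.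
Proof. by move=> t0; rewrite /clamp max_l// ge_min t0 orbT. Qed.

Lemma clamp_ge1 t : 1 <= t -> clamp t = 1.
Proof. by move=> t1; rewrite /clamp min_l// max_r. Qed.

Lemma clamp0 : clamp 0 = 0. Proof. exact: clamp_le0. Qed.
Lemma clamp1 : clamp 1 = 1. Proof. exact: clamp_ge1. Qed.

Lemma clampN t : clamp (1 - t) = 1 - clamp t.
Proof.
have [t0|t0] := leP t 0; first by rewrite (clamp_le0 t0) subr0 clamp_ge1//; lra.
have [t1|t1] := leP 1 t; first by rewrite (clamp_ge1 t1) subrr clamp_le0//; lra.
by rewrite !clamp_id// in_itv/=; apply/andP; split; lra.
Qed.

Lemma clamp_half_l t : t <= 2^-1 -> clamp (2 * t) = 2 * clamp t.
Proof.
move=> th; have [t0|t0] := leP t 0; first by rewrite !clamp_le0 ?mulr0//; lra.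
by rewrite !clamp_id// in_itv/=; apply/andP; split; lra.
Qed.

Lemma clamp_half_r t : 2^-1 <= t -> clamp (2 * t - 1) = 2 * clamp t - 1.
Proof.
move=> th; have [t1|t1] := leP 1 t; first by rewrite !clamp_ge1//; lra.
by rewrite !clamp_id// in_itv/=; apply/andP; split; lra.
Qed.

Lemma clamp_continuous : continuous clamp.
Proof.
move=> t; apply: (@continuous_max R R (cst 0) (fun t => Num.min 1 t)).
  exact: cvg_cst.
by apply: (@continuous_min R R (cst 1) id); [exact: cvg_cst | exact: cvg_id].
Qed.

Lemma within_clamp (T : topologicalType) (g : R -> T) :
  {within `[0, 1], continuous g} -> continuous (g \o clamp).
Proof.
move=> /subspace_continuousP cg t.
have ct : clamp @ t --> within [set` `[0, 1]] (nbhs (clamp t)).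
  move=> A wA.
  have : \forall s \near t, clamp s \in `[0, 1] -> A (clamp s).
    exact: (@clamp_continuous t _ wA).
  by apply: filterS => s; apply; exact: clamp_in.
exact: cvg_trans (cvg_app g ct) (cg _ (clamp_in t)).
Qed.

Lemma within_clamp2 (T : topologicalType) (H : R * R -> T) :
  {within `[0, 1] `*` `[0, 1], continuous H} ->
  continuous (fun z => H (clamp z.1, clamp z.2)).
Proof.
move=> /subspace_continuousP cH [s t].
pose c (z : R * R) := (clamp z.1, clamp z.2).
have cc : c @ (s, t) --> (c (s, t)).
  apply: (@cvg_pair _ _ _ (nbhs (s, t)) (nbhs (clamp s)) (nbhs (clamp t)) _ _ _
    (fun z => clamp z.1) (fun z => clamp z.2)).
  - apply: (@continuous_comp _ _ _ fst clamp (s, t)); last exact: clamp_continuous.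
    exact: cvg_fst.
  - apply: (@continuous_comp _ _ _ snd clamp (s, t)); last exact: clamp_continuous.
    exact: cvg_snd.
have ct : c @ (s, t) -->
    within ([set` `[0, 1]] `*` [set` `[0, 1]]) (nbhs (c (s, t))).
  move=> A wA.
  have : \forall z \near (s, t),
      ([set` `[0, 1]] `*` [set` `[0, 1]]) (c z) -> A (c z) by exact: (cc _ wA).
  by apply: filterS => z; apply; split; exact: clamp_in.
apply: cvg_trans (cvg_app H ct) (cH _ _); split; exact: clamp_in.
Qed.

Lemma continuous_within (T : topologicalType) (g : R -> T) :
  continuous g -> {within `[0, 1], continuous g}.
Proof. by move=> cg; exact: continuous_subspaceT. Qed.

Lemma is_path_comp (T U : topologicalType) (x y : T) g (f : T -> U) :
  is_path x y g -> (forall t : R, t \in `[0, 1] -> {for g t, continuous f}) ->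
  is_path (f x) (f y) (f \o g).
Proof.
move=> [cg g0 g1] cf; split; rewrite /= ?g0 ?g1//.
apply/subspace_continuousP => t t01; move/subspace_continuousP : cg => cg.
exact: (@cvg_comp _ _ _ g f _ _ _ (cg t t01) (cf t t01)).
Qed.

Lemma is_path_eq (T : topologicalType) (x y : T) (g g' : R -> T) :
  (forall t : R, t \in `[0, 1] -> g t = g' t) -> is_path x y g -> is_path x y g'.
Proof.
move=> gg' [cg g0 g1]; split; last 2 first.
- by rewrite -gg' ?in_itv/= ?lexx ?ler01.
- by rewrite -gg' ?in_itv/= ?lexx ?ler01.
apply: subspace_eq_continuous cg => t; rewrite inE => t01.
exact: gg'.
Qed.

Definition path_rev (T : Type) (g : R -> T) : R -> T := fun t => g (1 - t).

Lemma is_path_rev (T : topologicalType) (x y : T) (g : R -> T) :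
  is_path x y g -> is_path y x (path_rev g).
Proof.
move=> [/within_clamp cg g0 g1]; split; rewrite /path_rev ?subr0 ?subrr//.
have : continuous (fun t => (g \o clamp) (1 - t)).
  move=> t; apply: (@continuous_comp _ _ _ (fun t => 1 - t) (g \o clamp) t).
    by apply: cvgB; [exact: cvg_cst | exact: cvg_id].
  exact: cg.
move=> /continuous_within; apply: subspace_eq_continuous => t.
rewrite inE/= in_itv/= => /andP[? ?].
rewrite /from_subspace /= clamp_id// in_itv/=.
by apply/andP; split; lra.
Qed.

Lemma path_concat_clamp (T : topologicalType) (g1 g2 : R -> T) :
  path_concat g1 g2 \o clamp = path_concat (g1 \o clamp) (g2 \o clamp).
Proof.
apply/funext => t; rewrite /path_concat/=.
have [t2|t2] := leP t 2^-1.
  rewrite clamp_half_l// ifT//.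
  by have [t0|t0] := leP t 0; [rewrite clamp_le0//; lra|rewrite clamp_id// in_itv/=; apply/andP; split; lra].
rewrite (clamp_half_r (ltW t2)) ifF//; apply/negbTE; rewrite -ltNge.
by have [t1|t1] := leP 1 t; [rewrite clamp_ge1//; lra|rewrite clamp_id// in_itv/=; apply/andP; split; lra].
Qed.

Lemma path_concat_continuous (T : topologicalType) (g1 g2 : R -> T) :
  continuous g1 -> continuous g2 -> g1 1 = g2 0 -> continuous (path_concat g1 g2).
Proof.
move=> c1 c2 e12 t.
have c1' : continuous (fun t => g1 (2 * t)).
  move=> {}t; apply: (@continuous_comp R R T (fun t : R => 2 * t) g1 t); last exact: c1.
  exact: mulrl_continuous.
have c2' : continuous (fun t => g2 (2 * t - 1)).
  move=> {}t; apply: (@continuous_comp R R T (fun t : R => 2 * t - 1) g2 t); last exact: c2.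
  by apply: cvgB; [exact: mulrl_continuous | exact: cvg_cst].
case: (ltgtP t 2^-1) => [th|th|th] A.
- rewrite /path_concat (ltW th) => nA.
  have : \forall s \near t, A (g1 (2 * s)) by exact: (c1' t _ nA).
  by apply: filterS2 (lt_nbhsl th) => s sh /=; rewrite (ltW sh).
- rewrite /path_concat (lt_geF th) => nA.
  have : \forall s \near t, A (g2 (2 * s - 1)) by exact: (c2' t _ nA).
  by apply: filterS2 (lt_nbhsr th) => s sh /=; rewrite (lt_geF sh).
- rewrite /path_concat th lexx => nA.
  have h1 : 2 * 2^-1 = 1 :> R by rewrite mulfV.
  have n1 : nbhs (g1 (2 * t)) A by rewrite th.
  have n2 : nbhs (g2 (2 * t - 1)) A by rewrite th h1 subrr -e12 -h1.
  have : \forall s \near t, A (g1 (2 * s)) by exact: (c1' t _ n1).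
  have : \forall s \near t, A (g2 (2 * s - 1)) by exact: (c2' t _ n2).
  by rewrite th; apply: filterS2 => s A2 A1 /=; case: ifP.
Qed.

Lemma is_path_concat (T : topologicalType) (x y z : T) (g1 g2 : R -> T) :
  is_path x y g1 -> is_path y z g2 -> is_path x z (path_concat g1 g2).
Proof.
move=> p1 p2; apply: (is_path_eq (g := path_concat g1 g2 \o clamp)).
  by move=> t t01; rewrite /= clamp_id.
rewrite path_concat_clamp; split.
- apply: continuous_within; apply: path_concat_continuous.
  + by apply: within_clamp; case: p1.
  + by apply: within_clamp; case: p2.
  + by rewrite /= clamp0 clamp1; case: p1 => _ _ ->; case: p2.
- by rewrite /path_concat/= invr_ge0 ler0n mulr0 clamp0; case: p1.
- rewrite /path_concat/= ifF; last by apply/negbTE; rewrite -ltNge; lra.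
  have -> : 2 * 1 - 1 = 1 :> R by lra.
  by rewrite clamp1; case: p2.
Qed.

End Clamp.

(** * Transport along paths *)

Section Carries.
Context (R : realType) (B : topologicalType) (S : transport B).
Implicit Types (g : R -> B) (e : tr_tot S).
Notation pr := (@tr_pr B S).
Notation V := (@tr_dom B S).
Notation tau := (@tr_map B S).

(* Precomposition with [clamp] makes a path on [0, 1] a map on the whole line,
   so that no continuity or neighbourhood has to be relative to [0, 1]. *)
Definition carries g e e' := exists L : R -> tr_tot S,
  [/\ forall t, lift_at (g \o @clamp R) L t, L 0 = e & L 1 = e'].

Lemma carries_pr g e e' : carries g e e' -> pr e = g 0 /\ pr e' = g 1.
Proof.
by move=> [L [lL <- <-]]; rewrite (lL 0).1 (lL 1).1/= clamp0 clamp1.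
Qed.

Lemma carries_ex x y g e : is_path x y g -> pr e = x ->
  exists e', carries g e e'.
Proof.
move=> [cg g0 g1] pe; have [|||L [lL L0]] := lift_exists (within_clamp cg) (e := e).
- by move=> t t0; rewrite /= clamp_le0// clamp0.
- by move=> t t1; rewrite /= clamp_ge1// clamp1.
- by rewrite /= clamp0 g0.
- by exists (L 1), L.
Qed.

Lemma carries_unique x y g e e1 e2 : is_path x y g ->
  carries g e e1 -> carries g e e2 -> e1 = e2.
Proof.
move=> [/within_clamp cg _ _] [L [lL L0 <-]] [L' [lL' L'0 <-]].
by apply: (lift_unique cg) => //; rewrite L0.
Qed.

Lemma carries_patch x y g e i : is_path x y g -> pr e = x ->
  (forall t, t \in `[0, 1] -> V i (g t)) -> carries g e (tau i e y).
Proof.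
move=> [/within_clamp cg g0 g1] pe Vi.
have Ve : V i (pr e) by rewrite pe -g0; apply: Vi; rewrite in_itv/= lexx ler01.
exists (fun t => tau i e (g (clamp t))); split.
- by move=> t; apply: (lift_at_tau cg) => //; apply: Vi; exact: clamp_in.
- by rewrite clamp0 g0 -pe tr_map_id.
- by rewrite clamp1 g1.
Qed.

Lemma carries_rev g e e' : carries g e e' -> carries (path_rev g) e' e.
Proof.
move=> [L [lL L0 L1]]; exists (fun t => L (1 - t)); rewrite subr0 subrr; split=> // t.
have -> : path_rev g \o @clamp R = (g \o @clamp R) \o (fun t => 1 - t).
  by apply/funext => s; rewrite /path_rev/= clampN.
by apply: lift_at_comp; [apply: cvgB; [exact: cvg_cst | exact: cvg_id]|].
Qed.

Lemma carries_concat x y z g1 g2 e e' e'' :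
  is_path x y g1 -> is_path y z g2 ->
  carries g1 e e' -> carries g2 e' e'' -> carries (path_concat g1 g2) e e''.
Proof.
move=> p1 p2 [L1 [lL1 L10 L11]] [L2 [lL2 L20 L21]].
have lL1' t : lift_at ((g1 \o @clamp R) \o *%R 2) (L1 \o *%R 2) t.
  by apply: lift_at_comp => //; exact: mulrl_continuous.
have lL2' t : lift_at ((g2 \o @clamp R) \o (fun t => 2 * t - 1))
    (L2 \o (fun t => 2 * t - 1)) t.
  apply: lift_at_comp => //.
  by apply: cvgB; [exact: mulrl_continuous | exact: cvg_cst].
exists (fun t => if t <= 2^-1 then L1 (2 * t) else L2 (2 * t - 1)).
rewrite path_concat_clamp; split; last 2 first.
- by rewrite invr_ge0 ler0n mulr0.
- rewrite ifF; last by apply/negbTE; rewrite -ltNge; lra.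
  by rewrite (_ : 2 * 1 - 1 = 1 :> R)//; lra.
have cg12 : g1 1 = g2 0 by case: p1 => _ _ ->; case: p2.
move=> t; case: (ltgtP t 2^-1) => th.
- split; first by rewrite /path_concat (ltW th) (lL1' t).1.
  move=> i; rewrite /path_concat (ltW th) => /(lL1' t).2.
  by apply: filterS2 (lt_nbhsl th) => s sh; rewrite (ltW sh).
- split; first by rewrite /path_concat (lt_geF th) (lL2' t).1.
  move=> i; rewrite /path_concat (lt_geF th) => /(lL2' t).2.
  by apply: filterS2 (lt_nbhsr th) => s sh; rewrite (lt_geF sh).
(* At the junction [L1] and [L2] are both transported from the common point [e'], so one formula
   holds on the two sides. *)
- have h1 : 2 * t = 1 by rewrite th mulfV.
  have tt : t <= 2^-1 by rewrite th.
  split; first by rewrite /path_concat tt (lL1' t).1.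
  move=> i; rewrite /path_concat tt h1/= clamp1 => Vi.
  have := (lL2' t).2 i; rewrite /= h1 subrr clamp0 -cg12 => /(_ Vi).
  have := (lL1' t).2 i; rewrite /= h1 clamp1 => /(_ Vi).
  apply: filterS2 => s s1 s2.
  by case: ifP => // _; rewrite s2 L20 L11.
Qed.

Lemma carries_homotopic x y g1 g2 e e1 e2 :
  is_path x y g1 -> is_path x y g2 -> path_homotopic g1 g2 -> pr e = x ->
  carries g1 e e1 -> carries g2 e e2 -> e1 = e2.
Proof.
move=> p1 p2 [H [/within_clamp2 cH H1 H2 H01]] pe c1 c2.
pose K := fun z => H (clamp z.1, clamp z.2).
have cKs (s : R) : continuous (fun t => K (s, t)).
  by move=> t; apply: (@continuous_comp _ _ _ (fun t => (s, t)) K t);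
    [exact: continuous_pairr | exact: cH].
have K0 s : K (s, 0) = x.
  by rewrite /K/= clamp0 (H01 _ (clamp_in s)).1; case: p1.
have K1 s : K (s, 1) = y.
  by rewrite /K/= clamp1 (H01 _ (clamp_in s)).2; case: p1.
have /choice[L HL] : forall s : R, exists L, (forall t, lift_at (fun t => K (s, t)) L t) /\ L 0 = e.
  move=> s; apply: lift_exists => //.
  - by move=> t t0; rewrite /K/= (clamp_le0 t0) clamp0.
  - by move=> t t1; rewrite /K/= (clamp_ge1 t1) clamp1.
  - by rewrite K0.
have := lift_homotopy cH (fun s => (HL s).1) (fun s => (HL s).2) K0 K1.
have -> : L 0 1 = e1.
  apply: (carries_unique p1) c1; exists (L 0); split=> //; last exact: (HL 0).2.
  suff -> : g1 \o @clamp R = (fun t => K (0, t)) by exact: (HL 0).1.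
  by apply/funext => t; rewrite /K/= clamp0 H1// clamp_in.
have -> // : L 1 1 = e2.
  apply: (carries_unique p2) c2; exists (L 1); split=> //; last exact: (HL 1).2.
  suff -> : g2 \o @clamp R = (fun t => K (1, t)) by exact: (HL 1).1.
  by apply/funext => t; rewrite /K/= clamp1 H2// clamp_in.
Qed.

(** Symmetries of the connection commute with transport; they serve to change the starting point of
    a lift. *)
Lemma carries_equivariant (F : tr_tot S -> tr_tot S) g e e' :
  (forall e, pr (F e) = pr e) -> (forall i e q, F (tau i e q) = tau i (F e) q) ->
  carries g e e' -> carries g (F e) (F e').
Proof.
move=> pF Ft [L [lL L0 L1]]; exists (F \o L); split; rewrite /= ?L0 ?L1//.
move=> t; split; first by rewrite /= pF (lL t).1.
by move=> i /(lL t).2; apply: filterS => s /= ->.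
Qed.

End Carries.

(** * Calculus on R^n *)

Lemma cvg_sumR (R : realType) (T I : Type) (F : set_system T) (FF : Filter F)
    (r : seq I) (u : I -> T -> R) (l : I -> R) :
  (forall i, u i @ F --> l i) ->
  (\sum_(i <- r) u i x) @[x --> F] --> \sum_(i <- r) l i.
Proof.
move=> ul; elim: r => [|i r IH].
  rewrite big_nil; under eq_fun do rewrite big_nil; exact: cvg_cst.
by rewrite big_cons; under eq_fun do rewrite big_cons; exact: cvgD.
Qed.

Section Calculus.
Context (R : realType) (n : nat).
Notation rV := 'rV[R]_n.
Implicit Types (f g : rV -> R) (x y z : rV).
Notation e_ i := (delta_mx 0 i : rV).

Lemma ball_rV x r y : ball x r y <-> 0 < r /\ forall j, `|x 0 j - y 0 j| < r.
Proof.
split=> [[r0 H]|[r0 H]]; split=> //; first by move=> j; exact: H.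
by move=> i j; rewrite ord1; exact: H.
Qed.

(** With its converse below, this moves between coordinate derivatives and one real variable, where
    the mean value theorem and the rules for composition apply. *)
Lemma is_derive_slice f x i (t : R) : derivable (f : rV -> R^o) (x + t *: e_ i) (e_ i) ->
  is_derive t 1 (fun s : R => f (x + s *: e_ i) : R^o) (partial i f (x + t *: e_ i)).
Proof.
move=> df.
have E : (fun h : R => h^-1 *: (((fun s : R => f (x + s *: e_ i) : R^o) \o shift t) (h *: (1 : R^o)) - f (x + t *: e_ i))) =
  (fun h => h^-1 *: (((f : rV -> R^o) \o shift (x + t *: e_ i)) (h *: e_ i) - f (x + t *: e_ i))).
  apply/funext => h /=; congr (_ *: (f _ - _)).
  by rewrite [_ *: 1]mulr1 scalerDl addrCA.
by split; rewrite /derivable/partial/derive E.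
Qed.

Lemma is_derive_of_slice f x i (d : R) :
  is_derive (0 : R) (1 : R^o) (fun s : R => f (x + s *: e_ i) : R^o) d ->
  is_derive x (e_ i) (f : rV -> R^o) d.
Proof.
have E : (fun h : R => h^-1 *: (((fun s : R => f (x + s *: e_ i) : R^o) \o shift 0) (h *: (1 : R^o)) - f (x + 0 *: e_ i))) =
  (fun h => h^-1 *: (((f : rV -> R^o) \o shift x) (h *: e_ i) - f x)).
  apply/funext => h /=; rewrite scale0r !addr0; congr (_ *: (f _ - _)).
  by rewrite [_ *: 1]mulr1 addrC.
by case; rewrite /derivable/derive E => ? ?; split.
Qed.

Lemma mvt_sym (c dc : R -> R) (a b : R) :
  (forall s, Num.min a b <= s <= Num.max a b -> is_derive s (1 : R^o) (c : R -> R^o) (dc s)) ->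
  exists2 s, Num.min a b <= s <= Num.max a b & c b - c a = dc s * (b - a).
Proof.
wlog ab : a b / a <= b.
  move=> W; have [ab|ba] := orP (le_total a b); first exact: W.
  rewrite minC maxC => /(W b a ba)[s sab E]; exists s; first by [].
  by rewrite -opprB E -mulrN opprB.
rewrite (min_idPl ab) (max_idPr ab) => dc_.
case: (@MVT_segment R c dc a b ab) => [s||s sab E].
- by rewrite in_itv/= => /andP[? ?]; apply: dc_; rewrite !ltW.
- apply: derivable_within_continuous => s; rewrite in_itv/= => sab.
  exact: (@ex_derive _ _ _ _ _ _ _ (dc_ _ sab)).
- by exists s.
Qed.

Definition box x y : set rV := [set z | forall j,
  Num.min (x 0 j) (y 0 j) <= z 0 j <= Num.max (x 0 j) (y 0 j)].

Lemma box_ball x r y z : ball x r y -> box x y z -> ball x r z.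
Proof.
move=> /ball_rV[r0 xy] xyz; apply/ball_rV; split=> // j.
have := xy j; have /andP[] := xyz j.
rewrite !ltr_norml; case: (leP (x 0 j) (y 0 j)) => ? ? ? /andP[? ?]; apply/andP; split; lra.
Qed.

Lemma box_ball2 c r x y z : ball c r x -> ball c r y -> box x y z -> ball c r z.
Proof.
move=> /ball_rV[r0 cx] /ball_rV[_ cy] xyz; apply/ball_rV; split=> // j.
have := cx j; have := cy j; have /andP[] := xyz j.
rewrite !ltr_norml; case: (leP (x 0 j) (y 0 j)) => ? ? ? /andP[? ?] /andP[? ?]; apply/andP; split; lra.
Qed.

(* Moves from [x] to [y] one coordinate at a time. *)
Lemma mvt_rV f x y :
  (forall z i, box x y z -> derivable (f : rV -> R^o) z (e_ i)) ->
  exists xi : 'I_n -> rV, (forall k, box x y (xi k)) /\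
    f y - f x = \sum_k partial k f (xi k) * (y 0 k - x 0 k).
Proof.
move=> df.
pose z k : rV := \row_j (if (j < k)%N then y 0 j else x 0 j).
have zS (k : 'I_n) : z k.+1 = z k + (y 0 k - x 0 k) *: e_ k.
  apply/rowP => j; rewrite !mxE eqxx/= ltnS leq_eqVlt.
  have [->|jk] := eqVneq j k; first by rewrite eqxx ltnn/= mulr1 addrC subrK.
  by rewrite -val_eqE/= in jk; rewrite (negPf jk)/= mulr0 addr0.
have zb (k : 'I_n) (s : R) : Num.min 0 (y 0 k - x 0 k) <= s <= Num.max 0 (y 0 k - x 0 k) ->
    box x y (z k + s *: e_ k).
  move=> sb j; rewrite !mxE eqxx/=.
  have [->|jk] := eqVneq j k.
    rewrite ltnn mulr1; move: sb.
    by case: (leP 0 (y 0 k - x 0 k)) => ? /andP[? ?];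
      case: (leP (x 0 k) (y 0 k)) => ?; apply/andP; split; lra.
  rewrite mulr0 addr0; case: ifP => _; first by rewrite ge_min le_max lexx !orbT.
  by rewrite ge_min le_max lexx.
have /fin_all_exists[xi Hxi] : forall k : 'I_n, exists p, box x y p /\
    f (z k.+1) - f (z k) = partial k f p * (y 0 k - x 0 k).
  move=> k.
  have [|s sb E] := @mvt_sym (fun s => f (z k + s *: e_ k))
     (fun s => partial k f (z k + s *: e_ k)) 0 (y 0 k - x 0 k).
    by move=> s sb; apply: is_derive_slice; apply: df; exact: zb.
  exists (z k + s *: e_ k); split; first exact: zb.
  by rewrite zS; move: E; rewrite scale0r addr0 subr0.
exists xi; split; first by move=> k; exact: (Hxi k).1.
under eq_bigr => k _ do rewrite -(Hxi k).2.
rewrite -(big_mkord xpredT (fun k => f (z k.+1) - f (z k))) telescope_sumr//.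
congr (f _ - f _); apply/rowP => j; rewrite mxE ?ltn_ord// ltn0//.
Qed.

Lemma gradient0_const f c r x y : ball c r x -> ball c r y ->
  (forall z i, ball c r z -> is_derive z (e_ i) (f : rV -> R^o) (0 : R)) -> f y = f x.
Proof.
move=> cx cy df; apply/eqP; rewrite -subr_eq0; apply/eqP.
have [|xi [bxi ->]] := @mvt_rV f x y.
  by move=> z i xyz; apply: (@ex_derive _ _ _ _ _ _ _ (df z i _)); exact: box_ball2 xyz.
rewrite big1// => k _.
have D := df (xi k) k (box_ball2 cx cy (bxi k)).
by rewrite /partial (@derive_val _ _ _ _ _ _ _ D) mul0r.
Qed.

Definition C1_at f x := (forall i, \forall z \near x, derivable (f : rV -> R^o) z (e_ i)) /\
  forall i, {for x, continuous (partial i f)}.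

(* Caratheodory's form of differentiability; it makes the chain rule a
   statement about limits of products. *)
Lemma C1_slope f x : C1_at f x ->
  exists A : 'I_n -> rV -> R, (forall k, A k y @[y --> x] --> partial k f x) /\
    \forall y \near x, f y - f x = \sum_k A k y * (y 0 k - x 0 k).
Proof.
move=> [df cf].
have /nbhs_ballP[r /= r0 Hr] : \forall z \near x, forall i, derivable (f : rV -> R^o) z (e_ i).
  exact: near_forall.
have /choice[xi Hxi] : forall y, exists xi : 'I_n -> rV, ball x r y ->
    (forall k, box x y (xi k)) /\
    f y - f x = \sum_k partial k f (xi k) * (y 0 k - x 0 k).
  move=> y; have [xy|nxy] := pselect (ball x r y); last by exists (fun=> x).
  have [|xi Hxi] := @mvt_rV f x y; last by exists xi.
  by move=> z i xyz; apply: Hr; exact: box_ball xyz.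
exists (fun k y => partial k f (xi y k)); split=> [k|]; last first.
  by apply/nbhs_ballP; exists r => //= y /Hxi[].
apply: (@cvg_comp _ _ _ (fun y => xi y k) (partial k f) _ (nbhs x)); last exact: cf.
move=> A /nbhs_ballP[e /= e0 He].
suff : \forall y \near x, A (xi y k) by [].
apply/nbhs_ballP; exists (Num.min e r).
  by rewrite /= lt_min e0.
move=> y xy; apply: He.
have xyr : ball x r y by apply: le_ball xy; rewrite ge_min lexx orbT.
apply: (@box_ball _ _ y); first by apply: le_ball xy; rewrite ge_min lexx.
exact: (Hxi _ xyr).1.
Qed.

Lemma cvg_coord (T : Type) (F : set_system T) (FF : Filter F) (u : T -> rV) x :
  (forall k, u t 0 k @[t --> F] --> x 0 k) -> u @ F --> x.
Proof.
move=> H; apply/cvg_ballP => e e0.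
have : \forall t \near F, forall k, `|x 0 k - u t 0 k| < e.
  by apply: filter_forall => k; move/cvgrPdist_lt : (H k); exact.
by apply: filterS => t Ht; apply/ball_rV.
Qed.

Lemma C1_continuous f x : C1_at f x -> {for x, continuous f}.
Proof.
move=> /C1_slope[A [cA fA]].
have key (F : set_system rV) : Filter F -> (forall k, A k y @[y --> F] --> partial k f x) ->
    (forall k, (y : rV) 0 k @[y --> F] --> x 0 k) ->
    (f x + \sum_k A k y * (y 0 k - x 0 k)) @[y --> F] -->
    f x + \sum_(k < n) partial k f x * (x 0 k - x 0 k).
  move=> FF cAF cx; apply: cvgD; first exact: cvg_cst.
  apply: cvg_sumR => k; apply: cvgM; first exact: cAF.
  by apply: cvgB; [exact: cx|exact: cvg_cst].
have c0 := key (nbhs x) (nbhs_filter x) cA (fun k => @coord_continuous R 1 n 0 k x).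
rewrite big1 ?addr0 in c0; last by move=> k _; rewrite subrr mulr0.
have E : \forall y \near x, f x + \sum_k A k y * (y 0 k - x 0 k) = f y.
  by apply: nearS fA => y <-; rewrite addrC subrK.
exact: near_cvg E c0.
Qed.

Lemma chain_curve f (c : R -> rV) (c' : 'I_n -> R) (t : R) :
  C1_at f (c t) -> (forall k, is_derive t (1 : R^o) (fun s : R => c s 0 k : R^o) (c' k)) ->
  is_derive t (1 : R^o) (fun s : R => f (c s) : R^o) (\sum_k partial k f (c t) * c' k).
Proof.
move=> /C1_slope[A [cA fA]] dc.
have cck k : c s 0 k @[s --> t] --> c t 0 k.
  have H : derivable (fun s : R => c s 0 k : R^o) t (1 : R^o).
    exact: (@ex_derive _ _ _ _ _ _ _ (dc k)).
  by move/derivable1_diffP/differentiable_continuous : H.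
have cc : c @ t --> c t by exact: cvg_coord.
have sh : (h + t) @[h --> 0^'] --> t.
  rewrite -[X in _ --> X]add0r; apply: cvgD; last exact: cvg_cst.
  exact: (@cvg_within _ (nbhs (0 : R))).
have csh : c (h + t) @[h --> 0^'] --> c t.
  exact: (@cvg_comp _ _ _ (fun h => h + t) c _ _ _ sh cc).
have lim : (\sum_k A k (c (h + t)) * (h^-1 * (c (h + t) 0 k - c t 0 k))) @[h --> (0:R)^'] -->
    \sum_k partial k f (c t) * c' k.
  apply: cvg_sumR => k; apply: cvgM.
    exact: (@cvg_comp _ _ _ (fun h => c (h + t)) (A k) _ _ _ csh (cA k)).
  have := @ex_derive _ _ _ _ _ _ _ (dc k); rewrite /derivable => H.
  have := @derive_val _ _ _ _ _ _ _ (dc k); rewrite /derive => E.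
  rewrite -E; apply: cvg_trans H; apply: near_eq_cvg; near=> h.
  by rewrite /= [_ *: 1]mulr1.
have lim' : h^-1 *: (((fun s : R => f (c s) : R^o) \o shift t) (h *: (1 : R^o)) - f (c t)) @[h --> (0:R)^']
     --> (\sum_k partial k f (c t) * c' k : R^o).
  apply: cvg_trans lim; apply: near_eq_cvg.
  have : \forall h \near (0:R)^', f (c (h + t)) - f (c t) = \sum_k A k (c (h + t)) * (c (h + t) 0 k - c t 0 k).
    exact: csh _ fA.
  apply: filterS => h E; rewrite /= [_ *: 1]mulr1 E scaler_sumr.
  by apply: eq_bigr => k _; rewrite [in RHS]/GRing.scale/= mulrCA.
split; first by apply/cvg_ex; eexists; exact: lim'.
exact: cvg_lim lim'.
Unshelve. all: by end_near.
Qed.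

End Calculus.

Lemma chain_rule (R : realType) (m n : nat) (f : 'rV[R]_n -> R) (T : 'rV[R]_m -> 'rV[R]_n)
    (x : 'rV[R]_m) (i : 'I_m) :
  C1_at f (T x) ->
  (forall k, derivable (fun z => T z 0 k : R^o) x (delta_mx 0 i)) ->
  is_derive x (delta_mx 0 i) (fun z => f (T z) : R^o)
    (\sum_k partial k f (T x) * partial i (fun z => T z 0 k) x).
Proof.
move=> cf dT; apply: is_derive_of_slice.
have := @chain_curve R n f (fun s => T (x + s *: delta_mx 0 i))
  (fun k => partial i (fun z => T z 0 k) x) 0.
rewrite scale0r addr0; apply=> // k.
have := @is_derive_slice R m (fun z => T z 0 k) x i 0.
by rewrite scale0r addr0; apply; exact: dT.
Qed.

(** * Germs of smooth functions *)

Section SmoothAt.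
Context (R : realType) (n : nat).
Notation rV := 'rV[R]_n.
Implicit Types (f g : rV -> R) (x y z : rV).
Notation e_ i := (delta_mx 0 i : rV).

(** A local form of [Ck]: every condition is asked for on some neighbourhood of [x], so functions
    equal near [x] are interchangeable and no open set has to be carried along. *)
Fixpoint ck_at (k : nat) f x : Prop :=
  (\forall y \near x, {for y, continuous f}) /\
  if k is k'.+1 then forall i,
    (\forall y \near x, derivable (f : rV -> R^o) y (e_ i)) /\ ck_at k' (partial i f) x
  else True.

Definition smooth_at f x := forall k, ck_at k f x.

Lemma ck_atE k U f : open U -> Ck k U f <-> forall x, U x -> ck_at k f x.
Proof.
move=> oU; elim: k f => [|k IH] f /=.
  split=> [[cf _] x Ux|H]; split=> //.
    by apply: nearS (open_nbhs_nbhs (conj oU Ux)) => y Uy; apply: cf; rewrite inE.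
  by move=> x; rewrite inE => Ux; exact: near_self (H x Ux).1.
split=> [[cf Hf] x Ux|H].
  have nU : \forall y \near x, U y by exact: open_nbhs_nbhs.
  split; first by apply: nearS nU => y Uy; apply: cf; rewrite inE.
  move=> i; have [df ckf] := Hf i; split; first by apply: nearS nU => y; exact: df.
  exact: (IH _).1.
split; first by move=> x; rewrite inE => Ux; exact: near_self (H x Ux).1.
move=> i; split; first by move=> x Ux; exact: near_self ((H x Ux).2 i).1.
by apply/IH => x Ux; exact: ((H x Ux).2 i).2.
Qed.

Lemma CinftyE U f : open U -> Cinfty U f <-> forall x, U x -> smooth_at f x.
Proof.
move=> oU; split=> [H x Ux k|H k]; first by apply: (ck_atE k f oU).1.
by apply/(ck_atE k f oU) => x Ux; exact: H.
Qed.

Lemma near_eq_partial f g x i : (\forall y \near x, f y = g y) ->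
  partial i f x = partial i g x.
Proof. by move=> fg; apply: near_eq_derive. Qed.

Lemma near_partial f g x i : (\forall y \near x, f y = g y) ->
  \forall y \near x, partial i f y = partial i g y.
Proof. by move=> /near_near; apply: nearS => y; exact: near_eq_partial. Qed.

Lemma ck_at_congr k f g x : (\forall y \near x, f y = g y) -> ck_at k f x -> ck_at k g x.
Proof.
elim: k f g => [|k IH] f g fg /= [cf Hf].
  split=> //; apply: nearS2 (near_near fg) cf => y fgy cfy.
  by rewrite /prop_for/continuous_at -(near_self fgy); exact: near_cvg fgy cfy.
split.
  apply: nearS2 (near_near fg) cf => y fgy cfy.
  by rewrite /prop_for/continuous_at -(near_self fgy); exact: near_cvg fgy cfy.
move=> i; split; last exact: IH (near_partial i fg) (Hf i).2.
by apply: nearS2 (near_near fg) (Hf i).1 => y; exact: near_eq_derivable.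
Qed.

Lemma ck_atW k f x : ck_at k.+1 f x -> ck_at k f x.
Proof.
elim: k f => [|k IH] f [cf Hf]; first by [].
by split=> // i; split; [exact: (Hf i).1 | apply: IH; exact: (Hf i).2].
Qed.

Lemma ck_at_cont k f x : ck_at k f x -> \forall y \near x, {for y, continuous f}.
Proof. by case: k => [|k] []. Qed.

Lemma ck_at_C1 k f x : ck_at k.+1 f x -> \forall y \near x, C1_at f y.
Proof.
move=> [_ Hf].
have : \forall y \near x, forall i, (\forall z \near y, derivable (f : rV -> R^o) z (e_ i)) /\
    {for y, continuous (partial i f)}.
  by apply: near_forall => i; exact: (nearI (near_near (Hf i).1) (ck_at_cont (Hf i).2)).
by apply: nearS => y H; split=> i; [exact: (H i).1 | exact: (H i).2].
Qed.

(** Continuity of [f] follows from that of its partial derivatives, so inductions on [k] only have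
    to treat the latter. *)
Lemma ck_atS k f x :
  (forall i, (\forall y \near x, derivable (f : rV -> R^o) y (e_ i)) /\
     ck_at k (partial i f) x) -> ck_at k.+1 f x.
Proof.
move=> Hf; split=> //.
have : \forall y \near x, forall i, (\forall z \near y, derivable (f : rV -> R^o) z (e_ i)) /\
    {for y, continuous (partial i f)}.
  by apply: near_forall => i; exact: (nearI (near_near (Hf i).1) (ck_at_cont (Hf i).2)).
apply: nearS => y H; apply: C1_continuous.
by split=> i; [exact: (H i).1 | exact: (H i).2].
Qed.

Lemma ck_at_cst k (a : R) x : ck_at k (cst a) x.
Proof.
elim: k a => [|k IH] a; first by split=> //; apply: near_all => y; exact: cst_continuous.
apply: ck_atS => i; split; first by apply: near_all => y; exact: derivable_cst.
apply: (@ck_at_congr _ (cst 0)); last exact: IH.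
by apply: near_all => y; rewrite /partial derive_cst.
Qed.

Lemma ck_atD k f g x : ck_at k f x -> ck_at k g x -> ck_at k (fun y => f y + g y) x.
Proof.
elim: k f g => [|k IH] f g Hf Hg.
  split=> //; apply: nearS2 Hf.1 Hg.1 => y cf cg.
  exact: (@continuousD _ _ _ (f : rV -> R^o) g y).
apply: ck_atS => i; have [[_ /(_ i)[df Hdf]] [_ /(_ i)[dg Hdg]]] := (Hf, Hg).
split; first by apply: nearS2 df dg => y; exact: derivableD.
apply: ck_at_congr (IH _ _ Hdf Hdg).
by apply: nearS2 df dg => y dfy dgy; rewrite /partial (@deriveD _ _ _ (f : rV -> R^o) g).
Qed.

Lemma ck_atM k f g x : ck_at k f x -> ck_at k g x -> ck_at k (fun y => f y * g y) x.
Proof.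
elim: k f g => [|k IH] f g Hf Hg.
  split=> //; apply: nearS2 Hf.1 Hg.1 => y cf cg.
  exact: (@continuousM _ _ (f : rV -> R) g y).
apply: ck_atS => i; have [[_ /(_ i)[df Hdf]] [_ /(_ i)[dg Hdg]]] := (Hf, Hg).
split; first by apply: nearS2 df dg => y; exact: derivableM.
apply: ck_at_congr (ck_atD (IH _ _ (ck_atW Hf) Hdg) (IH _ _ (ck_atW Hg) Hdf)).
by apply: nearS2 df dg => y dfy dgy; rewrite /partial (@deriveM _ _ (f : rV -> R^o) g).
Qed.

(* One step of the induction proving that [F \o f] is of class C^k. *)
Lemma ck_at_comp1 k (F dF : R -> R) (D : set R) f x :
  (forall t, D t -> is_derive t (1 : R^o) (F : R -> R^o) (dF t)) ->
  (\forall y \near x, D (f y)) -> ck_at k.+1 f x ->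
  ck_at k (fun y => dF (f y)) x -> ck_at k.+1 (fun y => F (f y)) x.
Proof.
move=> dF_ Df Hf HdF; apply: ck_atS => i; have [_ /(_ i)[df Hdf]] := Hf.
have D1 : \forall y \near x,
    is_derive y (e_ i) (fun y => F (f y) : R^o) (dF (f y) * partial i f y).
  apply: nearS2 Df df => y Dy dfy; apply: is_derive_of_slice.
  have s : is_derive (0 : R) (1 : R^o) (fun s : R => f (y + s *: e_ i) : R^o) (partial i f y).
    by have := @is_derive_slice _ _ f y i 0; rewrite scale0r addr0; apply.
  have Fd : is_derive (f (y + 0 *: e_ i)) (1 : R^o) (F : R -> R^o) (dF (f y)).
    by rewrite scale0r addr0; exact: dF_.
  have := @is_derive1_comp R F (fun s : R => f (y + s *: e_ i)) 0 _ _ Fd s.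
  by rewrite mulrC.
split; first by apply: nearS D1 => y H; exact: (@ex_derive _ _ _ _ _ _ _ H).
apply: ck_at_congr (ck_atM HdF Hdf).
by apply: nearS D1 => y H; rewrite /partial (@derive_val _ _ _ _ _ _ _ H).
Qed.

Lemma ck_at_comp0 (F : R -> R) (D : set R) f x :
  (forall t, D t -> {for t, continuous F}) ->
  (\forall y \near x, D (f y)) -> ck_at 0 f x -> ck_at 0 (fun y => F (f y)) x.
Proof.
move=> cF Df [cf _]; split=> //; apply: nearS2 Df cf => y Dy cfy.
exact: (@continuous_comp _ _ _ f F y cfy (cF _ Dy)).
Qed.

Lemma smooth_at_congr f g x : (\forall y \near x, f y = g y) -> smooth_at f x -> smooth_at g x.
Proof. by move=> fg Hf k; exact: ck_at_congr fg (Hf k). Qed.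

Lemma smooth_at_cst (a : R) x : smooth_at (cst a) x.
Proof. by move=> k; exact: ck_at_cst. Qed.

Lemma smooth_atD f g x : smooth_at f x -> smooth_at g x -> smooth_at (fun y => f y + g y) x.
Proof. by move=> Hf Hg k; exact: ck_atD. Qed.

Lemma smooth_atM f g x : smooth_at f x -> smooth_at g x -> smooth_at (fun y => f y * g y) x.
Proof. by move=> Hf Hg k; exact: ck_atM. Qed.

Lemma smooth_atN f x : smooth_at f x -> smooth_at (fun y => - f y) x.
Proof.
move=> Hf; apply: smooth_at_congr (smooth_atM (smooth_at_cst (-1) x) Hf).
by apply: near_all => y; rewrite mulN1r.
Qed.

Lemma smooth_atB f g x : smooth_at f x -> smooth_at g x -> smooth_at (fun y => f y - g y) x.
Proof. by move=> Hf Hg; exact: smooth_atD (smooth_atN Hg). Qed.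

Lemma smooth_at_sum (I : Type) (r : seq I) (P : pred I) (f : I -> rV -> R) x :
  (forall i, P i -> smooth_at (f i) x) -> smooth_at (fun y => \sum_(i <- r | P i) f i y) x.
Proof.
move=> Hf; elim: r => [|i r IH].
  by apply: smooth_at_congr (smooth_at_cst 0 x); apply: near_all => y; rewrite big_nil.
have [Pi|nPi] := boolP (P i).
  by apply: smooth_at_congr (smooth_atD (Hf i Pi) IH); apply: near_all => y; rewrite big_cons Pi.
by apply: smooth_at_congr IH; apply: near_all => y; rewrite big_cons (negPf nPi).
Qed.

Lemma smooth_at_prod (I : Type) (r : seq I) (f : I -> rV -> R) x :
  (forall i, smooth_at (f i) x) -> smooth_at (fun y => \prod_(i <- r) f i y) x.
Proof.
move=> Hf; elim: r => [|i r IH].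
  by apply: smooth_at_congr (smooth_at_cst 1 x); apply: near_all => y; rewrite big_nil.
by apply: smooth_at_congr (smooth_atM (Hf i) IH); apply: near_all => y; rewrite big_cons.
Qed.

Lemma smooth_at_near f x : smooth_at f x -> \forall y \near x, C1_at f y.
Proof. by move=> /(_ 1%N); exact: ck_at_C1. Qed.

Lemma smooth_at_C1 f x : smooth_at f x -> C1_at f x.
Proof. by move=> /smooth_at_near /near_self. Qed.

Lemma smooth_at_derivable f x i : smooth_at f x -> derivable (f : rV -> R^o) x (e_ i).
Proof. by move=> /smooth_at_C1[/(_ i) /near_self]. Qed.

Lemma smooth_at_partial f x i : smooth_at f x -> smooth_at (partial i f) x.
Proof. by move=> Hf k; exact: ((Hf k.+1).2 i).2. Qed.

(** This gives the smoothness of primitives, which are first known only through their partial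
    derivatives. *)
Lemma smooth_at_gradient f (g : 'I_n -> rV -> R) x :
  (forall i, \forall y \near x, is_derive y (e_ i) (f : rV -> R^o) (g i y)) ->
  (forall i, smooth_at (g i) x) -> smooth_at f x.
Proof.
move=> df Hg; suff H k : ck_at k.+1 f x by move=> k; exact: ck_atW.
apply: ck_atS => i; split.
  by apply: nearS (df i) => y H; exact: (@ex_derive _ _ _ _ _ _ _ H).
apply: ck_at_congr (Hg i k).
by apply: nearS (df i) => y H; rewrite /partial (@derive_val _ _ _ _ _ _ _ H).
Qed.

Lemma is_derive_expR_comp f x i (d : R) : is_derive x (e_ i) (f : rV -> R^o) d ->
  is_derive x (e_ i) (fun y => expR (f y) : R^o) (expR (f x) * d).
Proof.
move=> df; apply: is_derive_of_slice.
have s : is_derive (0 : R) (1 : R^o) (fun s : R => f (x + s *: e_ i) : R^o) d.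
  have := @is_derive_slice _ _ f x i 0; rewrite scale0r addr0 => H.
  have := H (@ex_derive _ _ _ _ _ _ _ df); move/is_derive_eq; apply.
  by rewrite /partial (@derive_val _ _ _ _ _ _ _ df).
have := @is_derive1_comp R expR (fun s => f (x + s *: e_ i)) 0 _ _ (is_derive_expR _) s.
by rewrite scale0r addr0.
Qed.

Lemma smooth_at_exp f x : smooth_at f x -> smooth_at (fun y => expR (f y)) x.
Proof.
move=> Hf; elim=> [|k IH].
  apply: (@ck_at_comp0 _ setT) => //; last by apply: near_all.
  by move=> t _; exact: continuous_expR.
by apply: (@ck_at_comp1 _ _ expR setT) => //; apply: near_all.
Qed.

Lemma smooth_at_inv f x : f x != 0 -> smooth_at f x -> smooth_at (fun y => (f y)^-1) x.
Proof.
move=> fx0 Hf.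
have nf : \forall y \near x, f y != 0.
  have cf : {for x, continuous f} by exact: near_self (ck_at_cont (Hf 0%N)).
  have n0 : nbhs (f x) [set t : R | t != 0].
    exact: (open_nbhs_nbhs (conj (@open_neq R 0) fx0)).
  exact: (cf _ n0).
elim=> [|k IH].
  apply: (@ck_at_comp0 _ [set t | t != 0]) => // t t0.
  exact: inv_continuous.
(* The derivative of the inverse is written as a product of inverses, to which the induction
   hypothesis applies. *)
apply: (@ck_at_comp1 _ _ (fun t => - t^-1 * t^-1) [set t | t != 0]) => //.
  move=> t /= t0; split; first by apply: derivableV.
  rewrite (@deriveV _ _ (@id R^o) t 1)// derive_id /GRing.scale/= mulr1.
  by rewrite -exprVn expr2 mulNr.
apply: ck_atM => //.
apply: ck_at_congr (ck_atM (ck_at_cst k (-1) x) IH).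
by apply: near_all => y; rewrite mulN1r.
Qed.

End SmoothAt.

(** * Symmetry of second derivatives *)

Section Clairaut.
Context (R : realType) (n : nat).
Notation rV := 'rV[R]_n.
Implicit Types (f g : rV -> R) (x y z : rV).
Notation e_ i := (delta_mx 0 i : rV).

Lemma ball_two_steps x i j (t s h r : R) : 0 <= t <= h -> 0 <= s <= h -> h + h < r ->
  ball x r (x + t *: e_ i + s *: e_ j).
Proof.
move=> /andP[t0 th] /andP[s0 sh] hr; apply/ball_rV; split=> [|k]; first lra.
rewrite !mxE eqxx/= opprD opprD addrA addrA subrr add0r -opprD normrN.
apply: le_lt_trans (ler_normD _ _) _; apply: le_lt_trans hr; apply: lerD.
  by rewrite ger0_norm ?mulr_ge0// (le_trans _ th)// ler_piMr// lern1 leq_b1.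
by rewrite ger0_norm ?mulr_ge0// (le_trans _ sh)// ler_piMr// lern1 leq_b1.
Qed.

(** The mean value theorem is applied in direction [i] to the increment of [f] in direction [j], and
    then in direction [j] to [partial i f]. *)
Lemma second_difference f x i j (h r : R) : 0 <= h -> h + h < r ->
  (forall z, ball x r z -> derivable (f : rV -> R^o) z (e_ i)) ->
  (forall z, ball x r z -> derivable (partial i f : rV -> R^o) z (e_ j)) ->
  exists2 P, ball x r P &
    f (x + h *: e_ i + h *: e_ j) - f (x + h *: e_ i) - (f (x + h *: e_ j) - f x)
      = partial j (partial i f) P * h * h.
Proof.
move=> h0 hr df ddf.
have b00 t : 0 <= t <= h -> 0 <= h <= h by rewrite lexx h0.
have mm t : Num.min 0 h <= t <= Num.max 0 h -> 0 <= t <= h by rewrite (min_idPl h0) (max_idPr h0).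
have [|t /mm th E] := @mvt_sym R (fun t => f ((x + h *: e_ j) + t *: e_ i) - f (x + t *: e_ i))
  (fun t => partial i f ((x + h *: e_ j) + t *: e_ i) - partial i f (x + t *: e_ i)) 0 h.
  move=> t /mm th; apply: is_deriveB.
    by apply: is_derive_slice; apply: df; apply: ball_two_steps hr => //; rewrite h0 lexx.
  apply: is_derive_slice; apply: df.
  by have := @ball_two_steps x i j t 0 h r; rewrite scale0r addr0; apply=> //; rewrite lexx.
have [|s /mm sh E2] := @mvt_sym R (fun s => partial i f ((x + t *: e_ i) + s *: e_ j))
  (fun s => partial j (partial i f) ((x + t *: e_ i) + s *: e_ j)) 0 h.
  by move=> s /mm sh; apply: is_derive_slice; apply: ddf; exact: ball_two_steps hr.
exists (x + t *: e_ i + s *: e_ j); first exact: ball_two_steps hr.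
move: E E2; rewrite !scale0r !addr0 !subr0 => E E2.
rewrite -E2 (addrAC x (h *: e_ i)) (addrAC x (t *: e_ i)).
rewrite -E; ring.
Qed.

(** The second difference is symmetric in [i] and [j], so the two mixed derivatives take a common
    value at points [P] and [Q] close to [x]. If they differed by [d] at [x], continuity within
    [d / 2] would contradict this. *)
Lemma clairaut f x i j : ck_at 2 f x ->
  partial j (partial i f) x = partial i (partial j f) x.
Proof.
move=> [_ Hf]; apply: contrapT => /eqP; rewrite -subr_eq0 -normr_gt0.
set d := `| _ |; move=> d0.
have dE : d = `|partial j (partial i f) x - partial i (partial j f) x| by [].
clearbody d.
have near_d k l : \forall z \near x,
    `|partial l (partial k f) x - partial l (partial k f) z| < d / 2.
  have [_ /(_ l)[_ [/near_self c _]]] := (Hf k).2.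
  by apply: near_dist; rewrite ?divr_gt0.
have D k l : \forall z \near x, derivable (f : rV -> R^o) z (e_ k) /\
    derivable (partial k f : rV -> R^o) z (e_ l).
  apply: nearI; first exact: (Hf k).1.
  exact: ((Hf k).2.2 l).1.
have /nbhs_ballP[r /= r0 Hr] := nearI (nearI (near_d i j) (near_d j i)) (nearI (D i j) (D j i)).
have h0 : 0 <= r / 3 by rewrite divr_ge0// ltW.
have hr : r / 3 + r / 3 < r by lra.
have [P bP EP] := second_difference h0 hr (fun z bz => (Hr z bz).2.1.1) (fun z bz => (Hr z bz).2.1.2).
have [Q bQ EQ] := second_difference h0 hr (fun z bz => (Hr z bz).2.2.1) (fun z bz => (Hr z bz).2.2.2).
have h3 : r / 3 != 0 by rewrite mulf_neq0 ?invr_neq0 ?lt0r_neq0.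
have PQ : partial j (partial i f) P = partial i (partial j f) Q.
  have alg (p q u v w s h : R) : u - v - (w - s) = p * h * h ->
      u - w - (v - s) = q * h * h -> h != 0 -> p = q.
    move=> E1 E2 hn0; apply: (mulIf hn0); apply: (mulIf hn0); rewrite -E1 -E2; ring.
  by rewrite (addrAC x) in EQ; exact: alg EP EQ h3.
have H1 := (Hr P bP).1.1; have H2 := (Hr Q bQ).1.2.
suff : d < d by rewrite ltxx.
have close (a b p q e : R) : p = q -> `|a - p| < e / 2 -> `|b - q| < e / 2 -> `|a - b| < e.
  move=> -> ap bq; rewrite -(subrKA q) [ltRHS]splitr.
  by apply: (le_lt_trans (ler_normD _ _)); rewrite (distrC q) ltrD.
by have := close _ _ _ _ _ PQ H1 H2; rewrite -dE.
Qed.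

End Clairaut.

(** * The flat function exp(-1/t) *)

Section FlatFunctions.
Context (R : realType).
Implicit Types (t : R) (m : nat).

(* [t^-m exp(-1/t)] for positive [t]; the derivatives of [flat 0], the usual
   germ of a bump function, are linear combinations of these functions. *)
Definition flat m t : R := if 0 < t then t^-1 ^+ m * expR (- t^-1) else 0.

Lemma flat_ge0 m t : 0 <= flat m t.
Proof. by rewrite /flat; case: ifPn => // t0; rewrite mulr_ge0 ?exprn_ge0 ?invr_ge0 ?ltW ?expR_gt0. Qed.

Lemma flat0_gt0 t : (0 < flat 0 t) = (0 < t).
Proof. by rewrite /flat; case: ifPn => t0; rewrite ?ltxx// expr0 mul1r expR_gt0. Qed.

(** This is [exp(s / k) >= s / k] raised to the power [k]. *)
Lemma expR_ge_pow (k : nat) (s : R) : 0 <= s -> s ^+ k <= k%:R ^+ k * expR s.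
Proof.
move=> s0; case: k => [|k]; first by rewrite !expr0 mul1r -expR0 ler_expR.
have k0 : 0 < k.+1%:R :> R by rewrite ltr0n.
have -> : expR s = expR (s / k.+1%:R) ^+ k.+1.
  by rewrite -expRM_natl -mulr_natl mulrCA divff ?mulr1// lt0r_neq0.
rewrite -exprMn; apply: lerXn2r; rewrite ?nnegrE ?mulr_ge0 ?expR_ge0//.
rewrite -ler_pdivrMl// mulrC.
by apply: le_trans (expR_ge1Dx _); rewrite lerDr.
Qed.

(** A quadratic bound makes the derivative at 0 exist and vanish. For positive [t] it comes from
    [t^-m = t^-(m+2) t^2] and the previous estimate at [t^-1]. *)
Lemma flat_le m t : `|flat m t| <= m.+2%:R ^+ m.+2 * t ^+ 2.
Proof.
rewrite ger0_norm ?flat_ge0// /flat; case: ifPn => t0; last first.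
  by rewrite mulr_ge0 ?sqr_ge0 ?exprn_ge0.
have := @expR_ge_pow m.+2 t^-1; rewrite invr_ge0 ltW// => /(_ isT) H.
rewrite expRN ler_pdivrMr ?expR_gt0// mulrAC.
have -> : t^-1 ^+ m = t^-1 ^+ m.+2 * t ^+ 2.
  by rewrite -addn2 exprD -mulrA -exprMn mulVf ?expr1n ?mulr1// lt0r_neq0.
by rewrite ler_wpM2r ?sqr_ge0.
Qed.

Lemma is_derive_flat m t :
  is_derive t (1 : R^o) (flat m : R -> R^o) (flat m.+2 t - m%:R * flat m.+1 t).
Proof.
case: (ltgtP t 0) => [t0|t0|->].
- apply: (@near_eq_is_derive _ _ _ (cst 0 : R -> R^o)).
    near=> s; rewrite /flat ifF//; apply: lt_gtF.
    by near: s; exact: lt_nbhsl.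
  by rewrite /flat !(lt_gtF t0) mulr0 subr0; exact: is_derive_cst.
- apply: (@near_eq_is_derive _ _ _ (fun s : R => s^-1 ^+ m * expR (- s^-1) : R^o)).
    near=> s; rewrite /flat ifT//.
    by near: s; exact: lt_nbhsr.
  have dV : is_derive t (1 : R^o) (fun s : R => s^-1 : R^o) (- t^-1 ^+ 2).
    split; first by apply: derivableV => //; exact: lt0r_neq0.
    rewrite (@deriveV _ _ (@id R^o) t 1)//; last exact: lt0r_neq0.
    by rewrite derive_id /GRing.scale/= mulr1 exprVn.
  have dE : is_derive t (1 : R^o) (fun s : R => expR (- s^-1) : R^o) (t^-1 ^+ 2 * expR (- t^-1)).
    have dN : is_derive t (1 : R^o) (fun s : R => - s^-1 : R^o) (t^-1 ^+ 2).
      by apply: is_derive_eq; rewrite opprK.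
    have := @is_derive1_comp R expR (fun s => - s^-1) t _ _ (is_derive_expR _) dN.
    by move/is_derive_eq; apply; rewrite mulrC.
  have dX : is_derive t (1 : R^o) (fun s : R => s^-1 ^+ m : R^o) (m%:R * t^-1 ^+ m.-1 * - t^-1 ^+ 2).
    apply: (@is_derive1_comp R (fun s => s ^+ m) (fun s => s^-1) t _ _ _ dV).
    split; first exact: exprn_derivable.
    by rewrite exp_derive /GRing.scale/= mulr1.
  have := @is_deriveM _ _ _ _ t 1 _ _ dX dE.
  move/is_derive_eq; apply; rewrite /flat t0 /GRing.scale/=.
  case: m dX => [|m] dX; rewrite /= ?mul0r ?expr0 ?exprS; ring.
- have f0 k : flat k 0 = 0 by rewrite /flat ltxx.
  have lim : h^-1 *: ((flat m \o shift 0) (h *: (1 : R^o)) - flat m 0) @[h --> (0:R)^'] --> (0 : R^o).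
    have c0 : m.+2%:R ^+ m.+2 * `|h| @[h --> (0:R)^'] --> (0 : R).
      have c0 : m.+2%:R ^+ m.+2 * `|h| @[h --> (0:R)] --> m.+2%:R ^+ m.+2 * `|0 : R|.
        by apply: cvgM; [exact: cvg_cst | exact: (@norm_continuous _ R^o 0)].
      rewrite normr0 mulr0 in c0; apply: cvg_trans c0; apply: cvg_app.
      exact: (@cvg_within _ (nbhs (0 : R))).
    apply: norm_cvg0; apply: (squeeze_cvgr _ (cvg_cst 0) c0).
    near=> h; rewrite normr_ge0/= f0 subr0 addr0 [_ *: 1]mulr1 normrM normfV.
    have h0 : 0 < `|h| by rewrite normr_gt0; near: h; exact: nbhs_dnbhs_neq.
    rewrite -ler_pdivlMl ?invr_gt0// invrK mulrCA -expr2 real_normK ?num_real//.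
    exact: flat_le.
  rewrite !f0 mulr0 subr0; split; first by apply/cvg_ex; exists 0.
  exact: cvg_lim lim.
Unshelve. all: by end_near.
Qed.

End FlatFunctions.

Lemma smooth_at_flat (R : realType) (n : nat) (m : nat) (f : 'rV[R]_n -> R) x :
  smooth_at f x -> smooth_at (fun y => flat m (f y)) x.
Proof.
move=> Hf k; elim: k m => [|k IH] m.
  apply: (@ck_at_comp0 _ _ _ setT) => //; last by apply: near_all.
  move=> t _; apply/differentiable_continuous/derivable1_diffP.
  exact: (@ex_derive _ _ _ _ _ _ _ (is_derive_flat m t)).
apply: (@ck_at_comp1 _ _ _ _ (fun t => flat m.+2 t - m%:R * flat m.+1 t) setT) => //.
- by move=> t _; exact: is_derive_flat.
- by apply: near_all.
apply: ck_atD; first exact: IH.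
apply: ck_at_congr (ck_atM (ck_at_cst k (- m%:R) x) (IH m.+1)).
by apply: near_all => y; rewrite mulNr.
Qed.

(** * The Poincaré lemma on a coordinate ball *)

Section Poincare.
Context (R : realType) (n : nat).
Notation rV := 'rV[R]_n.
Implicit Types (f g : rV -> R) (x y z : rV).
Notation e_ i := (delta_mx 0 i : rV).
Notation mu := (@lebesgue_measure R).

Definition cube x (r : R) : set rV := [set z | forall j, `|x 0 j - z 0 j| <= r].

Lemma cube_compact x r : compact (cube x r).
Proof.
rewrite (_ : cube x r = [set z : rV | forall j, `[x 0 j - r, x 0 j + r]%classic (z ord0 j)]).
  by apply: (@rV_compact R n (fun j => `[x 0 j - r, x 0 j + r]%classic)) => j; exact: segment_compact.
apply/seteqP; split=> z Hz j; move: (Hz j); rewrite /= in_itv/= ler_norml.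
  by move=> /andP[? ?]; apply/andP; split; lra.
by move=> /andP[? ?]; apply/andP; split; lra.
Qed.

Lemma cube_bounded x r f : (forall z, cube x r z -> {for z, continuous f}) ->
  exists C, forall z, cube x r z -> `|f z| <= C.
Proof.
move=> cf.
have cK : compact (f @` cube x r).
  apply: continuous_compact (@cube_compact x r).
  apply/subspace_continuousP => z Kz.
  apply: cvg_trans (cf z Kz); apply: cvg_app; exact: cvg_within.
have [M [_ HM]] := compact_bounded cK.
exists (M + 1) => z Kz; apply: (HM (M + 1)); first by rewrite ltrDl.
by exists z.
Qed.

Lemma seg_cube c x (r t : R) : 0 <= t <= 1 -> cube c r x -> cube c r (c + t *: (x - c)).
Proof.
move=> /andP[t0 t1] cx j; rewrite !mxE opprD addrA subrr add0r normrN normrM ger0_norm//.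
by rewrite -[leRHS]mul1r ler_pM// distrC; exact: cx.
Qed.

Variables (eta : 'I_n -> rV -> R) (c : rV) (r : R).
Hypothesis r_gt0 : 0 < r.
Hypothesis smooth_eta : forall x, ball c r x -> forall j, smooth_at (eta j) x.
Hypothesis closed_eta : forall x, ball c r x -> forall i j,
  partial i (eta j) x = partial j (eta i) x.

(** The radial homotopy operator: [prim x] integrates [eta] along the segment from [c] to [x], [G x]
    is the integrand, and [dG i x] is its derivative in the [i]-th coordinate of [x]. *)
Let gam x t : rV := c + t *: (x - c).
Let G x (t : R) : R := \sum_j eta j (gam x t) * (x 0 j - c 0 j).
Let dG i x (t : R) : R :=
  \sum_j t * partial i (eta j) (gam x t) * (x 0 j - c 0 j) + eta i (gam x t).
Let prim x : R := \int[mu]_(t in `[0, 1]) G x t.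

Let ball_cube x (rho : R) : rho < r -> cube c rho x -> ball c r x.
Proof.
by move=> rr cx; apply/ball_rV; split=> // j; apply: le_lt_trans rr; exact: cx.
Qed.

Let gam_ball x t : 0 <= t <= 1 -> ball c r x -> ball c r (gam x t).
Proof.
move=> /andP[t0 t1] /ball_rV[_ cx]; apply/ball_rV; split=> // j.
rewrite !mxE opprD addrA subrr add0r normrN normrM ger0_norm//.
apply: le_lt_trans (cx j); rewrite distrC -[leRHS]mul1r ler_wpM2r//.
Qed.

Let derive_gam x t k : is_derive t (1 : R^o) (fun s : R => gam x s 0 k : R^o) (x 0 k - c 0 k).
Proof.
have -> : (fun s : R => gam x s 0 k) = (fun s : R => c 0 k + s * (x 0 k - c 0 k)).
  by apply/funext => s; rewrite !mxE.
apply: is_derive_eq; rewrite /GRing.scale/=; ring.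
Qed.

Let derive_along f x t : 0 <= t <= 1 -> ball c r x -> smooth_at f (gam x t) ->
  is_derive t (1 : R^o) (fun s : R => f (gam x s) : R^o)
    (\sum_k partial k f (gam x t) * (x 0 k - c 0 k)).
Proof.
by move=> t01 bx sf; apply: chain_curve => //; exact: smooth_at_C1.
Qed.

Let derivable_along_sum (u : 'I_n -> R -> R) t : (forall j, derivable (u j : R -> R^o) t 1) ->
  derivable (fun s => \sum_j u j s : R^o) t 1.
Proof.
move=> du; have := @derivable_sum R R^o R^o n u t 1 du.
by congr (derivable _ t 1); apply/funext => s; rewrite fct_sumE.
Qed.

Let derivable_G x t : 0 <= t <= 1 -> ball c r x -> derivable (G x : R -> R^o) t 1.
Proof.
move=> t01 bx; apply: derivable_along_sum => j; apply: derivableM; last exact: derivable_cst.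
exact: (@ex_derive _ _ _ _ _ _ _ (derive_along t01 bx (smooth_eta (gam_ball t01 bx) j))).
Qed.

Let derivable_dG i x t : 0 <= t <= 1 -> ball c r x -> derivable (dG i x : R -> R^o) t 1.
Proof.
move=> t01 bx; have gb := gam_ball t01 bx.
apply: derivableD; last first.
  exact: (@ex_derive _ _ _ _ _ _ _ (derive_along t01 bx (smooth_eta gb i))).
apply: derivable_along_sum => j; apply: derivableM; last exact: derivable_cst.
apply: derivableM; first exact: derivable_id.
have := derive_along t01 bx (smooth_at_partial i (smooth_eta gb j)).
by move=> H; exact: (@ex_derive _ _ _ _ _ _ _ H).
Qed.

Let derive_G_slice i x (s t : R) : 0 <= t <= 1 -> ball c r (x + s *: e_ i) ->
  is_derive s (1 : R^o) (fun s : R => G (x + s *: e_ i) t : R^o) (dG i (x + s *: e_ i) t).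
Proof.
move=> t01 bx; have gb := gam_ball t01 bx.
have dj j : is_derive s (1 : R^o)
    (fun s : R => eta j (gam (x + s *: e_ i) t) * ((x + s *: e_ i) 0 j - c 0 j) : R^o)
    (t * partial i (eta j) (gam (x + s *: e_ i) t) * ((x + s *: e_ i) 0 j - c 0 j) +
     eta j (gam (x + s *: e_ i) t) * (i == j)%:R).
  have d1 : is_derive s (1 : R^o) (fun s : R => eta j (gam (x + s *: e_ i) t) : R^o)
      (t * partial i (eta j) (gam (x + s *: e_ i) t)).
    have := @chain_curve R n (eta j) (fun s => gam (x + s *: e_ i) t)
      (fun k => t * (i == k)%:R) s (smooth_at_C1 (smooth_eta gb j)).
    rewrite (bigD1 i)//= big1 ?addr0; last first.
      by move=> k ki; rewrite eq_sym (negPf ki) !mulr0.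
    rewrite eqxx mulr1 mulrC; apply => k.
    have -> : (fun s : R => gam (x + s *: e_ i) t 0 k) =
        (fun s : R => c 0 k + t * (x 0 k + s * (i == k)%:R - c 0 k)).
      by apply/funext => u; rewrite !mxE eqxx/= eq_sym.
    apply: is_derive_eq; rewrite /GRing.scale/=; ring.
  have d2 : is_derive s (1 : R^o) (fun s : R => (x + s *: e_ i) 0 j - c 0 j : R^o) (i == j)%:R.
    have -> : (fun s : R => (x + s *: e_ i) 0 j - c 0 j) =
        (fun s : R => x 0 j + s * (i == j)%:R - c 0 j).
      by apply/funext => u; rewrite !mxE eqxx/= eq_sym.
    apply: is_derive_eq; rewrite /GRing.scale/=; ring.
  have := @is_deriveM _ _ _ _ s 1 _ _ d1 d2.
  by move/is_derive_eq; apply; rewrite /GRing.scale/=; ring.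
have := @is_derive_sum R R^o R^o n _ s 1 _ dj.
have -> : \sum_(j < n) (fun s : R => eta j (gam (x + s *: e_ i) t) * ((x + s *: e_ i) 0 j - c 0 j) : R^o)
   = (fun s => G (x + s *: e_ i) t).
  by apply/funext => u; rewrite fct_sumE.
move/is_derive_eq; apply; rewrite big_split/= /dG; congr (_ + _).
rewrite (bigD1 i)//= big1 ?addr0 ?eqxx ?mulr1// => k ki.
by rewrite eq_sym (negPf ki) mulr0.
Qed.

Let continuous_on01 (u : R -> R) : (forall t, 0 <= t <= 1 -> derivable (u : R -> R^o) t 1) ->
  {within `[0, 1], continuous u}.
Proof.
move=> du; apply: derivable_within_continuous => t; rewrite in_itv/=; exact: du.
Qed.

Let integrable01 (u : R -> R) : (forall t, 0 <= t <= 1 -> derivable (u : R -> R^o) t 1) ->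
  mu.-integrable `[0, 1] (EFin \o u).
Proof.
move=> du; apply: continuous_compact_integrable; first exact: segment_compact.
exact: continuous_on01.
Qed.

(** Closedness turns [dG i x] into the derivative in [t] of [t * eta i (gam x t)], and the
    fundamental theorem of calculus leaves the value at 1. *)
Let integral_dG i x : ball c r x -> \int[mu]_(t in `[0, 1]) dG i x t = eta i x.
Proof.
move=> bx.
have dH (t : R) : 0 <= t <= 1 -> is_derive t (1 : R^o) (fun s : R => s * eta i (gam x s) : R^o) (dG i x t).
  move=> t01; have gb := gam_ball t01 bx.
  have := @is_deriveM _ _ _ _ t 1 _ _ (@is_derive_id R R^o t 1) (derive_along t01 bx (smooth_eta gb i)).
  move/is_derive_eq; apply; rewrite /dG /GRing.scale/= mulr1; congr (_ + _).
  rewrite mulr_sumr; apply: eq_bigr => k _; rewrite mulrA; congr (_ * _ * _).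
  exact: closed_eta.
rewrite /Rintegral (@continuous_FTC2 _ _ (fun s : R => s * eta i (gam x s)))//.
- by rewrite /= mul1r mul0r subr0 /gam scale1r addrC subrK.
- by apply: continuous_on01 => t t01; exact: derivable_dG.
- have cH (t : R) : 0 <= t <= 1 -> {for t, continuous (fun s : R => s * eta i (gam x s))}.
    move=> t01; apply/differentiable_continuous/derivable1_diffP.
    exact: (@ex_derive _ _ _ _ _ _ _ (dH t t01)).
  split.
  + move=> t; rewrite in_itv/= => /andP[t0 t1].
    by apply: (@ex_derive _ _ _ _ _ _ _ (dH t _)); rewrite !ltW.
  + by apply: cvg_at_right_filter; apply: cH; rewrite lexx ler01.
  + by apply: cvg_at_left_filter; apply: cH; rewrite lexx ler01.
- move=> t; rewrite in_itv/= => /andP[t0 t1]; rewrite derive1E.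
  by apply: (@derive_val _ _ _ _ _ _ _ (dH t _)); rewrite !ltW.
Qed.

(** Differentiation under the integral sign reduces the claim to [integral_dG]. The work lies in a
    bound on [dG] that is uniform in the displacement along the [i]-th axis. *)
Lemma poincare : exists f, forall x, ball c r x -> forall i,
  is_derive x (e_ i) (f : rV -> R^o) (eta i x).
Proof.
exists prim => x bx i; apply: is_derive_of_slice.
(* With [rho] the sup-distance from [c] to [x], half of the gap to [r] is the admissible
   displacement [d]; all points involved then lie in the compact cube of radius [rho + d], inside
   the ball. *)
have [rho [rho_r xrho rho0]] : exists rho, [/\ rho < r, cube c rho x & 0 <= rho].
  exists (\big[Num.max/0]_j `|c 0 j - x 0 j|); split.
  - by rewrite bigmax_lt// => j _; case/ball_rV : bx.
  - by move=> j; exact: le_bigmax.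
  - exact: bigmax_ge_id.
pose d := (r - rho) / 2; have d0 : 0 < d by rewrite /d; lra.
have rd : rho + d < r by rewrite /d; lra.
have cs (s : R) : - d < s < d -> cube c (rho + d) (x + s *: e_ i).
  move=> /andP[? ?] j; rewrite !mxE eqxx/= opprD addrA.
  apply: le_trans (ler_normB _ _) _; apply: lerD; first exact: xrho.
  case: eqP => _; rewrite ?mulr1 ?mulr0 ?normr0 ?ler_norml; last exact: ltW.
  by apply/andP; split; lra.
have bs s : - d < s < d -> ball c r (x + s *: e_ i) by move=> /cs; exact: ball_cube.
have [C HC] : exists C : 'I_n -> R, forall j z, cube c (rho + d) z ->
    `|eta j z| <= C j /\ `|partial i (eta j) z| <= C j.
  apply: (@fin_all_exists _ _ (fun j (C : R) => forall z, cube c (rho + d) z ->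
    `|eta j z| <= C /\ `|partial i (eta j) z| <= C)) => j.
  have [|C1 H1] := @cube_bounded c (rho + d) (eta j).
    by move=> z /(ball_cube rd) /smooth_eta /(_ j) /smooth_at_C1; exact: C1_continuous.
  have [|C2 H2] := @cube_bounded c (rho + d) (partial i (eta j)).
    move=> z /(ball_cube rd) /smooth_eta /(_ j) /(smooth_at_partial i) /smooth_at_C1.
    exact: C1_continuous.
  exists (Num.max C1 C2) => z Kz.
  by rewrite !le_max H1 ?H2 ?orbT.
(* The terms of [dG] are estimated separately, with [t] at most 1 and coordinates of [x + s *: e_ i]
   within [rho + d] of those of [c]. *)
pose K := \sum_j C j * (rho + d) + C i.
have bound s t : - d < s < d -> 0 <= t <= 1 -> `|dG i (x + s *: e_ i) t| <= K.
  move=> sd t01; have Kz := seg_cube t01 (cs s sd).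
  apply: le_trans (ler_normD _ _) _; apply: lerD; last exact: (HC i _ Kz).1.
  apply: le_trans (ler_norm_sum _ _ _) _; apply: ler_sum => j _.
  rewrite !normrM; apply: ler_pM => //; last by rewrite distrC; exact: (cs s sd).
  move: t01 => /andP[t0 t1]; rewrite -[leRHS]mul1r; apply: ler_pM => //.
    by rewrite ger0_norm.
  exact: (HC j _ Kz).2.
have I0 : `]- d, d[%classic 0 by rewrite /= in_itv/= d0 oppr_lt0 d0.
pose f (s t : R) := G (x + s *: e_ i) t.
have intf s : `]- d, d[%classic s -> mu.-integrable `[0, 1] (EFin \o f s).
  rewrite /= in_itv/= => /bs bxs; apply: integrable01 => t t01.
  exact: derivable_G.
have dfs s t : `]- d, d[%classic s -> `[0, 1]%classic t ->
    is_derive s (1 : R^o) (f ^~ t : R -> R^o) (dG i (x + s *: e_ i) t).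
  rewrite /= !in_itv/= => /bs bxs t01; exact: derive_G_slice.
have K0 : 0 <= K.
  have d00 : - d < 0 < d by rewrite oppr_lt0 d0.
  have z01 : 0 <= (0 : R) <= 1 by rewrite lexx ler01.
  exact: le_trans (normr_ge0 _) (bound 0 0 d00 z01).
have df1 s t : `]- d, d[%classic s -> `[0, 1]%classic t -> derivable (f ^~ t : R -> R^o) s 1.
  by move=> Is It; exact: (@ex_derive _ _ _ _ _ _ _ (dfs s t Is It)).
have d1 s t : `]- d, d[%classic s -> `[0, 1]%classic t ->
    partial1of2 f s t = dG i (x + s *: e_ i) t.
  by move=> Is It; rewrite partial1of2E; exact: (@derive_val _ _ _ _ _ _ _ (dfs s t Is It)).
have intK : mu.-integrable `[0, 1] (EFin \o (fun=> K)).
  by apply: integrable01 => t _; exact: derivable_cst.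
have ub s t : `]- d, d[%classic s -> `[0, 1]%classic t -> `|partial1of2 f s t| <= K.
  move=> Is It; rewrite d1//; apply: bound; first by move: Is; rewrite /= in_itv.
  by move: It; rewrite /= in_itv.
have m01 : measurable (`[0, 1]%classic : set (measurableTypeR R)) by exact: measurable_itv.
have dF := derivable_under_integral m01 I0 intf df1 (fun=> K0) intK ub.
have eF := differentiation_under_integral m01 I0 intf df1 (fun=> K0) intK ub.
split; first exact: dF.
rewrite -derive1E [LHS]eF -(integral_dG i bx); apply: eq_Rintegral => t.
by rewrite inE => t01; rewrite d1// scale0r addr0.
Qed.

End Poincare.

(** * Charts and local primitives *)

Section Manifolds.
Context (R : realType) (n : nat).
Implicit Types M N : manifold R n.
Notation rV := 'rV[R]_n.
Notation e_ i := (delta_mx 0 i : rV).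
Notation rng a := (chart_rng (atlas a)).
Notation dom a := (chart_dom (atlas a)).
Notation inv a := (chart_inv (atlas a)).

Lemma rng_open M (a : atlas_idx M) : open (rng a).
Proof. exact: chart_rng_open. Qed.

Lemma near_rng M (a : atlas_idx M) x : rng a x -> \forall z \near x, rng a z.
Proof. by move=> ax; apply: near_open ax; exact: chart_rng_open. Qed.

Lemma near_chart_dom M (a : atlas_idx M) q : dom a q -> \forall z \near q, dom a z.
Proof. by move=> aq; apply: near_open aq; exact: chart_dom_open. Qed.

Lemma chart_cont M (a : atlas_idx M) q : dom a q -> {for q, continuous (atlas a)}.
Proof. by move=> aq; apply: chart_map_cont; rewrite inE. Qed.

Lemma inv_cont M (a : atlas_idx M) x : rng a x -> {for x, continuous (inv a)}.
Proof. by move=> ax; apply: chart_inv_cont; rewrite inE. Qed.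

Lemma smooth_on_cont M N (V : set M) (F : M -> N) q : smooth_on V F -> V q -> {for q, continuous F}.
Proof. by move=> [cF _] Vq; apply: cF; rewrite inE. Qed.

Lemma smooth_on_id M : smooth_on setT (@idfun M).
Proof.
split=> [q _|a b j]; first exact: cvg_id.
rewrite (_ : [set x | _] = [set x | rng a x /\ dom b (inv a x)]); first exact: atlas_smooth.
by apply/seteqP; split=> x /= [] // ? ?; split.
Qed.

Lemma near_dom_comp M N (V : set M) (F : M -> N) a b x : open V -> smooth_on V F -> rng a x ->
  V (inv a x) -> dom b (F (inv a x)) ->
  \forall z \near x, [/\ rng a z, V (inv a z) & dom b (F (inv a z))].
Proof.
move=> oV sF ax Vx bx.
have n1 : \forall z \near x, V (inv a z) by apply: (near_comp (inv_cont ax)); exact: near_open.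
have n2 : \forall z \near x, dom b (F (inv a z)).
  have n2 := near_comp (smooth_on_cont sF Vx) (near_chart_dom bx).
  exact: (near_comp (inv_cont ax) n2).
by apply: nearS2 (near_rng ax) (nearI n1 n2) => z ? [].
Qed.

Lemma smooth_on_at M N (V : set M) (F : M -> N) a b x j : open V -> smooth_on V F -> rng a x ->
  V (inv a x) -> dom b (F (inv a x)) ->
  smooth_at (fun z => (atlas b) (F (inv a z)) 0 j) x.
Proof.
move=> oV sF ax Vx bx.
have oD : open [set x | [/\ rng a x, V (inv a x) & dom b (F (inv a x))]].
  rewrite openE => z [az Vz bz]; exact: near_dom_comp.
by apply: ((CinftyE _ oD).1 (sF.2 a b j)); split.
Qed.

Lemma cvg_chart_comp M N (V : set M) (F : M -> N) a b x : smooth_on V F -> rng a x ->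
  V (inv a x) -> dom b (F (inv a x)) ->
  {for x, continuous (fun z => (atlas b) (F (inv a z)))}.
Proof.
move=> sF ax Vx bx.
apply: (@continuous_comp _ _ _ (fun z => F (inv a z)) (atlas b)); last exact: chart_cont.
apply: (@continuous_comp _ _ _ (inv a) F); first exact: inv_cont.
exact: (smooth_on_cont sF Vx).
Qed.

(* The weight [mu] accommodates primitives of [exp(-phi) w]. *)
Lemma pullback_gradient M N (F : M -> N) (w : form1 N) (eta : form1 M)
    (a : atlas_idx N) (b : atlas_idx M) (f mu : rV -> R) x :
  smooth_on setT F -> is_pullback F w eta -> rng b x -> dom a (F (inv b x)) ->
  (\forall z \near atlas a (F (inv b x)),
    C1_at f z /\ forall j, partial j f z = mu z * w a z 0 j) ->
  forall i, \forall z \near x,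
    is_derive z (e_ i) (fun z => f (atlas a (F (inv b z))) : R^o)
      (mu (atlas a (F (inv b z))) * eta b z 0 i).
Proof.
move=> sF pb bx ax Hf i.
have nf := near_comp (cvg_chart_comp sF bx I ax) Hf.
have nd := near_dom_comp openT sF bx I ax.
apply: (nearS2 _ nf nd) => z [C1f gf] [bz _ az].
have dT k : derivable (fun z => (atlas a) (F (inv b z)) 0 k : R^o) z (e_ i).
  exact: smooth_at_derivable (smooth_on_at k openT sF bz I az).
have := chain_rule C1f dT; move/is_derive_eq; apply.
rewrite (pb b a z bz az) mxE mulr_sumr; apply: eq_bigr => k _.
by rewrite gf mulrA.
Qed.

Lemma near_const_of_gradient0 M (f : M -> R) (a : atlas_idx M) q : dom a q ->
  (forall i, \forall x \near atlas a q, is_derive x (e_ i) (fun z => f (inv a z) : R^o) (0 : R)) ->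
  \forall q' \near q, f q' = f q.
Proof.
move=> aq /(near_forall (I := 'I_n)) /nbhs_ballP[r /= r0 Hr].
have nb : \forall q' \near q, ball (atlas a q) r (atlas a q').
  by apply: (near_comp (chart_cont aq)); exact: nbhsx_ballx.
apply: nearS2 (near_chart_dom aq) nb => q' aq' bq'.
have := @gradient0_const R n (fun z => f (inv a z)) (atlas a q) r (atlas a q) (atlas a q') (ballxx _ r0) bq'.
by rewrite !chart_mapK//; apply=> z i zb; exact: Hr.
Qed.

(** Coordinate balls. Their convexity provides both primitives of closed forms and paths that stay
    inside; they index the local transports of the connection. *)
Record patch M := Patch {
  patch_chart : atlas_idx M;
  patch_center : rV;
  patch_radius : R;
  patch_radius_gt0 : 0 < patch_radius;
  patch_sub : ball patch_center patch_radius `<=` rng patch_chart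
}.

Definition patch_dom M (i : patch M) : set M :=
  [set q | dom (patch_chart i) q /\
    ball (patch_center i) (patch_radius i) (atlas (patch_chart i) q)].

Lemma ball_near (c x : rV) (r : R) : ball c r x -> \forall z \near x, ball c r z.
Proof.
move=> cx; have [r0 H] := (ball_rV c r x).1 cx.
have : \forall z \near x, forall j, `|c 0 j - (z : rV) 0 j| < r.
  apply: near_forall => j.
  have e0 : 0 < r - `|c 0 j - x 0 j| by rewrite subr_gt0.
  have : \forall z \near x, `|x 0 j - (z : rV) 0 j| < r - `|c 0 j - x 0 j|.
    exact: near_dist (@coord_continuous R 1 n 0 j x) e0.
  apply: nearS => z Hz; rewrite -(subrKA (x 0 j)).
  by apply: le_lt_trans (ler_normD _ _) _; lra.
by apply: nearS => z Hz; apply/ball_rV.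
Qed.

Lemma patch_open M (i : patch M) : open (patch_dom i).
Proof.
rewrite openE => q [aq bq]; apply: nearI; first exact: near_chart_dom.
by apply: (near_comp (chart_cont aq)); exact: ball_near.
Qed.

Lemma patch_exists M (a : atlas_idx M) (V : set M) q : open V -> V q -> dom a q ->
  exists i : patch M, [/\ patch_chart i = a, patch_center i = atlas a q,
    patch_dom i q & patch_dom i `<=` V].
Proof.
move=> oV Vq aq; have ra := chart_map_rng aq.
have nV : \forall z \near atlas a q, V (inv a z).
  by apply: (near_comp (inv_cont ra)); rewrite chart_mapK//; exact: near_open.
have /nbhs_ballP[r /= r0 Hr] := nearI (near_rng ra) nV.
exists (@Patch M a (atlas a q) r r0 (fun z bz => (Hr z bz).1)); split=> //=.
  by split=> //; exact: ballxx.
by move=> q' [/= aq' /Hr[_]]; rewrite chart_mapK.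
Qed.

Lemma patch_path M (i : patch M) q q' : patch_dom i q -> patch_dom i q' ->
  exists g, is_path q q' g /\ forall t : R, t \in `[0, 1] -> patch_dom i (g t).
Proof.
set a := patch_chart i; move=> [aq bq] [aq' bq'].
pose l (t : R) := atlas a q + t *: (atlas a q' - atlas a q).
have bl t : 0 <= t <= 1 -> ball (patch_center i) (patch_radius i) (l t).
  move=> /andP[t0 t1]; apply/ball_rV; split=> [|j]; first exact: patch_radius_gt0.
  have := ((ball_rV _ _ _).1 bq).2 j; have := ((ball_rV _ _ _).1 bq').2 j.
  rewrite !mxE => bq'j bqj; set u := _ - atlas a q 0 j in bqj.
  set v := _ - atlas a q' 0 j in bq'j.
  have -> : patch_center i 0 j - (atlas a q 0 j + t * (atlas a q' 0 j - atlas a q 0 j)) =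
      (1 - t) * u + t * v by rewrite /u /v; ring.
  have uvr : Num.max `|u| `|v| < patch_radius i by rewrite gt_max bqj.
  apply: le_lt_trans uvr; apply: le_trans (ler_normD _ _) _.
  rewrite !normrM (ger0_norm t0) ger0_norm ?subr_ge0//.
  set m := Num.max _ _; rewrite (_ : m = (1 - t) * m + t * m); last by ring.
  by apply: lerD; rewrite ler_wpM2l ?subr_ge0// le_max lexx ?orbT.
have rl t : 0 <= t <= 1 -> rng a (l t) by move=> /bl; exact: patch_sub.
have cl : continuous l.
  move=> t; apply: cvg_coord => j.
  have -> : (fun s => l s 0 j) = (fun s : R => atlas a q 0 j + s * (atlas a q' 0 j - atlas a q 0 j)).
    by apply/funext => s; rewrite !mxE.
  rewrite !mxE; apply: cvgD; first exact: cvg_cst.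
  by apply: cvgM; [exact: cvg_id | exact: cvg_cst].
exists (fun t => inv a (l t)); split; last first.
  move=> t; rewrite in_itv/= => t01; split; first by apply: chart_inv_dom; exact: rl.
  by rewrite chart_invK; [exact: bl | exact: rl].
split.
- apply/subspace_continuousP => t; rewrite /= in_itv/= => t01.
  apply: cvg_trans (cvg_app _ (@cvg_within _ (nbhs t) _ _)) _ => /=.
  exact: (@continuous_comp _ _ _ l (inv a) t (cl t) (inv_cont (rl t t01))).
- by rewrite /l scale0r addr0 chart_mapK.
- by rewrite /l scale1r addrC subrK chart_mapK.
Qed.

Lemma smooth_funE M (f : M -> R) : smooth_fun f <->
  forall a x, rng a x -> smooth_at (fun z => f (inv a z)) x.
Proof.
split=> [sf a x ax|H a]; first exact: ((CinftyE _ (@rng_open _ a)).1 (sf a) x ax).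
by apply: ((CinftyE _ (@rng_open _ a)).2) => x; exact: H.
Qed.

Lemma form1_smooth M (w : form1 M) a x j : is_form1 w -> rng a x ->
  smooth_at (fun z => w a z 0 j) x.
Proof. by move=> [sw _] ax; exact: ((CinftyE _ (@rng_open _ a)).1 (sw a j) x ax). Qed.

Definition primitive_on M (i : patch M) (phi : rV -> R) (eta : 'I_n -> rV -> R) :=
  forall x, ball (patch_center i) (patch_radius i) x ->
    smooth_at phi x /\ forall j, is_derive x (e_ j) (phi : rV -> R^o) (eta j x).

Lemma primitive_exists M (i : patch M) (eta : 'I_n -> rV -> R) :
  (forall x, ball (patch_center i) (patch_radius i) x -> forall j, smooth_at (eta j) x) ->
  (forall x, ball (patch_center i) (patch_radius i) x -> forall j k,
     partial j (eta k) x = partial k (eta j) x) ->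
  exists phi, primitive_on i phi eta.
Proof.
move=> se ce; have [phi Hphi] := poincare (patch_radius_gt0 i) se ce.
exists phi => x bx; split; last exact: Hphi.
apply: smooth_at_gradient (se x bx) => j.
by apply: nearS (ball_near bx) => z bz; exact: Hphi.
Qed.

Lemma closed_primitive M (theta : form1 M) (i : patch M) : is_form1 theta -> closed1 theta ->
  exists phi, primitive_on i phi (fun j x => theta (patch_chart i) x 0 j).
Proof.
move=> tf tc; apply: primitive_exists => x /patch_sub ax j.
  exact: form1_smooth.
move=> k; apply/eqP; rewrite -subr_eq0; apply/eqP.
by have := tc _ x ax; move/matrixP => /(_ j k); rewrite !mxE.
Qed.

(** The form is closed because [d (exp(-phi) w) = exp(-phi) (dw - theta /\ w)]. *)
Lemma twisted_primitive M (theta w : form1 M) (i : patch M) phi :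
  is_form1 theta -> primitive_on i phi (fun j x => theta (patch_chart i) x 0 j) ->
  is_form1 w -> form2_zero (dtw1 theta w) ->
  exists k, primitive_on i k (fun j x => expR (- phi x) * w (patch_chart i) x 0 j).
Proof.
move=> tf Hphi wf wc; set a := patch_chart i in Hphi *.
have sE x : ball (patch_center i) (patch_radius i) x -> smooth_at (fun x => expR (- phi x)) x.
  by move=> /Hphi[sphi _]; apply: smooth_at_exp; exact: smooth_atN.
apply: primitive_exists => x bx.
  by move=> j; apply: smooth_atM; [exact: sE | apply: form1_smooth => //; exact: patch_sub].
have ax := patch_sub bx.
have P j k : partial j (fun x => expR (- phi x) * w a x 0 k) x =
    expR (- phi x) * (partial j (fun x => w a x 0 k) x - theta a x 0 j * w a x 0 k).
  have dw : is_derive x (e_ j) (fun x => w a x 0 k : R^o) (partial j (fun x => w a x 0 k) x).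
    split=> //; exact: smooth_at_derivable (form1_smooth k wf ax).
  have dE : is_derive x (e_ j) (fun x => expR (- phi x) : R^o) (- (expR (- phi x) * theta a x 0 j)).
    have dN := @is_deriveN _ _ _ _ x (e_ j) _ ((Hphi x bx).2 j).
    by have := is_derive_expR_comp dN; rewrite mulrN.
  have := @is_deriveM _ _ _ _ x (e_ j) _ _ dE dw => H.
  rewrite {1}/partial (@derive_val _ _ _ _ _ _ _ H) /GRing.scale/=.
  by rewrite mulrN mulrBr; congr (_ - _); rewrite mulrC mulrA.
move=> j k; rewrite !P; congr (_ * _).
have := wc _ x ax; move/matrixP => /(_ j k); rewrite !mxE => /eqP E.
apply/eqP; rewrite -subr_eq0 -(eqP E); apply/eqP; rewrite -/a; ring.
Qed.

End Manifolds.

(** * From twisted cocycles to representations *)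

Lemma locally_constant_eq (R : realType) (T : Type) (D : R -> T) :
  (forall t, \forall x \near t, D x = D t) -> D 0 = D 1.
Proof.
move=> loc; suff : forall t, 0 <= t -> D 0 = D t by apply; exact: ler01.
apply: real_induction => // t t0; first by move=> ->; apply: filterS (loc t) => x -> _.
by move=> IH; have [s [s0 st <-]] := near_left t0 (loc t); apply: IH; rewrite s0.
Qed.

Section Holonomy.
Context (R : realType) (n : nat).
Implicit Types N : manifold R n.
Notation rV := 'rV[R]_n.
Notation e_ i := (delta_mx 0 i : rV).
Notation rng a := (chart_rng (atlas a)).
Notation dom a := (chart_dom (atlas a)).
Notation inv a := (chart_inv (atlas a)).

Definition patch_fun (M : manifold R n) (i : patch M) (f : rV -> R) (q : M) : R :=
  f (atlas (patch_chart i) q).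

(** A general [F] covers two uses: the identity of [M], to compare local primitives with one
    another, and the covering map, to compare them with a function on the cover. *)
Lemma patch_fun_gradient (M N : manifold R n) (F : N -> M) (i : patch M) (f mu : rV -> R)
    (w : form1 M) (eta : form1 N) (b : atlas_idx N) y :
  smooth_on setT F -> is_pullback F w eta ->
  primitive_on i f (fun j x => mu x * w (patch_chart i) x 0 j) ->
  patch_dom i (F y) -> dom b y ->
  forall j, \forall z \near atlas b y,
    is_derive z (e_ j) (fun z => patch_fun i f (F (inv b z)) : R^o)
      (patch_fun i mu (F (inv b z)) * eta b z 0 j).
Proof.
move=> sF pb Hf [ay iy] byy; apply: pullback_gradient (sF) pb _ _ _.
- exact: chart_map_rng.
- by rewrite chart_mapK.
rewrite chart_mapK//; apply: nearS (ball_near iy) => z /Hf[sf df].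
split=> [|j]; first exact: smooth_at_C1.
by rewrite /partial (@derive_val _ _ _ _ _ _ _ (df j)).
Qed.

Lemma agree_of_gradient (N : manifold R n) (G H mG mH : N -> R)
    (eta : form1 N) (b : atlas_idx N) y : dom b y ->
  (forall j, \forall z \near atlas b y,
    is_derive z (e_ j) (fun z => G (inv b z) : R^o) (mG (inv b z) * eta b z 0 j)) ->
  (forall j, \forall z \near atlas b y,
    is_derive z (e_ j) (fun z => H (inv b z) : R^o) (mH (inv b z) * eta b z 0 j)) ->
  (\forall y' \near y, mG y' = mH y') ->
  \forall y' \near y, G y' - G y = H y' - H y.
Proof.
move=> byy dG dH mGH.
have : \forall y' \near y, G y' - H y' = G y - H y.
  apply: (near_const_of_gradient0 (f := fun y => G y - H y) byy) => j.
  have nm : \forall z \near atlas b y, mG (inv b z) = mH (inv b z).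
    have mGH' : \forall y' \near inv b (atlas b y), mG y' = mH y' by rewrite chart_mapK.
    exact: (near_comp (inv_cont (chart_map_rng byy)) mGH').
  apply: nearS2 (nearI (dG j) (dH j)) nm => z [d1 d2] mz.
  have := @is_deriveB _ _ _ _ _ z (e_ j) _ _ d1 d2; move/is_derive_eq; apply.
  by rewrite mz subrr.
apply: nearS => y' E; have -> : G y' = G y - H y + H y' by rewrite -E subrK.
by ring.
Qed.

Definition theta_primitives (M : manifold R n) (theta : form1 M) (phi : patch M -> rV -> R) :=
  forall i, primitive_on i (phi i) (fun j x => theta (patch_chart i) x 0 j).

Lemma phi_gradient (M N : manifold R n) (theta : form1 M) (phi : patch M -> rV -> R)
    (F : N -> M) (eta : form1 N) i (b : atlas_idx N) y :
  theta_primitives theta phi ->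
  smooth_on setT F -> is_pullback F theta eta -> patch_dom i (F y) -> dom b y ->
  forall j, \forall z \near atlas b y,
    is_derive z (e_ j) (fun z => patch_fun i (phi i) (F (inv b z)) : R^o) (1 * eta b z 0 j).
Proof.
move=> Hphi sF pb iy byy; apply: (patch_fun_gradient (mu := cst 1) sF pb) => // x bx.
by have [sphi dphi] := Hphi i x bx; split=> // j; rewrite mul1r.
Qed.

Section Twisted.
Variables (M : manifold R n) (theta w : form1 M).
Hypotheses (theta_form : is_form1 theta) (theta_closed : closed1 theta).
Hypotheses (w_form : is_form1 w) (w_closed : form2_zero (dtw1 theta w)).

Definition twisted_primitives (phi k : patch M -> rV -> R) := forall i,
  primitive_on i (phi i) (fun j x => theta (patch_chart i) x 0 j) /\
  primitive_on i (k i) (fun j x => expR (- phi i x) * w (patch_chart i) x 0 j).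

Lemma twisted_primitives_exist : exists phi k, twisted_primitives phi k.
Proof.
have /choice[phi Hphi] := fun i => closed_primitive i theta_form theta_closed.
have /choice[k Hk] := fun i => twisted_primitive theta_form (Hphi i) w_form w_closed.
by exists phi, k => i; split.
Qed.

Variables (phi k : patch M -> rV -> R).
Hypothesis Hpk : twisted_primitives phi k.
Let Phi i := patch_fun i (phi i).
Let K i := patch_fun i (k i).

Lemma twisted_primitives_theta : theta_primitives theta phi.
Proof. by move=> i; exact: (Hpk i).1. Qed.

Lemma phi_agree i i' q : patch_dom i q -> patch_dom i' q ->
  \forall q' \near q, Phi i q' - Phi i q = Phi i' q' - Phi i' q.
Proof.
move=> iq i'q; have aq := iq.1; have [_ pb] := theta_form.
apply: (agree_of_gradient (mG := cst 1) (mH := cst 1) aq).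
- exact: (phi_gradient twisted_primitives_theta (smooth_on_id M) pb iq aq).
- exact: (phi_gradient twisted_primitives_theta (smooth_on_id M) pb i'q aq).
- exact: near_all.
Qed.

(** The primitives [K i] belong to different forms [exp(-Phi i) w]. Multiplied by [exp(Phi i q)]
    they acquire the gradient [exp(Phi i q - Phi i) w], which near [q] does not depend on the
    patch. *)
Lemma k_agree i i' q : patch_dom i q -> patch_dom i' q ->
  \forall q' \near q, expR (Phi i q) * (K i q' - K i q) = expR (Phi i' q) * (K i' q' - K i' q).
Proof.
move=> iq i'q; have aq := iq.1; have [_ pb] := w_form.
have D l : patch_dom l q -> forall j, \forall z \near atlas (patch_chart i) q,
    is_derive z (e_ j) (fun z => expR (Phi l q) * K l (inv (patch_chart i) z) : R^o)
      (expR (Phi l q - Phi l (inv (patch_chart i) z)) * w (patch_chart i) z 0 j).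
  move=> lq j.
  have := patch_fun_gradient (smooth_on_id M) pb (Hpk l).2 lq aq j.
  apply: nearS => z dz; have := @is_deriveZ _ _ _ _ (expR (Phi l q)) z _ _ dz.
  move/is_derive_eq; apply; rewrite /GRing.scale/= mulrA; congr (_ * _).
  by rewrite -expRD.
have : \forall q' \near q, expR (Phi i q) * K i q' - expR (Phi i q) * K i q =
    expR (Phi i' q) * K i' q' - expR (Phi i' q) * K i' q.
  apply: (agree_of_gradient (G := fun z => expR (Phi i q) * K i z)
    (H := fun z => expR (Phi i' q) * K i' z) (mG := fun z => expR (Phi i q - Phi i z))
    (mH := fun z => expR (Phi i' q - Phi i' z)) aq (D i iq) (D i' i'q)).
  apply: nearS (phi_agree iq i'q) => q' E; congr expR.
  by apply: oppr_inj; rewrite !opprB.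
by apply: nearS => q'; rewrite !mulrBr.
Qed.

(* A point of the fibre over [q] is a pair [(u, v)] of values of local
   primitives of [theta] and of [exp(-u) w]. *)
Definition twisted_map (i : patch M) (e : M * R * R) (q : M) : M * R * R :=
  (q, e.1.2 + Phi i q - Phi i e.1.1,
   e.2 + expR (Phi i e.1.1 - e.1.2) * (K i q - K i e.1.1)).

Lemma patch_cover (q : M) : exists i : patch M, patch_dom i q.
Proof.
have [a aq] := atlas_cover q.
by have [i [_ _ iq _]] := patch_exists openT I aq; exists i.
Qed.

Lemma twisted_mapE i e q : patch_dom i e.1.1 -> patch_dom i q -> (twisted_map i e q).1.1 = q.
Proof. by []. Qed.

Lemma twisted_map_id i e : patch_dom i e.1.1 -> twisted_map i e e.1.1 = e.
Proof. by case: e => [[q u] v] _; rewrite /twisted_map/= addrK subrr mulr0 addr0. Qed.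

Lemma twisted_map_trans i e q q' : patch_dom i e.1.1 -> patch_dom i q -> patch_dom i q' ->
  twisted_map i (twisted_map i e q) q' = twisted_map i e q'.
Proof.
case: e => [[q0 u] v] _ _ _; rewrite /twisted_map/=; congr (_, _, _); first by ring.
have -> : Phi i q - (u + Phi i q - Phi i q0) = Phi i q0 - u by ring.
by move: (expR _) => c; ring.
Qed.

Lemma twisted_map_near i i' e : patch_dom i e.1.1 -> patch_dom i' e.1.1 ->
  \forall q \near e.1.1, twisted_map i e q = twisted_map i' e q.
Proof.
case: e => [[q0 u] v] /= iq i'q; apply: nearS2 (phi_agree iq i'q) (k_agree iq i'q) => q E1 E2.
rewrite /twisted_map/=; congr (_, _, _ + _); first by rewrite -!addrA E1.
by rewrite !expRD !(mulrC _ (expR (- u))) -!mulrA E2.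
Qed.

Definition twisted_transport : transport M :=
  @Transport M (M * R * R)%type (fun e => e.1.1) (patch M) (@patch_dom R n M) twisted_map
    (@patch_open R n M) patch_cover twisted_mapE twisted_map_id twisted_map_trans
    twisted_map_near.

(** A change of the constants of integration: adding [u0] to the primitive [u] of [theta] multiplies
    [exp(-u) w], and hence its primitive, by [exp(-u0)]. *)
Definition affine_shift (u0 v0 : R) (e : M * R * R) : M * R * R :=
  (e.1.1, e.1.2 + u0, v0 + expR (- u0) * e.2).

Lemma carries_affine_shift u0 v0 (g : R -> M) e e' : carries (S := twisted_transport) g e e' ->
  carries (S := twisted_transport) g (affine_shift u0 v0 e) (affine_shift u0 v0 e').
Proof.
apply: carries_equivariant => // i [[q u] v] q'.
rewrite /= /twisted_map /affine_shift/=; congr (_, _, _); first by ring.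
by rewrite mulrDr addrA mulrA -expRD; congr (_ + _ * _); congr expR; ring.
Qed.

End Twisted.
End Holonomy.

(** * Plane representations fixing the first basis vector *)

Section UpperTriangular.
Context (R : realType).
Implicit Types (a d u : R).

Definition upper a d : 'M[R]_2 :=
  \matrix_(i, j) if i == 0 then if j == 0 then 1 else a else if j == 0 then 0 else d.

Lemma ord2P (i : 'I_2) : i = 0 \/ i = 1.
Proof. by case: i => [[|[|//]] p]; [left|right]; apply/val_inj. Qed.

Lemma mulmx2E m (A : 'M[R]_2) (B : 'M[R]_(2, m)) i j :
  (A *m B) i j = A i 0 * B 0 j + A i 1 * B 1 j.
Proof.
by rewrite mxE big_ord_recl big_ord1; congr (_ + A _ _ * B _ _); apply/val_inj.
Qed.

Lemma det_mx2 (A : 'M[R]_2) : \det A = A 0 0 * A 1 1 - A 0 1 * A 1 0.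
Proof.
rewrite (expand_det_row A 0) big_ord_recl big_ord1 /cofactor !det_mx11 !mxE /=.
rewrite expr0 mul1r addn1 expr1 mulN1r mulrN.
by congr (_ * A _ _ - A _ _ * A _ _); apply/val_inj.
Qed.

Lemma det_upper a d : \det (upper a d) = d.
Proof. by rewrite det_mx2 !mxE/= mul1r mulr0 subr0. Qed.

Lemma mul_upper a d a' d' : upper a d *m upper a' d' = upper (a' + a * d') (d * d').
Proof.
apply/matrixP => i j; rewrite mulmx2E !mxE/=.
by case: (ord2P i) => ->; case: (ord2P j) => -> /=; rewrite ?(mul1r, mul0r, mulr0, addr0, add0r).
Qed.

Lemma upper_fix a d : upper a d *m delta_mx 0 0 = delta_mx 0 0 :> 'cV_2.
Proof.
apply/matrixP => i j; rewrite mulmx2E !mxE/= (ord1 j) mulr0 addr0 mulr1.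
by case: (ord2P i) => ->.
Qed.

Lemma fix_upper (A : 'M[R]_2) : A *m delta_mx 0 0 = delta_mx 0 0 :> 'cV_2 ->
  A = upper (A 0 1) (\det A).
Proof.
move=> /matrixP H.
have A00 : A 0 0 = 1.
  by have := H 0 0; rewrite mulmx2E !mxE/= mulr0 addr0 mulr1.
have A10 : A 1 0 = 0.
  by have := H 1 0; rewrite mulmx2E !mxE/= mulr0 addr0 mulr1.
apply/matrixP => i j; rewrite !mxE det_mx2 A00 A10 mulr0 mul1r subr0.
by case: (ord2P i) => ->; case: (ord2P j) => ->.
Qed.

Lemma upper_mul_col a d (v : 'cV[R]_2) :
  (upper a d *m v) 0 0 = v 0 0 + a * v 1 0 /\ (upper a d *m v) 1 0 = d * v 1 0.
Proof. by split; rewrite mulmx2E !mxE/= ?mul1r ?mul0r ?add0r. Qed.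

Lemma cV2P (v w : 'cV[R]_2) : v 0 0 = w 0 0 -> v 1 0 = w 1 0 -> v = w.
Proof. by move=> ? ?; apply/matrixP => i j; rewrite (ord1 j); case: (ord2P i) => ->. Qed.

(* A line other than the fixed one is spanned by [(u, 1)]; it is invariant under
   [upper a d] exactly when [a = (d - 1) u]. *)
Lemma decomposable_upperP (T : topologicalType) (x0 : T) (xi : (R -> T) -> 'M[R]_2)
    (a d : (R -> T) -> R) :
  (forall g, is_loop x0 g -> xi g = upper (a g) (d g)) ->
  decomposable x0 xi <-> exists u, forall g, is_loop x0 g -> a g = (d g - 1) * u.
Proof.
move=> xiE; split=> [[L1 [L2 [[d1 d2] [L12 _] inv1 inv2]]]|[u Hu]].
  (* The two lines span the plane, so one of them differs from the fixed line. *)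
  have : exists L v, [/\ \dim L = 1%N, rep_invariant x0 xi L, v \in L & v 1 0 != 0].
    have : delta_mx 1 0 \in (L1 + L2)%VS by rewrite L12 memvf.
    move=> /memv_addP[v1 v1L [v2 v2L /matrixP /(_ 1 0)]].
    rewrite !mxE/=; have [v10|v10] := eqVneq (v1 1 0) 0; last by exists L1, v1.
    by rewrite v10 add0r => v2E; exists L2, v2; rewrite -v2E oner_neq0.
  move=> [L [v [dL iL vL v1]]]; exists (v 0 0 / v 1 0) => g lg.
  have LE : L = <[v]>%VS.
    have vn0 : v != 0 by apply: contraNneq v1 => ->; rewrite mxE.
    by apply/esym/eqP; rewrite eqEdim -memvE vL dL dim_vline vn0.
  have := iL g lg v vL; rewrite LE => /vlineP[k kE].
  have [E0 E1] := upper_mul_col (a g) (d g) v.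
  move: E0 E1; rewrite -xiE// kE !mxE => E0 /(mulIf v1) kd.
  by apply: (mulIf v1); rewrite mulrA divfK// mulrBl mul1r -kd E0 addrC addKr.
pose v : 'cV[R]_2 := \col_i if i == 0 then u else 1.
have v0 : v 0 0 = u by rewrite mxE.
have v1 : v 1 0 = 1 by rewrite mxE.
have vn0 : v != 0 by apply/eqP => /matrixP /(_ 1 0); rewrite v1 mxE => /eqP; rewrite oner_eq0.
pose e : 'cV[R]_2 := delta_mx 0 0.
have e0 : e 0 0 = 1 by rewrite mxE.
have e1 : e 1 0 = 0 by rewrite mxE.
have en0 : e != 0 by apply/eqP => /matrixP /(_ 0 0); rewrite e0 mxE => /eqP; rewrite oner_eq0.
exists <[e]>%VS, <[v]>%VS; split.
- by rewrite !dim_vline en0 vn0.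
- split.
    apply/vspaceP => z; rewrite memvf; apply/memv_addP.
    exists ((z 0 0 - z 1 0 * u) *: e); first by rewrite memvZ ?memv_line.
    exists (z 1 0 *: v); first by rewrite memvZ ?memv_line.
    by apply: cV2P; rewrite !mxE/= ?mulr1 ?mulr0 ?add0r// subrK.
  apply/eqP; rewrite -subv0; apply/subvP => z; rewrite memv_cap => /andP[/vlineP[k ->] /vlineP[l]].
  move=> /matrixP H; have := H 1 0; rewrite !mxE/= mulr0 mulr1 => l0.
  by have := H 0 0; rewrite !mxE/= mulr1 -l0 mul0r => ->; rewrite scale0r mem0v.
- move=> g lg z /vlineP[k ->]; rewrite -scalemxAr memvZ// (xiE g lg).
  by rewrite /e upper_fix memv_line.
- move=> g lg z /vlineP[k ->]; rewrite -scalemxAr memvZ// (xiE g lg).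
  apply/vlineP; exists (d g); have [E0 E1] := upper_mul_col (a g) (d g) v.
  by apply: cV2P; rewrite ?E0 ?E1 [in RHS]mxE// v0 v1 mulr1 Hu//; ring.
Qed.

End UpperTriangular.

(** * The holonomy representation of a twisted cocycle *)

Section FirstAssertion.
Context (R : realType) (n : nat).
Variables (M Mt : manifold R n) (p : Mt -> M).
Hypothesis p_cover : smooth_covering p.
Notation rV := 'rV[R]_n.
Notation e_ i := (delta_mx 0 i : rV).
Notation rng a := (chart_rng (atlas a)).
Notation dom a := (chart_dom (atlas a)).
Notation inv a := (chart_inv (atlas a)).

Let p_smooth : smooth_on setT p. Proof. by case: p_cover. Qed.

Lemma cover_cont : continuous p.
Proof. by move=> y; exact: smooth_on_cont p_smooth I. Qed.

Lemma smooth_fun_gradient (f : Mt -> R) (b : atlas_idx Mt) y : smooth_fun f -> dom b y ->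
  forall j, \forall z \near atlas b y,
    is_derive z (e_ j) (fun z => f (inv b z) : R^o) (d0 f b z 0 j).
Proof.
move=> /smooth_funE sf byy j; apply: nearS (near_rng (chart_map_rng byy)) => z bz.
rewrite mxE; split=> //; exact: smooth_at_derivable (sf b z bz).
Qed.

Section Phase.
Variables (theta : form1 M) (phi : patch M -> rV -> R) (f : Mt -> R).
Hypothesis theta_form : is_form1 theta.
Hypothesis Hphi : theta_primitives theta phi.
Hypotheses (f_smooth : smooth_fun f) (f_pb : is_pullback p theta (d0 f)).

Lemma phase_agree (i : patch M) y : patch_dom i (p y) ->
  \forall y' \near y, patch_fun i (phi i) (p y') - patch_fun i (phi i) (p y) = f y' - f y.
Proof.
move=> iy; have [b byy] := atlas_cover y.
apply: (agree_of_gradient (G := fun y => patch_fun i (phi i) (p y)) (H := f)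
  (mG := cst 1) (mH := cst 1) (eta := d0 f) byy).
- exact: (phi_gradient Hphi p_smooth f_pb iy byy).
- move=> j; apply: nearS (smooth_fun_gradient f_smooth byy j) => z H.
  by rewrite mul1r.
- exact: near_all.
Qed.

(** Along the lifted path, the first real coordinate of the horizontal curve and [f] are both
    primitives of [theta], so their difference is locally constant. This identifies that coordinate
    of the holonomy with the logarithm of [rho]. *)
Lemma carries_phase (w : form1 M) (k : patch M -> rV -> R) (w_form : is_form1 w)
    (Hpk : twisted_primitives theta w phi k) (g : R -> M) (l : R -> Mt) y y' e e' :
  is_path y y' l -> (forall t, t \in `[0, 1] -> p (l t) = g t) ->
  carries (S := twisted_transport theta_form w_form Hpk) g e e' ->
  e'.1.2 - e.1.2 = f y' - f y.
Proof.
move=> [/within_clamp cl l0 l1] pl [L [lL <- <-]].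
pose D t := (L t).1.2 - f (l (clamp t)).
suff : D 0 = D 1 by rewrite /D clamp0 clamp1 l0 l1 => E; lra.
apply: locally_constant_eq => t.
have gt : p (l (clamp t)) = g (clamp t) by rewrite pl// clamp_in.
have [i iq] := patch_cover (g (clamp t)).
have [pL HL] := lL t; have {}HL := HL i iq.
have ip : patch_dom i (p (l (clamp t))) by rewrite gt.
have nf := near_comp (cl t) (phase_agree ip).
apply: nearS2 HL nf => s Ls; rewrite !pl ?clamp_in// => E.
rewrite /= in pL; rewrite /D Ls /twisted_map/= pL.
by move: E; rewrite /patch_fun/=; lra.
Qed.

End Phase.

Hypothesis Mt_sc : simply_connected R Mt.
Variables (y0 : Mt) (theta : form1 M) (rho : (R -> M) -> R).
Hypotheses (theta_form : is_form1 theta) (theta_closed : closed1 theta).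
Hypothesis rho_assoc : assoc_rep p y0 theta rho.

Lemma base_path q : exists g : R -> M, is_path (p y0) q g.
Proof.
have [y yq] : exists y, p y = q.
  by have [_ /seteqP[_ /(_ q I)[y _ yq]] _] := p_cover; exists y.
have [g pg] := Mt_sc.1 y0 y; exists (p \o g); rewrite -yq.
by apply: is_path_comp pg _ => t _; exact: cover_cont.
Qed.

(** The entries of [xi g] are read off the holonomy of [g] starting from [e0]. An invariant
    complement would normalise the constants of integration so that they match along all paths,
    giving a global twisted primitive of [w]. *)
Lemma twisted_cocycle_rep : twisted_H1_neq0 theta ->
  exists xi : (R -> M) -> 'M[R]_2,
    [/\ pi1_rep (p y0) xi, ~ decomposable (p y0) xi,
        forall g, is_loop (p y0) g -> \det (xi g) = rho g &
        forall g, is_loop (p y0) g -> xi g *m delta_mx 0 0 = delta_mx 0 0 :> 'cV[R]_2].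
Proof.
move=> [w [w_form w_closed] w_exact].
have [phi [k Hpk]] := twisted_primitives_exist theta_form theta_closed w_form w_closed.
pose S := twisted_transport theta_form w_form Hpk.
set x0 := p y0; pose e0 : M * R * R := (x0, 0, 0).
have /choice[hol Hhol] : forall g : R -> M, exists e, is_loop x0 g -> carries (S := S) g e0 e.
  move=> g; have [lg|nlg] := pselect (is_loop x0 g); last by exists e0.
  by have [e] := carries_ex (S := S) (e := e0) lg erefl; exists e.
have hol_pr g : is_loop x0 g -> (hol g).1.1 = x0.
  by move=> lg; have [_] := carries_pr (Hhol g lg); case: lg => _ _ ->.
have hol_rho g : is_loop x0 g -> rho g = expR (hol g).1.2.
  move=> lg; have [f [act [c [sf pbf Hact]]]] := rho_assoc.
  have [[_ [l pl plg]] fc ->] := Hact g lg.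
  have := carries_phase (twisted_primitives_theta Hpk) sf pbf pl plg (Hhol g lg); rewrite /= subr0 fc => ->.
  by congr expR; ring.
pose xi g := upper (expR (hol g).1.2 * (hol g).2) (expR (hol g).1.2).
have eE g : is_loop x0 g -> hol g = (x0, (hol g).1.2, (hol g).2).
  by move=> lg; rewrite -(hol_pr g lg); case: (hol g) => [[]].
(* In a concatenation the second loop starts at the holonomy of the first; the affine symmetry
   brings this back to transport from [e0]. *)
have shift (e : M * R * R) (g : R -> M) e' : carries (S := S) g e0 e' -> carries (S := S) g (x0, e.1.2, e.2)
    (e'.1.1, e'.1.2 + e.1.2, e.2 + expR (- e.1.2) * e'.2).
  move=> H; have := carries_affine_shift e.1.2 e.2 H.
  by rewrite {1}/affine_shift/= add0r mulr0 addr0.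
exists xi; split.
- split.
  + by move=> g lg; rewrite unitmxE unitfE det_upper gt_eqF ?expR_gt0.
  + move=> g1 g2 l1 l2 h12; rewrite /xi.
    by rewrite (carries_homotopic (S := S) (e := e0) l1 l2 h12 erefl (Hhol g1 l1) (Hhol g2 l2)).
  + move=> g1 g2 l1 l2; have l12 := is_path_concat l1 l2.
    have H1 := Hhol g1 l1; rewrite (eE g1 l1) in H1.
    have H2 := shift (hol g1) g2 _ (Hhol g2 l2).
    rewrite /xi (carries_unique l12 (Hhol _ l12) (carries_concat l1 l2 H1 H2)) mul_upper/=.
    rewrite -expRD; congr upper; last by rewrite addrC.
    rewrite mulrDr mulrA -expRD addrK addrC; congr (_ + _).
    by rewrite addrC expRD mulrAC.
- move=> /(decomposable_upperP (xi := xi) (fun g _ => erefl)).1[u0 Hu].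
  apply: w_exact.
  (* The relation for the upper right entry, divided by [rho]: [b g - u0 = - rho(g)^-1 u0] with
     [b g] the last coordinate of the holonomy. *)
  have {}Hu g : is_loop x0 g -> (hol g).2 - u0 = - expR (- (hol g).1.2) * u0.
    move=> /Hu E; apply: (mulfI (lt0r_neq0 (expR_gt0 (hol g).1.2))).
    by rewrite mulrBr E mulNr mulrN mulrA -expRD subrr expR0; ring.
  (* This is [exp(phi) (h - u0)] evaluated at the end of a horizontal curve starting from [e0]. *)
  pose val (e : M * R * R) := expR e.1.2 * (e.2 - u0).
  have val_unique q (al be : R -> M) (e e' : M * R * R) : is_path x0 q al -> is_path x0 q be ->
      carries (S := S) al e0 e -> carries (S := S) be e0 e' -> val e = val e'.
    move=> pa pb ca cb; have lg := is_path_concat pa (is_path_rev pb).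
    have [_ eq] := carries_pr ca; have [_ e'q] := carries_pr cb.
    have q1 : e.1.1 = e'.1.1 by rewrite [LHS]eq [RHS]e'q; case: pa => _ _ ->; case: pb.
    (* The affine symmetry that takes [e'] to [e] takes [e0] to the holonomy of the loop going out
       along [al] and back along [be]; [Hu] for this loop is the equality of the two values. *)
    pose d := e.1.2 - e'.1.2.
    have := carries_affine_shift d (e.2 - expR (- d) * e'.2) (carries_rev cb).
    rewrite /affine_shift /e0/= -q1 add0r mulr0 addr0 subrK (_ : e'.1.2 + d = e.1.2); last first.
      by rewrite /d; ring.
    rewrite -(_ : e = (e.1.1, e.1.2, e.2)); last by case: (e) => [[]].
    move=> c2; have := carries_unique lg (Hhol _ lg) (carries_concat pa (is_path_rev pb) ca c2).
    move=> holE; have := Hu _ lg; rewrite holE/= => E.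
    have -> : val e = expR e.1.2 * (expR (- d) * (e'.2 - u0)).
      congr (_ * _); rewrite mulrBr -[in RHS]mulNr -E; ring.
    by rewrite mulrA -expRD /val; congr (expR _ * _); rewrite /d; ring.
  have /choice[al Hal] : forall q, exists ge : (R -> M) * (M * R * R),
      is_path x0 q ge.1 /\ carries (S := S) ge.1 e0 ge.2.
    move=> q; have [g pg] := base_path q.
    by have [e ce] := carries_ex (S := S) (e := e0) pg erefl; exists (g, e).
  pose F q := val (al q).2.
  (* The path to [q'] may be taken through [q] and then inside the patch. The resulting expression
     shows at once that [F] is smooth and that its twisted differential is [w]. *)
  have F_local (i : patch M) q : patch_dom i q -> exists C, forall q', patch_dom i q' ->
      F q' = expR (patch_fun i (phi i) q') * (patch_fun i (k i) q' + C).
    move=> iq; have [pq cq] := Hal q; set e := (al q).2 in cq.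
    have eq : e.1.1 = q by have [_] := carries_pr cq; case: pq => _ _ ->.
    exists (expR (e.1.2 - patch_fun i (phi i) q) * (e.2 - u0) - patch_fun i (k i) q) => q' iq'.
    have [s [ps is_]] := patch_path iq iq'.
    have c2 := carries_patch (S := S) ps eq is_.
    have [pq' cq'] := Hal q'.
    rewrite /F (val_unique _ _ _ _ _ pq' (is_path_concat pq ps) cq' (carries_concat pq ps cq c2)).
    rewrite /val /= eq; set a := patch_fun i (phi i) q'; set b := patch_fun i (phi i) q.
    have -> : expR (e.1.2 + a - b) = expR a * expR (e.1.2 - b).
      by rewrite -expRD; congr expR; ring.
    rewrite -mulrA; congr (_ * _).
    have : expR (e.1.2 - b) * expR (b - e.1.2) = 1.
      by rewrite -expRD (_ : _ + _ = 0) ?expR0//; ring.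
    move: (expR (e.1.2 - b)) (expR (b - e.1.2)) => c c' cc'.
    rewrite -[patch_fun i (k i) q' in RHS]mul1r -[patch_fun i (k i) q in RHS]mul1r -cc'; ring.
  have F_chart a x : rng a x -> exists i C, [/\ patch_chart i = a,
      ball (patch_center i) (patch_radius i) x &
      \forall z \near x, F (inv a z) = expR (phi i z) * (k i z + C)].
    move=> ax; have aq := chart_inv_dom ax.
    have [i [ia ic iq _]] := patch_exists openT I aq.
    have [C HC] := F_local i _ iq; exists i, C; split=> //.
      by case: iq => _; rewrite ia chart_invK.
    have := near_comp (inv_cont ax) (near_open (@patch_open R n M i) iq).
    apply: nearS2 (near_rng ax) => z az iz.
    by rewrite HC// /patch_fun ia chart_invK.
  exists F.
    apply/smooth_funE => a x ax; have [i [C [ia ix EF]]] := F_chart a x ax.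
    have [sphi _] := (Hpk i).1 x ix; have [sk _] := (Hpk i).2 x ix.
    apply: (smooth_at_congr (f := fun z => expR (phi i z) * (k i z + C))).
      by apply: nearS EF => z ->.
    apply: smooth_atM; first exact: smooth_at_exp.
    by apply: smooth_atD => //; exact: smooth_at_cst.
  move=> a x ax; have [i [C [ia ix EF]]] := F_chart a x ax.
  have [sphi dphi] := (Hpk i).1 x ix; have [sk dk] := (Hpk i).2 x ix.
  apply/rowP => j; rewrite !mxE (near_eq_partial j EF) (near_self EF).
  have dphij := dphi j; have dkj := dk j; rewrite ia in dphij dkj.
  have dE : is_derive x (e_ j) (fun z => expR (phi i z) : R^o) (expR (phi i x) * theta a x 0 j).
    exact: is_derive_expR_comp.
  have dK : is_derive x (e_ j) (fun z => k i z + C : R^o) (expR (- phi i x) * w a x 0 j).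
    have := @is_deriveD _ _ _ _ _ x (e_ j) _ _ dkj (is_derive_cst (C : R^o) x (e_ j)).
    by rewrite addr0.
  have := @is_deriveM _ _ _ _ x (e_ j) _ _ dE dK => dF.
  rewrite {1}/partial (@derive_val _ _ _ _ _ _ _ dF) /GRing.scale/=.
  rewrite mulrA -expRD subrr expR0 mul1r; move: (expR _) (k i x) (w a x 0 j) (theta a x 0 j) => ? ? ? ?.
  ring.
- by move=> g lg; rewrite det_upper hol_rho.
- by move=> g lg; rewrite upper_fix.
Qed.

End FirstAssertion.

(** * Deck transformations *)

Section RealContinuity.
Context (R : realType) (T : topologicalType).
Implicit Types (f g : T -> R).

Lemma continuous_addR f g : continuous f -> continuous g -> continuous (fun z => f z + g z).
Proof. by move=> cf cg z; apply: cvgD; [exact: cf | exact: cg]. Qed.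

Lemma continuous_subR f g : continuous f -> continuous g -> continuous (fun z => f z - g z).
Proof. by move=> cf cg z; apply: cvgB; [exact: cf | exact: cg]. Qed.

Lemma continuous_mulR f g : continuous f -> continuous g -> continuous (fun z => f z * g z).
Proof. by move=> cf cg z; apply: cvgM; [exact: cf | exact: cg]. Qed.

Lemma continuous_clamp f : continuous f -> continuous (fun z => clamp (f z)).
Proof. by move=> cf z; apply: continuous_comp; [exact: cf | exact: clamp_continuous]. Qed.

End RealContinuity.

(* The homotopy follows straight segments from a point running along the three
   sides of the square on which the null-homotopy is constant to the middle of
   the fourth side. *)
Lemma simply_connected_homotopic (R : realType) (T : topologicalType) (x y : T) (al be : R -> T) :
  simply_connected R T -> is_path x y al -> is_path x y be -> path_homotopic al be.
Proof.
move=> [_ sc] pa pb.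
have [H [cH H0 H1 H01]] := sc x _ (is_path_concat pa (is_path_rev pb)).
have {}cH := within_clamp2 cH.
have [_ a0 a1] := pa; have [_ b0 b1] := pb.
pose K (z : R * R) := H (clamp z.1, clamp z.2).
(* At [z.2 = 0] the point [(u, v)] runs in thirds along the sides [v = 0], [u = 1], [v = 1]; at
   [z.2 = 1] it is [(0, 1/2)]. For [z.1 = 0] and [z.1 = 1] it stays on the side [u = 0] and traces
   the halves carrying [al] and [be]. *)
pose u (z : R * R) : R := (1 - z.2) * clamp (Num.min (3 * z.1) (3 - 3 * z.1)).
pose v (z : R * R) : R := (1 - z.2) * clamp (3 * z.1 - 1) + z.2 / 2.
have c1 : continuous (fun z : R * R => z.1) by move=> [s t]; exact: cvg_fst.
have c2 : continuous (fun z : R * R => z.2) by move=> [s t]; exact: cvg_snd.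
have cc (c : R) : continuous (fun _ : R * R => c) by move=> z; exact: cst_continuous.
have c3 := continuous_mulR (cc 3) c1.
have cu : continuous u.
  apply: continuous_mulR; first exact: continuous_subR (cc 1) c2.
  apply: continuous_clamp => z.
  apply: (@continuous_min R _ (fun z : R * R => 3 * z.1) (fun z : R * R => 3 - 3 * z.1)).
    exact: c3.
  exact: (continuous_subR (cc 3) c3).
have cv : continuous v.
  apply: continuous_addR; last exact: continuous_mulR c2 (cc 2^-1).
  apply: continuous_mulR; first exact: continuous_subR (cc 1) c2.
  apply: continuous_clamp; exact: continuous_subR c3 (cc 1).
have i0 : (0 : R) \in `[0, 1] by rewrite in_itv/= lexx ler01.
have i1 : (1 : R) \in `[0, 1] by rewrite in_itv/= lexx ler01.
have half : (1 / 2 : R) <= 2^-1 by rewrite mul1r.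
have g0 : path_concat al (path_rev be) 0 = x by rewrite /path_concat invr_ge0 ler0n mulr0.
have g1 : path_concat al (path_rev be) 1 = x.
  rewrite /path_concat ifF; last by apply/negbTE; rewrite -ltNge; lra.
  by rewrite /path_rev (_ : 1 - (2 * 1 - 1) = 0 :> R)//; lra.
exists (fun z => K (u z, v z)); split.
- apply: continuous_subspaceT => z.
  apply: (@continuous_comp _ _ _ (fun z => (u z, v z)) K); last exact: cH.
  exact: (@cvg_pair _ _ _ (nbhs z) (nbhs (u z)) (nbhs (v z)) _ _ _ u v (cu z) (cv z)).
- move=> t; rewrite in_itv/= => /andP[t0 t1].
  have -> : u (0, t) = 0.
    by rewrite /u/= mulr0 subr0 clamp_le0 ?mulr0// ge_min lexx.
  have -> : v (0, t) = t / 2.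
    by rewrite /v/= mulr0 sub0r clamp_le0 ?mulr0 ?add0r// lerN10.
  have it : t / 2 \in `[0, 1] by rewrite in_itv/=; apply/andP; split; lra.
  rewrite /K/= clamp0 clamp_id// H0// /path_concat ifT; last by lra.
  by congr al; field.
- move=> t; rewrite in_itv/= => /andP[t0 t1].
  have -> : u (1, t) = 0.
    by rewrite /u/= mulr1 subrr clamp_le0 ?mulr0// ge_min lexx orbT.
  have -> : v (1, t) = 1 - t / 2.
    by rewrite /v/= mulr1 clamp_ge1; [field | lra].
  have it : 1 - t / 2 \in `[0, 1] by rewrite in_itv/=; apply/andP; split; lra.
  rewrite /K/= clamp0 clamp_id// H0// /path_concat; case: ifPn => [h|h].
    have -> : t = 1 by lra.
    by rewrite (_ : 2 * (1 - 1 / 2) = 1 :> R) ?a1 ?b1//; field.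
  by rewrite /path_rev; congr be; field.
- move=> s _; split.
    rewrite /u /v /= subr0 !mul1r mul0r addr0 /K/= a0.
    have clampK (r : R) : clamp (clamp r) = clamp r by rewrite clamp_id// clamp_in.
    rewrite !clampK; have [s1|s1] := leP (3 * s) 1.
      by rewrite (clamp_le0 (t := 3 * s - 1)) ?(H01 _ (clamp_in _)).1 ?g0//; lra.
    have [s2|s2] := leP 2 (3 * s).
      by rewrite (clamp_ge1 (t := 3 * s - 1)) ?(H01 _ (clamp_in _)).2 ?g1//; lra.
    rewrite (clamp_ge1 (t := Num.min _ _)) ?H1 ?clamp_in//.
    by rewrite le_min; apply/andP; split; lra.
  rewrite /u /v /= subrr !mul0r add0r /K/= clamp0.
  rewrite clamp_id; last by rewrite in_itv/=; apply/andP; split; lra.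
  rewrite H0; last by rewrite in_itv/=; apply/andP; split; lra.
  by rewrite /path_concat half; congr al; field.
Qed.

(** * Coverings as flat connections *)

Section CoverTransport.
Context (R : realType) (n : nat).
Variables (M Mt : manifold R n) (p : Mt -> M).
Hypothesis p_cover : smooth_covering p.

(** [tau e q] is the point over [q] on the sheet through [e]; the index set of the sheets is
    forgotten. *)
Record sheets (V : set M) (tau : Mt -> M -> Mt) : Prop := Sheets {
  sheets_open : open V;
  sheets_pr : forall e q, V (p e) -> V q -> p (tau e q) = q;
  sheets_id : forall e, V (p e) -> tau e (p e) = e;
  sheets_trans : forall e q q', V (p e) -> V q -> V q' -> tau (tau e q) q' = tau e q';
  sheets_cont : forall e q, V (p e) -> V q -> {for q, continuous (tau e)};
  sheets_near : forall e, V (p e) -> \forall y \near e, tau e (p y) = y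
}.

Lemma sheets_exist (V : set M) : open V -> evenly_covered p V -> exists tau, sheets V tau.
Proof.
move=> oV [J [U [s [oU tU pU Hs]]]].
have /choice[tau Htau] : forall e, exists t : M -> Mt, V (p e) -> exists j, U j e /\ t = s j.
  move=> e; have [Ve|nVe] := pselect (V (p e)); last by exists (fun=> e).
  have [j _ Uj] : (\bigcup_j U j) e by rewrite -pU.
  by exists (s j) => _; exists j.
exists tau; split=> //.
- by move=> e q /Htau[j [_ ->]] Vq; have [_ _ + _] := Hs j; apply.
- by move=> e Ve; have [j [Uj ->]] := Htau e Ve; have [_ _ _] := Hs j; apply.
- move=> e q q' Ve Vq Vq'; have [j [Uj ->]] := Htau e Ve; have [_ Us ps _] := Hs j.
  have [|j' [Uj' ->]] := Htau (s j q); first by rewrite ps.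
  have -> // : j' = j by apply: tU => //; exists (s j q); split=> //; exact: Us.
- by move=> e q /Htau[j [_ ->]] Vq; have [ss _ _ _] := Hs j; exact: smooth_on_cont ss Vq.
- move=> e Ve; have [j [Uj ->]] := Htau e Ve; have [_ _ _ ts] := Hs j.
  by apply: nearS (near_open (oU j) Uj) => y /ts.
Qed.

Lemma sheets_cover : exists (V : M -> set M) (tau : M -> Mt -> M -> Mt),
  forall q, V q q /\ sheets (V q) (tau q).
Proof.
have : forall q, exists Vt : set M * (Mt -> M -> Mt), Vt.1 q /\ sheets Vt.1 Vt.2.
  move=> q; have [_ _ /(_ q)[V [oV Vq eV]]] := p_cover.
  by have [tau Htau] := sheets_exist oV eV; exists (V, tau).
by move=> /choice[F HF]; exists (fun q => (F q).1), (fun q => (F q).2).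
Qed.

Variables (V : M -> set M) (tau : M -> Mt -> M -> Mt).
Hypothesis Vtau : forall q, V q q /\ sheets (V q) (tau q).
Let sh q := (Vtau q).2.

(** A continuous local section stays near [q] on the open sheet through its value at [q]. *)
Lemma sheet_lift_unique i e (z : M -> Mt) q : V i (p e) -> V i q ->
  {for q, continuous z} -> z q = tau i e q -> (\forall q' \near q, p (z q') = q') ->
  \forall q' \near q, z q' = tau i e q'.
Proof.
move=> Ve Vq cz zq pz.
have Vz : V i (p (z q)) by rewrite zq (sheets_pr (sh i)).
have := near_comp cz (sheets_near (sh i) Vz).
have := near_open (sheets_open (sh i)) Vq.
move=> nV; apply: nearS2 (nearI pz nV) => q' [pz' Vq'] <-.
by rewrite pz' zq (sheets_trans (sh i)).
Qed.

Lemma cover_map_near i i' e : V i (p e) -> V i' (p e) ->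
  \forall q \near p e, tau i e q = tau i' e q.
Proof.
move=> Vi Vi'; apply: sheet_lift_unique => //.
- exact: (sheets_cont (sh i)).
- by rewrite (sheets_id (sh i))// (sheets_id (sh i')).
- by apply: nearS (near_open (sheets_open (sh i)) Vi) => q Vq; rewrite (sheets_pr (sh i)).
Qed.

Definition cover_transport : transport M :=
  @Transport M Mt p M V tau (fun i => sheets_open (sh i)) (fun q => ex_intro _ q (Vtau q).1)
    (fun i => @sheets_pr _ _ (sh i)) (fun i => @sheets_id _ _ (sh i))
    (fun i => @sheets_trans _ _ (sh i)) cover_map_near.

(** A continuous lift is horizontal, since near each time it stays on one sheet. *)
Lemma carries_path (g : R -> M) (l : R -> Mt) y y' : is_path y y' l ->
  (forall t, t \in `[0, 1] -> p (l t) = g t) -> carries (S := cover_transport) g y y'.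
Proof.
move=> [/within_clamp cl l0 l1] pl; exists (l \o @clamp R); rewrite /= clamp0 clamp1 l0 l1.
split=> // t; split; first by rewrite /= pl// clamp_in.
move=> i /= Vi; have Vl : V i (p (l (clamp t))) by rewrite pl// clamp_in.
have := near_comp (cl t) (sheets_near (sh i) Vl).
by apply: nearS => s /= <-; rewrite pl ?clamp_in.
Qed.

End CoverTransport.

(** * The action of loops by deck transformations *)

Section Deck.
Context (R : realType) (n : nat).
Variables (M Mt : manifold R n) (p : Mt -> M).
Hypothesis p_cover : smooth_covering p.
Hypothesis Mt_sc : simply_connected R Mt.
Implicit Types h : Mt -> Mt.

Let lift_unique2 (g : R -> M) (l l' : R -> Mt) y z z' : is_path y z l -> is_path y z' l' ->
  (forall t, t \in `[0, 1] -> p (l t) = g t) ->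
  (forall t, t \in `[0, 1] -> p (l' t) = g t) -> is_path (p y) (p z) g -> z = z'.
Proof.
move=> pl pl' gl gl' pg; have [V [tau Vtau]] := sheets_cover p_cover.
exact: (carries_unique pg (carries_path Vtau pl gl) (carries_path Vtau pl' gl')).
Qed.

Lemma deck_path h y y' (l : R -> Mt) : deck_transformation p h -> is_path y y' l ->
  is_path (h y) (h y') (h \o l) /\ forall t, p ((h \o l) t) = p (l t).
Proof.
move=> [ch _ ph] pl; split=> [|t]; last exact: ph.
by apply: is_path_comp pl _ => t _; exact: ch.
Qed.

(** The images under [h] and [h'] of a path from [y] lift the same path of [M] and have the same
    origin. *)
Lemma deck_unique h h' y : deck_transformation p h -> deck_transformation p h' ->
  h y = h' y -> h =1 h'.
Proof.
move=> dh dh' hy z; have [l pl] := Mt_sc.1 y z.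
have [pl1 e1] := deck_path dh pl; have [pl2 e2] := deck_path dh' pl.
rewrite -hy in pl2; apply: (lift_unique2 (g := p \o l) pl1 pl2) => //.
have [_ _ ph] := dh; rewrite !ph; apply: is_path_comp pl _ => t _.
exact: cover_cont.
Qed.

Lemma deck_comp h h' : deck_transformation p h -> deck_transformation p h' ->
  deck_transformation p (h \o h').
Proof.
move=> [ch [k [ck hk kh]] ph] [ch' [k' [ck' hk' kh']] ph']; split.
- by move=> y; apply: continuous_comp; [exact: ch' | exact: ch].
- exists (k' \o k); split.
  + by move=> y; apply: continuous_comp; [exact: ck | exact: ck'].
  + exact: can_comp.
  + exact: can_comp.
- by move=> y; rewrite /= ph ph'.
Qed.

Variables (y0 : Mt) (act : (R -> M) -> Mt -> Mt).
Hypothesis act_by : forall g, is_loop (p y0) g -> pi1_acts_by p y0 g (act g).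

Lemma act_deck g : is_loop (p y0) g -> deck_transformation p (act g).
Proof. by move=> /act_by[]. Qed.

(** The lift of the concatenation from [y0] is the lift of [g1] followed by the image under [act g1]
    of the lift of [g2], so it ends at [act g1 (act g2 y0)]. *)
Lemma act_concat g1 g2 : is_loop (p y0) g1 -> is_loop (p y0) g2 ->
  act (path_concat g1 g2) =1 act g1 \o act g2.
Proof.
move=> l1 l2; have l12 := is_path_concat l1 l2.
have [d1 [f1 pf1 gf1]] := act_by l1; have [d2 [f2 pf2 gf2]] := act_by l2.
have [d12 [f12 pf12 gf12]] := act_by l12.
apply: (deck_unique (y := y0)) => //; first exact: deck_comp.
have [pf ef] := deck_path d1 pf2.
apply: (lift_unique2 (g := path_concat g1 g2) pf12 (is_path_concat pf1 pf)) => //.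
  move=> t; rewrite in_itv/= => /andP[t0 t1]; rewrite /path_concat; case: leP => th.
    by rewrite gf1// in_itv/=; apply/andP; split; lra.
  by rewrite ef gf2// in_itv/=; apply/andP; split; lra.
by have [_ _ ->] := d12.
Qed.

(** For a path [l] from [y0] to [y], lifting its projection backwards from [y'] leads to a point [z]
    over [p y0]. The projection of a path from [y0] to [z] is the required loop: its deck
    transformation sends [y0] to [z], hence [l] to a path from [z] to [y']. *)
Lemma act_transitive y y' : p y = p y' -> exists2 g, is_loop (p y0) g & act g y = y'.
Proof.
move=> yy'; have [V [tau Vtau]] := sheets_cover p_cover.
pose S := cover_transport Vtau.
have [l pl] := Mt_sc.1 y0 y.
have ppl : is_path (p y0) (p y) (p \o l).
  by apply: is_path_comp pl _ => t _; exact: cover_cont.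
have [z cz] := carries_ex (S := S) (e := y') (is_path_rev ppl) (esym yy').
have cz' : carries (S := S) (p \o l) z y'.
  have := carries_rev cz; congr carries; apply/funext => t.
  by rewrite /path_rev/=; congr (p (l _)); ring.
have pz : p z = p y0 by have [_] := carries_pr cz; rewrite /path_rev/= subrr; case: pl => _ ->.
have [m pm] := Mt_sc.1 y0 z.
have lm : is_loop (p y0) (p \o m).
  by rewrite /is_loop -{2}pz; apply: is_path_comp pm _ => t _; exact: cover_cont.
have [dm [f pf gf]] := act_by lm.
have az : act (p \o m) y0 = z.
  by apply/esym; apply: (lift_unique2 (g := p \o m) pm pf) => //; rewrite pz.
exists (p \o m) => //.
have [pa ea] := deck_path dm pl; rewrite az in pa.
have := carries_path Vtau pa (fun t _ => ea t).
by move=> /(carries_unique ppl); apply.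
Qed.

(** The two deck transformations coincide everywhere, so the lifts of [g] and [g'] from [y0] have
    the same end; they are homotopic in [Mt], and the homotopy is projected. *)
Lemma act_free g g' y : is_loop (p y0) g -> is_loop (p y0) g' -> act g y = act g' y ->
  path_homotopic g g'.
Proof.
move=> lg lg' E; have [d [f pf gf]] := act_by lg; have [d' [f' pf' gf']] := act_by lg'.
have E0 := deck_unique d d' E y0; rewrite -E0 in pf'.
have [H [cH H0 H1 H01]] := simply_connected_homotopic Mt_sc pf pf'.
have i0 : (0 : R) \in `[0, 1] by rewrite in_itv/= lexx ler01.
have i1 : (1 : R) \in `[0, 1] by rewrite in_itv/= lexx ler01.
exists (p \o H); split.
- apply/subspace_continuousP => z z01; move/subspace_continuousP : cH => /(_ z z01) cH.
  have cp : {for H z, continuous p} by exact: cover_cont.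
  exact: (@cvg_comp _ _ _ H p _ _ _ cH cp).
- by move=> t it; rewrite /= H0// gf.
- by move=> t it; rewrite /= H1// gf'.
- by move=> s is_; have [/= -> ->] := H01 s is_; rewrite !gf.
Qed.

End Deck.

(** * Locally finite families of bump functions *)

Section Bump.
Context (R : realType) (n : nat) (M : manifold R n).
Notation rV := 'rV[R]_n.
Notation rng a := (chart_rng (atlas a)).
Notation dom a := (chart_dom (atlas a)).
Notation inv a := (chart_inv (atlas a)).

Definition cube_bump (c : rV) (r : R) (x : rV) : R :=
  \prod_(j < n) flat 0 (r ^+ 2 - (x 0 j - c 0 j) ^+ 2).

Lemma cube_bump_ge0 c r x : 0 <= cube_bump c r x.
Proof. by apply: prodr_ge0 => j _; exact: flat_ge0. Qed.

Lemma cube_bump_center c r : 0 < r -> 0 < cube_bump c r c.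
Proof.
move=> r0; apply: prodr_gt0 => j _.
by rewrite flat0_gt0 subrr expr0n subr0 exprn_gt0.
Qed.

Lemma cube_bump_support c r x : 0 < r -> cube_bump c r x != 0 -> cube c r x.
Proof.
move=> r0 /eqP nz j; rewrite leNgt; apply/negP => rj; apply: nz.
rewrite /cube_bump (bigD1 j)//= (_ : flat 0 _ = 0) ?mul0r// /flat ifF//.
apply/negbTE; rewrite -leNgt subr_le0 -[leRHS]real_normK ?num_real// distrC.
by apply: lerXn2r; rewrite ?nnegrE// ltW// distrC.
Qed.

(** The last clause says that the closed support lies in [V], so that a product with a function
    controlled only over [V] is still controlled everywhere. *)
Definition bump_in (V : set M) (beta : M -> R) :=
  [/\ smooth_fun beta, forall z, 0 <= beta z, forall z, beta z != 0 -> V z &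
      forall z, ~ V z -> \forall z' \near z, beta z' = 0].

(** A bump in a chart is extended by zero. Its support lies in the image [K] of a closed cube,
    compact and hence closed in the Hausdorff space [M], so the extension vanishes near every point
    outside [K]. *)
Lemma bump_exists (V : set M) q : open V -> V q -> exists beta, bump_in V beta /\ 0 < beta q.
Proof.
move=> oV Vq; have [a aq] := atlas_cover q.
have [i [ia ic iq iV]] := patch_exists oV Vq aq.
pose c := patch_center i; pose r := patch_radius i / 2.
have r0 : 0 < r by rewrite divr_gt0 ?patch_radius_gt0.
have cr x : cube c r x -> ball c (patch_radius i) x.
  move=> cx; apply/ball_rV; split=> [|j]; first exact: patch_radius_gt0.
  by apply: le_lt_trans (cx j) _; have := patch_radius_gt0 i; rewrite /r; lra.
have rngc x : cube c r x -> rng a x by move=> /cr; rewrite -ia; exact: patch_sub.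
pose K := inv a @` cube c r.
have K_closed : closed K.
  apply: compact_closed; first exact: manifold_hausdorff.
  apply: continuous_compact (@cube_compact R n c r).
  apply/subspace_continuousP => x /rngc ax.
  have ci : {for x, continuous (inv a)} := inv_cont ax.
  by apply: cvg_trans ci; apply: cvg_app; exact: cvg_within.
have KV : K `<=` V.
  move=> _ [x cx <-]; apply: iV; rewrite /patch_dom/= ia; split.
    by apply: chart_inv_dom; exact: rngc.
  by rewrite chart_invK; [exact: cr | exact: rngc].
pose beta z := if pselect (dom a z) then cube_bump c r (atlas a z) else 0.
have betaK z : beta z != 0 -> K z.
  rewrite /beta; case: pselect => [az|naz]; last by rewrite eqxx.
  by move=> /(cube_bump_support r0) cz; exists (atlas a z) => //; rewrite chart_mapK.
have nK z : ~ K z -> \forall z' \near z, beta z' = 0.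
  move=> nKz; apply: nearS (near_open (closed_openC K_closed) nKz) => z' nKz'.
  by apply/eqP; apply: contra_notT nKz' => /betaK.
exists beta; split; last first.
  by rewrite /beta; case: pselect => [az|naz]/=; rewrite ?eqxx//; rewrite -ic; exact: cube_bump_center.
split.
- apply/smooth_funE => b x bx; have [Kz|nKz] := pselect (K (inv b x)); last first.
    apply: (smooth_at_congr _ (smooth_at_cst (0 : R) x)).
    by apply: nearS (near_comp (inv_cont bx) (nK _ nKz)) => z ->.
  have az : dom a (inv b x) by case: Kz => y cy <-; apply: chart_inv_dom; exact: rngc.
  have sT j : smooth_at (fun z => atlas a (inv b z) 0 j) x.
    exact: (smooth_on_at j openT (smooth_on_id M) bx I az).
  apply: (@smooth_at_congr _ _ (fun z => \prod_(j < n)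
      flat 0 (r ^+ 2 - (atlas a (inv b z) 0 j - c 0 j) * (atlas a (inv b z) 0 j - c 0 j)))).
    apply: nearS (near_comp (inv_cont bx) (near_chart_dom az)) => z az'.
    by rewrite /beta; case: pselect.
  apply: smooth_at_prod => j; apply: smooth_at_flat.
  apply: smooth_atB; first exact: smooth_at_cst.
  by apply: smooth_atM; (apply: smooth_atB; [exact: sT | exact: smooth_at_cst]).
- by move=> z; rewrite /beta; case: pselect => [az|naz]/=; rewrite ?eqxx//; exact: cube_bump_ge0.
- by move=> z /betaK /KV.
- by move=> z nVz; apply: nK => /KV.
Qed.

Lemma smooth_fun_cont (f : M -> R) : smooth_fun f -> continuous f.
Proof.
move=> /smooth_funE sf q; have [a aq] := atlas_cover q.
have ax := chart_map_rng aq.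
have cf : {for atlas a q, continuous (fun x => f (inv a x))}.
  by apply: C1_continuous; apply: smooth_at_C1; exact: sf.
have cfa : {for q, continuous (fun z => f (inv a (atlas a z)))}.
  exact: (@continuous_comp _ _ _ (atlas a) (fun x => f (inv a x)) q (chart_cont aq) cf).
have E : \forall z \near q, f (inv a (atlas a z)) = f z.
  by apply: nearS (near_chart_dom aq) => z az; rewrite chart_mapK.
have := near_cvg E cfa; rewrite /= chart_mapK//.
Qed.

(** The Lindelöf property: for each member of a countable base contained in some [W q], one such [q]
    is kept; [q0] fills the indices that correspond to none. *)
Lemma countable_cover (q0 : M) (W : M -> set M) : (forall q, open (W q)) -> (forall q, W q q) ->
  exists c : nat -> M, forall z, exists k, W (c k) z.
Proof.
move=> oW Wq; have [B /countable_injP[f finj] [oB bB]] := @manifold_second_countable R n M.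
have /choice[c Hc] : forall k, exists q, forall b, B b -> f b = k ->
    (exists q', b `<=` W q') -> b `<=` W q.
  move=> k; have [[b [Bb fb [q' bq']]]|H] := pselect (exists b, [/\ B b, f b = k & exists q', b `<=` W q']).
    by exists q' => b' Bb' fb' _; rewrite (finj b' b) ?inE// fb'.
  by exists q0 => b Bb fb Hb; exfalso; apply: H; exists b.
exists c => z.
have [b [Bb bz] bW] := bB z (W z) (near_open (oW z) (Wq z)).
by exists (f b); apply: (Hc (f b) b) => //; exists z.
Qed.

Lemma smooth_fun_flat (f : M -> R) (e : R) : smooth_fun f -> smooth_fun (fun z => flat 0 (e - f z)).
Proof.
move=> /smooth_funE sf; apply/smooth_funE => a x ax; apply: smooth_at_flat.
by apply: smooth_atB; [exact: smooth_at_cst | exact: sf].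
Qed.

Lemma smooth_funM (f g : M -> R) : smooth_fun f -> smooth_fun g -> smooth_fun (fun z => f z * g z).
Proof.
move=> /smooth_funE sf /smooth_funE sg; apply/smooth_funE => a x ax.
by apply: smooth_atM; [exact: sf | exact: sg].
Qed.

Lemma smooth_fun_prod k (f : 'I_k -> M -> R) : (forall j, smooth_fun (f j)) ->
  smooth_fun (fun z => \prod_j f j z).
Proof.
move=> sf; apply/smooth_funE => a x ax; apply: smooth_at_prod => j.
by move/smooth_funE : (sf j); apply.
Qed.

(* The unnormalised partition: the [k]-th function is cut off where an earlier
   bump exceeds [1 / (k + 1)], which makes the family locally finite without
   any compactness argument. *)
Lemma partition_exists (q0 : M) (V : M -> set M) : (forall q, open (V q)) -> (forall q, V q q) ->
  exists (c : nat -> M) (g : nat -> M -> R),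
    [/\ forall k, bump_in (V (c k)) (g k),
        forall z : M, exists k, 0 < g k z &
        forall z : M, exists N, \forall z' \near z, forall k, (N <= k)%N -> g k z' = 0].
Proof.
move=> oV Vq; have /choice[be Hbe] := fun q => bump_exists (oV q) (Vq q).
have cbe q : continuous (be q) by apply: smooth_fun_cont; case: (Hbe q) => [[]].
have [|q|c Hc] := @countable_cover q0 (fun q => [set z | 0 < be q z]).
- by move=> q; apply: open_comp (@open_gt R 0) => z _; exact: cbe.
- exact: (Hbe q).2.
have be_ge0 k z : 0 <= be (c k) z by case: (Hbe (c k)) => [[_ + _ _] _]; apply.
pose cut k (j : 'I_k) z : R := flat 0 (k.+1%:R^-1 - be (c j) z).
exists c, (fun k z => be (c k) z * \prod_(j < k) cut k j z); split.
- move=> k; have [[sb _ Vb nb] _] := Hbe (c k); split.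
  + apply: smooth_funM => //; apply: smooth_fun_prod => j; apply: smooth_fun_flat.
    by case: (Hbe (c j)) => [[]].
  + by move=> z; rewrite mulr_ge0//; apply: prodr_ge0 => j _; exact: flat_ge0.
  + by move=> z; rewrite mulf_eq0 negb_or => /andP[/Vb].
  + by move=> z /nb; apply: nearS => z' ->; rewrite mul0r.
(* At the first bump that is positive at [z] all earlier ones vanish, so every cut-off is
   positive. *)
- move=> z; have [k k0 kmin] := ex_minnP (Hc z).
  exists k; rewrite mulr_gt0//; apply: prodr_gt0 => j _; rewrite /cut flat0_gt0.
  have -> : be (c j) z = 0.
    apply/eqP; rewrite eq_le be_ge0 andbT leNgt; apply/negP => /kmin.
    by rewrite leqNgt ltn_ord.
  by rewrite subr0 invr_gt0 ltr0n.
- move=> z; have [i bi] := Hc z.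
  have [N HN] : exists N : nat, N.+1%:R^-1 < be (c i) z / 2.
    have e0 : 0 < be (c i) z / 2 by rewrite divr_gt0.
    by exists (Num.truncn (be (c i) z / 2)^-1); rewrite invf_plt ?posrE ?ltr0n// truncnS_gt.
  (* From [i.+1] on the bump [i] is among the cut-offs, and from [N] on the threshold lies below
     half of its value at [z]. *)
  exists (maxn N i.+1).
  have nb : \forall z' \near z, `|be (c i) z - be (c i) z'| < be (c i) z / 2.
    by apply: near_dist; [exact: cbe | rewrite divr_gt0].
  apply: nearS nb => z' bz' k; rewrite geq_max => /andP[Nk ik].
  rewrite (bigD1 (Ordinal ik))//= /cut/= (_ : flat 0 _ = 0) ?mul0r ?mulr0//.
  rewrite /flat ifF//; apply/negbTE; rewrite -leNgt subr_le0.
  apply: (@le_trans _ _ N.+1%:R^-1); first by rewrite lef_pV2 ?posrE ?ltr0n// ler_nat.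
  apply: (le_trans (ltW HN)); move: bz'; rewrite ltr_norml => /andP[_].
  by rewrite ltrBlDr -ltrBlDl [X in X - _]splitr addrK => /ltW.
Qed.

End Bump.

(** * From representations to twisted cocycles *)

Section SecondAssertion.
Context (R : realType) (n : nat).
Variables (M Mt : manifold R n) (p : Mt -> M) (y0 : Mt).
Hypotheses (p_cover : smooth_covering p) (Mt_sc : simply_connected R Mt).
Notation rV := 'rV[R]_n.
Notation e_ i := (delta_mx 0 i : rV).
Notation rng a := (chart_rng (atlas a)).
Notation dom a := (chart_dom (atlas a)).
Notation inv a := (chart_inv (atlas a)).
Notation x0 := (p y0).

Variables (act : (R -> M) -> Mt -> Mt) (rho b : (R -> M) -> R).
Hypothesis act_by : forall g, is_loop x0 g -> pi1_acts_by p y0 g (act g).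
Hypothesis b_homotopy : forall g g', is_loop x0 g -> is_loop x0 g' ->
  path_homotopic g g' -> b g = b g'.
Hypothesis b_concat : forall g g', is_loop x0 g -> is_loop x0 g' ->
  b (path_concat g g') = b g + (rho g)^-1 * b g'.

Variables (V : M -> set M) (tau : M -> Mt -> M -> Mt).
Hypothesis Vtau : forall q, V q q /\ sheets p (V q) (tau q).
Let sh q := (Vtau q).2.

Let p_act g y : is_loop x0 g -> p (act g y) = p y.
Proof. by move=> /(act_deck act_by)[_ _]; apply. Qed.

Let act_cont g : is_loop x0 g -> continuous (act g).
Proof. by move=> /(act_deck act_by)[]. Qed.

Let b_act g g' y : is_loop x0 g -> is_loop x0 g' -> act g y = act g' y -> b g = b g'.
Proof. by move=> lg lg' E; apply: b_homotopy => //; exact: (act_free p_cover Mt_sc act_by lg lg' E). Qed.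

(** A deck transformation takes a local section to a local section, and such sections are determined
    near [q] by one value. *)
Lemma act_tau g e i i' q : is_loop x0 g -> V i (p e) -> V i q -> V i' q ->
  \forall q' \near q, act g (tau i e q') = tau i' (act g (tau i e q)) q'.
Proof.
move=> lg Ve Vq Vq'.
have pe : p (act g (tau i e q)) = q by rewrite p_act// (sheets_pr (sh i)).
apply: (sheet_lift_unique Vtau (z := fun q => act g (tau i e q))).
- by rewrite pe.
- exact: Vq'.
- apply: (@continuous_comp _ _ _ (tau i e) (act g)); first exact: (sheets_cont (sh i)).
  exact: act_cont.
- by rewrite -[X in tau i' _ X]pe (sheets_id (sh i')) ?pe.
- apply: nearS (near_open (sheets_open (sh i)) Vq) => q1 Vq1.
  by rewrite p_act// (sheets_pr (sh i)).
Qed.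

Definition deck_loop_spec (lp : Mt -> Mt -> (R -> M)) := forall y y', p y = p y' ->
  is_loop x0 (lp y y') /\ act (lp y y') y = y'.

Lemma deck_loop_exists : exists lp, deck_loop_spec lp.
Proof.
have /choice[F HF] : forall z : Mt * Mt, exists g, p z.1 = p z.2 -> is_loop x0 g /\ act g z.1 = z.2.
  move=> [y y'] /=; have [E|nE] := pselect (p y = p y'); last by exists (fun=> x0).
  by have [g lg gE] := act_transitive p_cover Mt_sc act_by E; exists g.
by exists (fun y y' => F (y, y')) => y y' E; exact: HF.
Qed.

Lemma sum_truncate (u : nat -> R) m m' : (forall k, (m <= k)%N -> u k = 0) ->
  (forall k, (m' <= k)%N -> u k = 0) -> \sum_(k < m) u k = \sum_(k < m') u k.
Proof.
wlog mm' : m m' / (m <= m')%N.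
  by move=> W; have [?|/ltnW ?] := leqP m m' => H H'; [exact: W|apply/esym; exact: W].
move=> H _; rewrite -!(big_mkord xpredT u) [RHS](big_cat_nat _ mm')//=.
have -> : \sum_(m <= k < m') u k = 0.
  by rewrite big_nat big1// => k /andP[mk _]; exact: H.
by rewrite addr0.
Qed.

(** Over [V (c k)], [b] of the loop that moves a chosen sheet to [y] is locally constant in [y], and
    the cocycle identity gives it the transformation law. Smoothness of the average is stated in
    charts of [M] through sheets, as the form will be built there. *)
Lemma equivariant_function_exists : exists h : Mt -> R,
  (forall g y, is_loop x0 g -> h (act g y) = b g + (rho g)^-1 * h y) /\
  forall y i a, V i (p y) -> dom a (p y) ->
    smooth_at (fun x => h (tau i y (inv a x))) (atlas a (p y)).
Proof.
have oV q : open (V q) := sheets_open (sh q).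
have [c [g [bg gpos gfin]]] := partition_exists x0 oV (fun q => (Vtau q).1).
have /choice[N HN] := gfin; have [lp Hlp] := deck_loop_exists.
have /choice[s0 Hs0] : forall q, exists y, p y = q.
  by move=> q; have [_ /seteqP[_ /(_ q I)[y _ yq]] _] := p_cover; exists y.
pose s k q := tau (c k) (s0 (c k)) q.
have Vs0 k : V (c k) (p (s0 (c k))) by rewrite Hs0; exact: (Vtau _).1.
have ps k q : V (c k) q -> p (s k q) = q by move=> Vq; rewrite /s (sheets_pr (sh _)).
(* Where [p y] is outside [V (c k)] this value is arbitrary, but it is always multiplied by the
   weight [g k], which vanishes there. *)
pose hh k y := b (lp (s k (p y)) y).
have hhE k y g1 : V (c k) (p y) -> is_loop x0 g1 -> act g1 (s k (p y)) = y -> hh k y = b g1.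
  move=> Vy l1 E; have [l2 E2] := Hlp (s k (p y)) y (ps k _ Vy).
  by apply: (b_act l2 l1 (y := s k (p y))); rewrite E2.
have hh_act k y g1 : V (c k) (p y) -> is_loop x0 g1 ->
    hh k (act g1 y) = b g1 + (rho g1)^-1 * hh k y.
  move=> Vy l1; have [l2 E2] := Hlp (s k (p y)) y (ps k _ Vy).
  rewrite (hhE k _ (path_concat g1 (lp (s k (p y)) y))) ?p_act//.
  - by rewrite b_concat.
  - exact: is_path_concat l1 l2.
  - by rewrite (act_concat p_cover Mt_sc act_by l1 l2)/= E2.
have hh_loc k y i : V i (p y) -> V (c k) (p y) ->
    \forall q \near p y, hh k (tau i y q) = hh k y.
  move=> Vi Vk; have [l2 E2] := Hlp (s k (p y)) y (ps k _ Vk).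
  have := act_tau l2 (Vs0 k) Vk Vi; rewrite -/(s k (p y)) E2 => nb.
  have nV := nearI (near_open (oV i) Vi) (near_open (oV (c k)) Vk).
  apply: nearS2 nV nb => q [Viq Vkq] E.
  have pq : p (tau i y q) = q by rewrite (sheets_pr (sh i)).
  by apply: hhE; rewrite ?pq.
have g0V k q : ~ V (c k) q -> g k q = 0.
  by move=> nV; have [_ _ _ /(_ q nV) /near_self] := bg k.
have gN q k : (N q <= k)%N -> g k q = 0 by exact: near_self (HN q) k.
pose G q := \sum_(k < N q) g k q.
have G0 q : G q != 0.
  have [k gk] := gpos q; have [kN|Nk] := ltnP k (N q); last by rewrite gN ?ltxx in gk.
  rewrite /G (bigD1 (Ordinal kN))//= gt_eqF// ltr_pwDl// sumr_ge0// => j _.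
  by have [_ + _ _] := bg j; apply.
pose h y := (\sum_(k < N (p y)) g k (p y) * hh k y) / G (p y).
exists h; split.
  move=> g1 y l1; rewrite /h p_act//.
  have -> : \sum_(k < N (p y)) g k (p y) * hh k (act g1 y) =
      \sum_(k < N (p y)) (g k (p y) * b g1 + (rho g1)^-1 * (g k (p y) * hh k y)).
    apply: eq_bigr => k _; have [Vk|nVk] := pselect (V (c k) (p y)).
      by rewrite hh_act// mulrDr mulrCA.
    by rewrite g0V// !mul0r mulr0 addr0.
  rewrite big_split/= -mulr_suml -mulr_sumr -/(G (p y)) mulrDl mulrAC (divff (G0 _)) mul1r.
  by rewrite -mulrA.
move=> y i a Vi ay; set m := N (p y).
(* The number of summands in [h] varies with the base point; near [p y] it can be frozen at [m]. *)
have near_sum (u : nat -> M -> R) : \forall q \near p y,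
    \sum_(k < N q) g k q * u k q = \sum_(k < m) g k q * u k q.
  apply: nearS (HN (p y)) => q Hq; apply: (sum_truncate (u := fun k => g k q * u k q)) => k Hk; first by rewrite gN ?mul0r.
  by rewrite Hq ?mul0r.
have near_h : \forall q \near p y, h (tau i y q) =
    (\sum_(k < m) g k q * hh k y) / \sum_(k < m) g k q.
  have nb : \forall q \near p y, forall k : 'I_m, g k q * hh k (tau i y q) = g k q * hh k y.
    apply: near_forall => k; have [Vk|nVk] := pselect (V (c k) (p y)).
      by apply: nearS (hh_loc k y i Vi Vk) => q ->.
    have [_ _ _ /(_ _ nVk)] := bg k.
    by apply: nearS => q ->; rewrite !mul0r.
  have n1 := near_sum (fun k q => hh k (tau i y q)).
  have n2 := near_sum (fun _ _ => 1).
  apply: nearS2 (nearI nb (near_open (oV i) Vi)) (nearI n1 n2) => q [Eq Vq] [E1 E2].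
  rewrite /h (sheets_pr (sh i))// E1 /G; congr (_ / _); first by apply: eq_bigr => k _; exact: Eq.
  have -> : \sum_(k < N q) g k q = \sum_(k < N q) g k q * 1 by apply: eq_bigr => k _; rewrite mulr1.
  by rewrite E2; apply: eq_bigr => k _; rewrite mulr1.
have ra := chart_map_rng ay.
have sg k : smooth_at (fun x => g k (inv a x)) (atlas a (p y)).
  by have [/smooth_funE sgk _ _ _] := bg k; exact: sgk.
have near_h' : \forall q \near inv a (atlas a (p y)), h (tau i y q) =
    (\sum_(k < m) g k q * hh k y) / \sum_(k < m) g k q by rewrite chart_mapK.
apply: (@smooth_at_congr _ _ (fun x => (\sum_(k < m) g k (inv a x) * hh k y) *
    (\sum_(k < m) g k (inv a x))^-1)).
  by apply: nearS (near_comp (inv_cont ra) near_h') => x ->.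
apply: smooth_atM.
  by apply: smooth_at_sum => k _; apply: smooth_atM => //; exact: smooth_at_cst.
apply: smooth_at_inv; last exact: smooth_at_sum.
by rewrite chart_mapK//; exact: G0.
Qed.

End SecondAssertion.

(** * The twisted cocycle of an equivariant function *)

Section TwistedForm.
Context (R : realType) (n : nat).
Variables (M Mt : manifold R n) (p : Mt -> M) (y0 : Mt).
Hypotheses (p_cover : smooth_covering p) (Mt_sc : simply_connected R Mt).
Notation rV := 'rV[R]_n.
Notation e_ i := (delta_mx 0 i : rV).
Notation rng a := (chart_rng (atlas a)).
Notation dom a := (chart_dom (atlas a)).
Notation inv a := (chart_inv (atlas a)).
Notation x0 := (p y0).

Variables (theta : form1 M) (f : Mt -> R).
Hypotheses (theta_form : is_form1 theta) (theta_closed : closed1 theta).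
Hypotheses (f_smooth : smooth_fun f) (f_pb : is_pullback p theta (d0 f)).

Variables (act : (R -> M) -> Mt -> Mt) (c : (R -> M) -> R).
Hypothesis act_by : forall g, is_loop x0 g -> pi1_acts_by p y0 g (act g).
Hypothesis f_act : forall g y, is_loop x0 g -> f (act g y) = f y + c g.

Variables (V : M -> set M) (tau : M -> Mt -> M -> Mt).
Hypothesis Vtau : forall q, V q q /\ sheets p (V q) (tau q).
Let sh q := (Vtau q).2.

Variables (b : (R -> M) -> R) (h : Mt -> R).
Hypothesis h_act : forall g y, is_loop x0 g -> h (act g y) = b g + (expR (c g))^-1 * h y.
Hypothesis h_smooth : forall y i a, V i (p y) -> dom a (p y) ->
  smooth_at (fun x => h (tau i y (inv a x))) (atlas a (p y)).

Variable sec : M -> Mt.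
Hypothesis secK : forall q, p (sec q) = q.

(* [exp(f) dh], which is invariant under the deck transformations. *)
Definition descended_form : form1 M := fun a x =>
  let q := inv a x in
  expR (f (sec q)) *: \row_j partial j (fun z => h (tau q (sec q) (inv a z))) x.
Local Notation w := descended_form.

(** Read through a sheet, [f] becomes a function in a chart of [M] with the known gradient
    [theta]. *)
Lemma f_local y i a : V i (p y) -> dom a (p y) -> exists (l : patch M) (phi : rV -> R) (C : R),
  [/\ patch_chart l = a, patch_dom l (p y), primitive_on l phi (fun j x => theta a x 0 j) &
      \forall x \near atlas a (p y), f (tau i y (inv a x)) = phi x + C].
Proof.
move=> Vi ay; have [l [la _ lq _]] := patch_exists openT I ay.
have /choice[phi Hphi] := fun l => closed_primitive l theta_form theta_closed.
exists l, (phi l), (f y - phi l (atlas a (p y))); split=> //.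
  by have := Hphi l; rewrite la.
have nf := phase_agree p_cover Hphi f_smooth f_pb lq.
have ct := sheets_cont (sh i) Vi Vi.
have ty : tau i y (p y) = y by rewrite (sheets_id (sh i)).
rewrite -{1}ty in nf; have nq := near_comp ct nf.
have ra := chart_map_rng ay.
have nV := near_open (sheets_open (sh i)) Vi.
have := nearI nq nV; rewrite -{1}(chart_mapK ay) => /(near_comp (inv_cont ra)) nx.
apply: nearS2 nx (near_rng ra) => x [+ Vx] ax.
rewrite (sheets_pr (sh i))// /patch_fun la (chart_invK ax) => E.
by rewrite addrCA E addrC subrK.
Qed.

(** The section [sec] is only a choice of points. Replacing its value by another lift amounts to a
    deck transformation, which divides [dh] by [exp(c g)] and multiplies [exp(f)] by it; so a fixed
    sheet may be used on a whole neighbourhood. *)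
Lemma descended_form_at y i a x : V i (p y) -> rng a x -> V i (inv a x) ->
  w a x = expR (f (tau i y (inv a x))) *: \row_j partial j (fun z => h (tau i y (inv a z))) x.
Proof.
move=> Vy ax Vx; set q := inv a x in Vx *.
have py1 : p (tau i y q) = q by rewrite (sheets_pr (sh i)).
have [g lg gE] := act_transitive p_cover Mt_sc act_by (etrans py1 (esym (secK q))).
have Vq : V q q := (Vtau q).1.
have nt := act_tau act_by Vtau lg Vy Vx Vq; rewrite gE in nt.
have nx := near_comp (inv_cont ax) nt.
have E j : partial j (fun z => h (tau q (sec q) (inv a z))) x =
    (expR (c g))^-1 * partial j (fun z => h (tau i y (inv a z))) x.
  have aq : dom a (p (tau i y q)) by rewrite py1; exact: chart_inv_dom.
  have Vi' : V i (p (tau i y q)) by rewrite py1.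
  have sh1 := h_smooth Vi' aq; rewrite py1 chart_invK// in sh1.
  have nV := near_comp (inv_cont ax) (near_open (sheets_open (sh i)) Vx).
  have {}sh1 : smooth_at (fun z => h (tau i y (inv a z))) x.
    by apply: smooth_at_congr sh1; apply: nearS nV => z Vz; rewrite (sheets_trans (sh i)).
  rewrite (@near_eq_partial _ _ _ (fun z => b g + (expR (c g))^-1 * h (tau i y (inv a z)))); last first.
    by apply: nearS nx => z <-; rewrite h_act.
  have d1 := derivableP (@smooth_at_derivable R n _ x j sh1).
  have d2 := @is_deriveZ _ _ _ _ (expR (c g))^-1 x (e_ j) _ d1.
  have d3 := @is_deriveD _ _ _ _ _ x (e_ j) _ _ (is_derive_cst (b g : R^o) x (e_ j)) d2.
  by rewrite {1}/partial (@derive_val _ _ _ _ _ _ _ d3) add0r.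
rewrite /w -/q -gE f_act// gE expRD; apply/rowP => j; rewrite !mxE E.
by rewrite mulrA -[_ * _ * (expR (c g))^-1]mulrA divff ?mulr1// lt0r_neq0// expR_gt0.
Qed.

Lemma descended_form_near y i a : V i (p y) -> dom a (p y) -> \forall x \near atlas a (p y),
  w a x = expR (f (tau i y (inv a x))) *: \row_j partial j (fun z => h (tau i y (inv a z))) x.
Proof.
move=> Vi ay; have ra := chart_map_rng ay.
have nV : \forall q \near inv a (atlas a (p y)), V i q.
  by rewrite chart_mapK//; exact: near_open (sheets_open (sh i)) Vi.
by apply: nearS2 (near_comp (inv_cont ra) nV) (near_rng ra) => x Vx ax; exact: descended_form_at.
Qed.

Lemma descended_is_form1 : is_form1 w.
Proof.
split=> [a j|a a' x ax a'x].
  apply: (CinftyE _ (@rng_open _ _ _ a)).2 => x ax.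
  pose y := sec (inv a x); have py : p y = inv a x := secK _.
  have Vy : V (p y) (p y) := (Vtau _).1.
  have ay : dom a (p y) by rewrite py; exact: chart_inv_dom.
  have [l [phi [C [la ly Hphi nf]]]] := f_local Vy ay.
  have sh1 := h_smooth Vy ay; have nw := descended_form_near Vy ay.
  have xE : atlas a (p y) = x by rewrite py chart_invK.
  rewrite xE in nf sh1 nw.
  have lx : ball (patch_center l) (patch_radius l) x by case: ly => _; rewrite la xE.
  apply: (@smooth_at_congr _ _ (fun z => expR (phi z + C) *
      partial j (fun z => h (tau (p y) y (inv a z))) z)).
    by apply: nearS2 nf nw => z Ef ->; rewrite !mxE Ef.
  apply: smooth_atM; last exact: smooth_at_partial.
  apply: smooth_at_exp; apply: smooth_atD; last exact: smooth_at_cst.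
  exact: (Hphi x lx).1.
set q := inv a x in a'x *; pose y := sec q; have py : p y = q := secK q.
have Vy : V q (p y) by rewrite py; exact: (Vtau _).1.
have a'y : dom a' (p y) by rewrite py.
pose T z := atlas a' (inv a z).
pose Hh z := h (tau q y (inv a' z)).
have sHh : smooth_at Hh (T x) by have := h_smooth Vy a'y; rewrite py.
have dT i k : derivable (fun z => T z 0 k : R^o) x (e_ i).
  by apply: smooth_at_derivable; exact: (smooth_on_at k openT (smooth_on_id M) ax I a'x).
apply/rowP => i; rewrite /w -/q /idfun (chart_mapK a'x) !mxE.
have E : partial i (fun z => h (tau q (sec q) (inv a z))) x =
    \sum_k partial k Hh (T x) * partial i (fun z => T z 0 k) x.
  have D := chain_rule (smooth_at_C1 sHh) (dT i).
  rewrite -(@derive_val _ _ _ _ _ _ _ D); apply: near_eq_derive.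
  apply: nearS (near_comp (inv_cont ax) (near_chart_dom a'x)) => z a'z.
  by rewrite /Hh /T chart_mapK.
by rewrite E mulr_sumr; apply: eq_bigr => k _; rewrite !mxE mulrA.
Qed.

(** [d (exp(f) dh) = exp(f) df /\ dh], the second derivatives of [h] cancelling by symmetry, and
    [df] is the pullback of [theta]. *)
Lemma descended_form_closed : form2_zero (dtw1 theta w).
Proof.
move=> a x ax; pose y := sec (inv a x); have py : p y = inv a x := secK _.
have Vy : V (p y) (p y) := (Vtau _).1.
have ay : dom a (p y) by rewrite py; exact: chart_inv_dom.
have [l [phi [C [la ly Hphi nf]]]] := f_local Vy ay.
have sh1 := h_smooth Vy ay; have nw := descended_form_near Vy ay.
have xE : atlas a (p y) = x by rewrite py chart_invK.
rewrite xE in nf sh1 nw.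
have lx : ball (patch_center l) (patch_radius l) x by case: ly => _; rewrite la xE.
set Hh := fun z => h (tau (p y) y (inv a z)) in sh1 nw.
have wE j : \forall z \near x, w a z 0 j = expR (phi z + C) * partial j Hh z.
  by apply: nearS2 nf nw => z Ef ->; rewrite !mxE Ef.
have P i j : partial i (fun z => w a z 0 j) x =
    expR (phi x + C) * (theta a x 0 i * partial j Hh x + partial i (partial j Hh) x).
  rewrite (near_eq_partial i (wE j)).
  have dC : is_derive x (e_ i) (fun z => phi z + C : R^o) (theta a x 0 i).
    have := @is_deriveD _ _ _ _ _ x (e_ i) _ _ ((Hphi x lx).2 i) (is_derive_cst (C : R^o) x (e_ i)).
    by rewrite addr0.
  have dE := is_derive_expR_comp dC.
  have dP := derivableP (@smooth_at_derivable R n _ x i (smooth_at_partial j sh1)).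
  have D := @is_deriveM _ _ _ _ x (e_ i) _ _ dE dP.
  rewrite {1}/partial (@derive_val _ _ _ _ _ _ _ D) /GRing.scale/= mulrDr addrC.
  by congr (_ + _); rewrite mulrC mulrA.
move: P wE; move: w => W P wE.
apply/matrixP => i j; rewrite !mxE !P (near_self (wE i)) (near_self (wE j)).
rewrite (clairaut i j (sh1 2%N)).
move: (expR _) (theta a x 0 i) (theta a x 0 j) (partial i Hh x) (partial j Hh x)
  (partial i (partial j Hh) x) => ? ? ? ? ? ?; ring.
Qed.

(** For a twisted primitive [F], the function [h - exp(-f) F] on [Mt] has zero gradient and so is a
    constant [u]; the law for [b] is the comparison of its values at [y0] and [act g y0]. *)
Lemma descended_form_coboundary : twisted_coboundaries theta w ->
  exists u, forall g, is_loop x0 g -> b g = u - (expR (c g))^-1 * u.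
Proof.
move=> [F sF wF].
pose D y := h y - expR (- f y) * F (p y).
have D_loc y : \forall y' \near y, D y' = D y.
  have [a ay] := atlas_cover (p y); have ra := chart_map_rng ay.
  have Vy : V (p y) (p y) := (Vtau _).1; set i := p y in Vy.
  have [l [phi [C [la ly Hphi nf]]]] := f_local Vy ay.
  have nw := descended_form_near Vy ay; have sh1 := h_smooth Vy ay.
  have lx : ball (patch_center l) (patch_radius l) (atlas a (p y)) by case: ly => _; rewrite la.
  have nD : \forall q \near p y, D (tau i y q) = D (tau i y (p y)).
    apply: (near_const_of_gradient0 (f := fun q => D (tau i y q)) ay) => j.
    have nV : \forall q \near inv a (atlas a (p y)), V i q.
      by rewrite chart_mapK//; exact: near_open (sheets_open (sh i)) Vy.
    have nVx := near_comp (inv_cont ra) nV.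
    have n1 := nearI (near_near nf) (nearI (near_near nVx) nw).
    have n2 := nearI (near_rng ra) (nearI (ball_near lx) (smooth_at_near sh1)).
    apply: nearS2 n1 n2 => x [nfx [nVx1 wx]] [ax [bx C1h]].
    set Hh := fun z => h (tau i y (inv a z)) in wx C1h *.
    have dH : is_derive x (e_ j) (Hh : rV -> R^o) (partial j Hh x).
      by split=> //; exact: near_self (C1h.1 j).
    have dN : is_derive x (e_ j) (fun z => - (phi z + C) : R^o) (- theta a x 0 j).
      have d1 := @is_deriveD _ _ _ _ _ x (e_ j) _ _ ((Hphi x bx).2 j) (is_derive_cst (C : R^o) x (e_ j)).
      by have := @is_deriveN _ _ _ _ x (e_ j) _ d1; rewrite addr0.
    have sFx := (smooth_funE F).1 sF a x ax.
    have dF : is_derive x (e_ j) (fun z => F (inv a z) : R^o) (partial j (fun z => F (inv a z)) x).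
      by split=> //; exact: smooth_at_derivable.
    have dM := @is_deriveM _ _ _ _ x (e_ j) _ _ (is_derive_expR_comp dN) dF.
    have dD := @is_deriveB _ _ _ _ _ x (e_ j) _ _ dH dM.
    apply: (@near_eq_is_derive _ _ _ (fun z => Hh z - expR (- (phi z + C)) * F (inv a z) : R^o)).
      by apply: nearS2 nfx nVx1 => z Ef Vz; rewrite /D (sheets_pr (sh i))// Ef.
    move/is_derive_eq : dD; apply.
    have := wF a x ax; rewrite wx (near_self nfx) => /rowP /(_ j); rewrite !mxE => E.
    have EE : expR (- (phi x + C)) * expR (phi x + C) = 1 by rewrite -expRD addNr expR0.
    rewrite /GRing.scale/= -[partial j Hh x]mul1r -EE -[_ * _ * partial j Hh x]mulrA E.
    move: (expR (- (phi x + C))) (partial j (fun z => F (inv a z)) x) (F (inv a x)) (theta a x 0 j)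
      => ? ? ? ?; ring.
  have cp : {for y, continuous p} by exact: cover_cont.
  have := nearI (near_comp cp nD) (sheets_near (sh i) Vy).
  by apply: nearS => y' [+ E]; rewrite E (sheets_id (sh i)).
have D_const y : D y0 = D y.
  have [l [/within_clamp cl l0 l1]] := Mt_sc.1 y0 y.
  have := @locally_constant_eq R R (fun t => D (l (clamp t))).
  rewrite clamp0 clamp1 l0 l1; apply=> t.
  exact: (near_comp (cl t) (D_loc (l (clamp t)))).
exists (D y0) => g lg.
have pg : p (act g y0) = p y0 by have [_ _ ->] := act_deck act_by lg.
have := D_const (act g y0); rewrite /D pg h_act// f_act// opprD expRD !expRN.
move: (expR (c g))^-1 (expR (f y0))^-1 (h y0) (F (p y0)) => e1 e2 h0 F0 E.
have -> : b g = (b g + e1 * h0 - e2 * e1 * F0) - e1 * (h0 - e2 * F0) by ring.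
by rewrite -E.
Qed.

End TwistedForm.

(** * The twisted cocycle of an indecomposable representation *)

Section Conclusion.
Context (R : realType) (n : nat).
Variables (M Mt : manifold R n) (p : Mt -> M) (y0 : Mt).
Hypothesis p_universal : universal_cover p.
Variables (theta : form1 M) (rho : (R -> M) -> R).
Hypotheses (theta_form : is_form1 theta) (theta_closed : closed1 theta).
Hypothesis rho_assoc : assoc_rep p y0 theta rho.

Lemma rep_twisted_cocycle (xi : (R -> M) -> 'M[R]_2) :
  pi1_rep (p y0) xi -> ~ decomposable (p y0) xi ->
  (forall g, is_loop (p y0) g -> \det (xi g) = rho g) ->
  (forall g, is_loop (p y0) g -> xi g *m delta_mx 0 0 = delta_mx 0 0 :> 'cV[R]_2) ->
  twisted_H1_neq0 theta.
Proof.
move=> [_ xi_hom xi_concat] xi_indec xi_det xi_fix.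
have [p_cover Mt_sc] := p_universal.
have [f [act [c [f_smooth f_pb Hact]]]] := rho_assoc.
have act_by g (lg : is_loop (p y0) g) : pi1_acts_by p y0 g (act g) by have [] := Hact g lg.
have f_act g y (lg : is_loop (p y0) g) : f (act g y) = f y + c g by have [_ ->] := Hact g lg.
have rhoE g (lg : is_loop (p y0) g) : rho g = expR (c g) by have [_ _ ->] := Hact g lg.
have xiE g (lg : is_loop (p y0) g) : xi g = upper (xi g 0 1) (expR (c g)).
  by rewrite -rhoE// -xi_det//; apply: fix_upper; exact: xi_fix.
have c0 g : expR (c g) != 0 by rewrite lt0r_neq0// expR_gt0.
(* The upper right entry of [xi g] is [rho b]. Homotopy invariance and multiplicativity of
   [exp(c g)], needed for the cocycle identity, are read off the determinant of [xi]. *)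
pose b g := (expR (c g))^-1 * xi g 0 1.
have b_homotopy g g' : is_loop (p y0) g -> is_loop (p y0) g' -> path_homotopic g g' -> b g = b g'.
  move=> lg lg' hg; rewrite /b (xi_hom g g')//; congr (_^-1 * _).
  by rewrite -!rhoE// -!xi_det// (xi_hom g g').
have b_concat g g' : is_loop (p y0) g -> is_loop (p y0) g' ->
    b (path_concat g g') = b g + (expR (c g))^-1 * b g'.
  move=> lg lg'; have lgg := is_path_concat lg lg'.
  have := xi_concat g g' lg lg'; rewrite (xiE g lg) (xiE g' lg') mul_upper => E.
  have dE : expR (c (path_concat g g')) = expR (c g) * expR (c g').
    by rewrite -rhoE// -xi_det// E det_upper.
  rewrite /b dE E mxE/=; field.
  by rewrite !c0.
have [V [tau Vtau]] := sheets_cover p_cover.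
have [h [h_act h_smooth]] := equivariant_function_exists p_cover Mt_sc act_by b_homotopy b_concat Vtau.
have /choice[sec secK] : forall q, exists y, p y = q.
  by move=> q; have [_ /seteqP[_ /(_ q I)[y _ yq]] _] := p_cover; exists y.
exists (descended_form f tau h sec); first split.
- exact: (descended_is_form1 p_cover Mt_sc theta_form theta_closed f_smooth f_pb act_by f_act Vtau h_act h_smooth secK).
- exact: (descended_form_closed p_cover Mt_sc theta_form theta_closed f_smooth f_pb act_by f_act Vtau h_act h_smooth secK).
move=> /(descended_form_coboundary p_cover Mt_sc theta_form theta_closed f_smooth f_pb act_by f_act Vtau h_act h_smooth secK)[u Hu].
apply: xi_indec; apply/(decomposable_upperP xiE); exists u => g lg.
have := Hu g lg; rewrite /b => E.
by rewrite -[LHS](mulVKf (c0 g)) E mulrBr mulrBl mul1r mulVKf.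
Qed.

End Conclusion.

Theorem theorem2p3 (R : realType) (n : nat) (M : manifold R n)
    (M_connected : connected [set: M])
    (theta : form1 M) (theta_form : is_form1 theta)
    (theta_closed : closed1 theta) (theta_nonexact : ~ exact1 theta)
    (Mt : manifold R n) (p : Mt -> M) (p_universal : universal_cover p)
    (y0 : Mt) (rho : (R -> M) -> R) (rho_assoc : assoc_rep p y0 theta rho) :
  (twisted_H1_neq0 theta ->
     exists xi : (R -> M) -> 'M[R]_2,
       [/\ pi1_rep (p y0) xi,
           ~ decomposable (p y0) xi,
           forall g, is_loop (p y0) g -> \det (xi g) = rho g &
           forall g, is_loop (p y0) g ->
             xi g *m delta_mx 0 0 = delta_mx 0 0 :> 'cV[R]_2]) /\
  ((exists xi : (R -> M) -> 'M[R]_2,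
       [/\ pi1_rep (p y0) xi,
           ~ decomposable (p y0) xi,
           forall g, is_loop (p y0) g -> \det (xi g) = rho g &
           forall g, is_loop (p y0) g ->
             xi g *m delta_mx 0 0 = delta_mx 0 0 :> 'cV[R]_2]) ->
     twisted_H1_neq0 theta).
Proof.
have [p_cover Mt_sc] := p_universal; split.
  exact: (twisted_cocycle_rep p_cover Mt_sc theta_form theta_closed rho_assoc).
move=> [xi [xi_rep xi_indec xi_det xi_fix]].
exact: (rep_twisted_cocycle p_universal theta_form theta_closed rho_assoc xi_rep
  xi_indec xi_det xi_fix).
Qed.
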